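(* Let $\delta>0$ and $\beta\ge 0$, and consider, for $x\in\mathbb{S}^1$ and $t\ge0$, the equation $$2\varepsilon u_t=\mathcal{N}u_x+2\delta\mathcal{N}u_{xx}+\mathcal{N}\mathcal{H}u-\beta\mathcal{N}\mathcal{H}\partial_x^2u+\delta^2\mathcal{N}\partial_x^3u-\varepsilon\mathcal{N}\Big\{2uu_x+\Lambda[\mathcal{H},\Lambda^{-1}u]u+\beta\Lambda[\mathcal{H},\Lambda^{-1}u]\Lambda^2u-\delta\Lambda[\mathcal{H},u]u_x+\delta\partial_x(uu_x)+\delta\Lambda[\partial_x^2,\Lambda^{-1}u]u\Big\}\qquad(\ast)$$ with initial condition $u(x,0)=u_0(x)$. (i) Given an arbitrary zero-mean $u_0\in H^2$, there exists a unique local strong solution to $(\ast)$ $$u\in C([0,T^*],H^2)\cap L^2([0,T^*];H^3)$$ for a small enough $T^*$ depending only on $\|u_0\|_{H^2}$ and the physical parameters of the problem. (ii) Furthermore, there exists $c_0>0$ such that for any zero-mean $u_0\in H^2$ satisfying $\|u_0\|_{H^2}\le c_0$ there exists a unique global solution $u$ of $(\ast)$ stemming from the initial data $u_0$ which belongs to the energy space $$u\in C(\mathbb{R}_+;H^2)\cap L^2(\mathbb{R}_+;H^3).$$ Moreover, $$\|u\|_{A^0}\le C e^{-\frac{\delta}{2}t},$$ and $$\|u\|_{H^r}\le C e^{-C(\delta,r)t}\qquad\text{for all } r\in[0,2),$$ where the norms on the left-hand sides are those of $u(\cdot,t)$.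
   Context: $\mathbb{S}^1$ denotes the interval $[-\pi,\pi]$ with periodic boundary conditions and $\mathbb{R}_+=[0,\infty)$. $\hat f(k)$, $k\in\mathbb{Z}$, denote the Fourier coefficients of $f$ in $x$. The Hilbert transform $\mathcal{H}$ and the operator $\Lambda$ (square root of $-\partial_x^2$) are the Fourier multipliers $\widehat{\mathcal{H}f}(k)=-i\,\mathrm{sgn}(k)\hat f(k)$ and $\widehat{\Lambda f}(k)=|k|\hat f(k)$; powers $\Lambda^s$, including $\Lambda^{-1}$, have symbol $|k|^s$ for $k\neq0$ and act on zero-mean functions. The operator $\mathcal{N}=(1-\delta^2\partial_x^2)^{-1}(1-\delta\partial_x)$ is the Fourier multiplier with symbol $$\widehat{\mathcal{N}}(k)=\frac{1-\delta ik}{1+\delta^2|k|^2}.$$ For operators $A,B$, $[A,B]g=A(Bg)-B(Ag)$; when a function appears in a commutator it denotes the multiplication operator by that function. Thus, for example, $[\mathcal{H},\Lambda^{-1}u]u=\mathcal{H}\big((\Lambda^{-1}u)u\big)-(\Lambda^{-1}u)\mathcal{H}u$ and $[\partial_x^2,\Lambda^{-1}u]u=\partial_x^2\big((\Lambda^{-1}u)u\big)-(\Lambda^{-1}u)\partial_x^2u$. All functions have zero mean in $x$ (the equation preserves this property). For zero-mean functions the Sobolev space $H^s=H^s(\mathbb{S}^1)$ coincides with the homogeneous space $\dot H^s=\{f\in L^1:\Lambda^s f\in L^2\}$, with norm $\|f\|_{H^s}=\|\Lambda^s f\|_{L^2}$. The Wiener space $A^s$ is $\{f\in L^1:\widehat{\Lambda^s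 f}\in\ell^1\}$ with norm $\|f\|_{A^s}=\sum_{k}|k|^s|\hat f(k)|$; in particular $\|f\|_{A^0}=\sum_k|\hat f(k)|$ for zero-mean $f$. The equation $(\ast)$ is an asymptotic model of unidirectional viscous water waves. Its physical parameters are: $\varepsilon$, the steepness parameter, measuring the ratio between the amplitude and the wavelength; $\delta$, a dimensionless parameter reflecting the viscous effects; $\beta$, the Bond number, measuring the ratio between capillary and gravity forces. Convention on constants: $C$ denotes any positive constant independent of any physical parameter of the problem, whose explicit value may vary from line to line, while $C(\delta,r)$ is a positive constant depending on $\delta$ and $r$.
   Formalization: The steepness ε is taken positive, and the two decay estimates are stated only for ε ≤ 1; without an upper bound on ε they fail (e.g. ε = 4, β = 0, where the first Fourier mode decays more slowly than e^{-δt/2}). Existence and uniqueness are stated for all ε > 0. *)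

(* Defs.v *)
From HB Require Import structures.
From mathcomp Require Import all_boot all_order all_algebra.
From mathcomp Require Import complex.
From mathcomp Require Import all_classical all_reals all_analysis.
Set Implicit Arguments.
Unset Strict Implicit.
Unset Printing Implicit Defensive.
Import Order.TTheory GRing.Theory Num.Theory.
Import numFieldNormedType.Exports.
Import ComplexField.
Local Open Scope classical_set_scope.
Local Open Scope ring_scope.
Local Open Scope complex_scope.

Section Circle.
Variable R : realType.
Local Notation mu := (@lebesgue_measure R).

(* A function on the circle is represented by a function R -> R of which only
   the values on [-pi, pi] matter; equality is equality a.e. on [-pi, pi]. *)
Definition S1 : set R := `[- pi, pi].

Definition inLp (p : \bar R) (f : R -> R) : Prop := f \_ S1 \in Lfun mu p.

Definition L2norm (f : R -> R) : R := fine 'N[mu]_2%:E[EFin \o (f \_ S1)]%E.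

Definition ae_eqS1 (f g : R -> R) : Prop := ae_eq mu S1 f g.

Definition zero_mean (f : R -> R) : Prop := \int[mu]_(x in S1) f x = 0.

(* A periodic distribution is given by its sequence of Fourier coefficients. *)
Definition distr := int -> R[i].

(* (2 pi)^-1 times the integral of f(x) e^{-ikx} over [-pi, pi] *)
Definition fhat (f : R -> R) : distr := fun k =>
  ((2 * pi)^-1 * \int[mu]_(x in S1) (f x * cos (k%:~R * x))) +i*
  (- ((2 * pi)^-1 * \int[mu]_(x in S1) (f x * sin (k%:~R * x)))).

(* The integrable function, unique up to a.e. equality, with Fourier
   coefficients a; the zero function when there is none. *)
Definition funof (a : distr) : R -> R :=
  xget (cst 0) [set f | inLp 1%E f /\ fhat f = a].

(* Pointwise product of two distributions that are functions. *)
Definition dmul (a b : distr) : distr := fhat (fun x => funof a x * funof b x).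

Definition multiplier (m : int -> R[i]) (a : distr) : distr :=
  fun k => m k * a k.

Definition Dx : distr -> distr := multiplier (fun k => 'i%C * k%:~R).

Definition Hilb : distr -> distr :=
  multiplier (fun k => - 'i%C * (Num.sg k)%:~R).

(* The value 0 at k = 0 makes negative powers act on zero-mean data. *)
Definition Lam (s : R) : distr -> distr :=
  multiplier (fun k => if k == 0 then 0 else (`|k%:~R| `^ s)%:C).

Definition Nop (delta : R) : distr -> distr :=
  multiplier (fun k => (1 - delta%:C * 'i%C * k%:~R) /
                       (1 + delta%:C ^+ 2 * `|k|%:~R ^+ 2)).

Definition comm (A B : distr -> distr) (a : distr) : distr :=
  A (B a) - B (A a).

(* The equation is 2 eps u_t = rhs eps delta beta u.  For u in H^2 both factors
   of every product below have square integrable representatives, so that the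
   default value of funof is never used; the outer multipliers may produce
   distributions that are not functions. *)
Definition rhs (eps delta beta : R) (u : distr) : distr :=
  let N := Nop delta in
  let L := Lam 1 in
  let Lm1u := dmul (Lam (-1) u) in
  N (Dx u) + (2 * delta)%:C *: N (Dx (Dx u)) + N (Hilb u)
  - beta%:C *: N (Hilb (Dx (Dx u))) + (delta ^+ 2)%:C *: N (Dx (Dx (Dx u)))
  - eps%:C *: N (2 *: dmul u (Dx u)
                 + L (comm Hilb Lm1u u)
                 + beta%:C *: L (comm Hilb Lm1u (Lam 2 u))
                 - delta%:C *: L (comm Hilb (dmul u) (Dx u))
                 + delta%:C *: Dx (dmul u (Dx u))
                 + delta%:C *: L (comm (Dx \o Dx) Lm1u u)).

(* The zero-mean space H^s, with norm the L^2 norm of Lambda^s f. *)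
Definition inHs (s : R) (f : R -> R) : Prop :=
  [/\ inLp 1%E f, zero_mean f &
      exists2 g, inLp 2%:E g & fhat g = Lam s (fhat f)].

Definition Hnorm (s : R) (f : R -> R) : R := L2norm (funof (Lam s (fhat f))).

Definition Wnorm (s : R) (f : R -> R) : \bar R :=
  \esum_(k in [set: int]) (Normc.normc (Lam s (fhat f) k))%:E.

(* Time-dependent functions: u t is the function x |-> u(x,t). *)

Definition contHs (I : set R) (s : R) (u : R -> R -> R) : Prop :=
  (forall t, I t -> inHs s (u t)) /\
  (forall t, I t -> Hnorm s (u r \- u t) @[r --> within I (nbhs t)] --> 0).

Definition sqintHs (I : set R) (s : R) (u : R -> R -> R) : Prop :=
  {ae mu, forall t, I t -> inHs s (u t)} /\
  mu.-integrable I (fun t => (Hnorm s (u t) ^+ 2)%:E).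

(* g is the derivative at t of u : I -> L^2, one-sided at an endpoint of I. *)
Definition is_time_deriv (I : set R) (u : R -> R -> R) (t : R) (g : R -> R) :=
  inLp 2%:E g /\
  L2norm (fun x => (r - t)^-1 * (u r x - u t x) - g x)
    @[r --> within I t^'] --> 0.

Definition strong_solution (eps delta beta : R) (I : set R) (u0 : R -> R)
    (u : R -> R -> R) : Prop :=
  [/\ contHs I 2 u, sqintHs I 3 u, ae_eqS1 (u 0) u0 &
      forall t, I t -> exists2 ut, is_time_deriv I u t ut &
        (2 * eps)%:C *: fhat ut = rhs eps delta beta (fhat (u t))].

Definition unique_strong_solution (eps delta beta : R) (I : set R)
    (u0 : R -> R) (u : R -> R -> R) : Prop :=
  strong_solution eps delta beta I u0 u /\
  (forall v, strong_solution eps delta beta I u0 v ->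
     forall t, I t -> ae_eqS1 (v t) (u t)).

End Circle.

(* Main.v *)
(* On the side of Fourier coefficients the equation reads
   u_k' = A_k u_k + sum_j t(k, j) u_j u_(k-j) with - Re A_k >= nu + c k^2 for
   k <> 0, where nu = delta / (2 eps). The kernel t loses one derivative only:
   the multiplier N gains one, and in the commutators with H the difference
   sg k - sg m (m = k - j) vanishes unless |k|, |m| <= |j|. In the unknowns
   k^2 u_k, for which H^2 becomes l^2, the kernel is thus at most
   K |k| (j^-2 + m^-2), whose sum of squares over j is O(k^2).

   The factor |k| is absorbed by - Re A_k, so that Picard iteration on the Duhamel
   formula converges for small data, with the supremum in time taken inside the
   l^2 sum. After factoring out e^(- nu t) this gives the global solutions and
   their decay. For arbitrary data one factors out e^(rho t) instead, with rho so
   large that K |k| is small compared with rho + c k^2, on a time interval of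
   length 1 / rho.

   The coefficients of a strong solution are bounded in H^2 on compact time
   intervals, and the Duhamel formula improves this to an l^2 majorant uniform in
   time; the contraction estimate then gives uniqueness. *)

Require Import Defs.
From mathcomp Require Import all_boot all_order all_algebra.
From mathcomp Require Import complex.
From mathcomp Require Import all_classical all_reals all_analysis.
From mathcomp Require Import measurable_realfun.
From mathcomp Require Import ring lra zify.
Import Order.TTheory GRing.Theory Num.Theory.
Import numFieldNormedType.Exports.
Import ComplexField.
Set Implicit Arguments.
Unset Strict Implicit.
Unset Printing Implicit Defensive.
Local Open Scope classical_set_scope.
Local Open Scope ring_scope.
Local Open Scope complex_scope.

(** The linear part looks dispersive of third order, but D + 2 delta D^2 + delta^2 D^3 = (1 + delta
    D)^2 D, and N is inverse to 1 + delta D: one factor cancels and delta D^2 stays as dissipation.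
    With the supremum in time inside the l^2 sum, the majorants [M k] do not depend on t. Continuity
    in H^2 and the time derivative in L^2 then reduce to one scalar equation per mode and dominated
    convergence of series. Square integrability in time with values in H^3 is beyond such majorants:
    for the free evolution it holds because the integral of k^2 e^(-2 c k^2 t) over t >= 0 is
    bounded in k, and the quadratic part is in H^3 at every time, as Duhamel gains two derivatives
    and the kernel loses one. In [rhs] the products are pointwise products of functions chosen by
    [funof]. They become convolutions through the Riesz-Fischer theorem and the injectivity of
    Fourier coefficients on L^1, both proved below. The condition eps <= 1 in the decay statement
    means nu >= delta / 2. *)

Local Notation normc := Normc.normc.
Local Notation Re := complex.Re.
Local Notation Im := complex.Im.

(** * Sums over the integers *)

Section NonnegSums.
Variables (R : realType) (T : choiceType).
Implicit Types f g : T -> R.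

Definition nsum f : \bar R := \esum_(k in [set: T]) (f k)%:E.

(** For nonnegative [f] this says at once that the family is summable and that its sum is at most
    [B], so that no separate convergence hypothesis has to be carried along. *)
Definition sumle f (B : R) : Prop := (nsum f <= B%:E)%E.

Lemma nsum_ge0 f : (forall k, 0 <= f k) -> (0 <= nsum f)%E.
Proof. by move=> f0; apply: esum_ge0 => k _; rewrite lee_fin. Qed.

Lemma le_nsum f g : (forall k, f k <= g k) -> (nsum f <= nsum g)%E.
Proof. by move=> fg; apply: le_esum => k _; rewrite lee_fin. Qed.

Lemma eq_nsum f g : f =1 g -> nsum f = nsum g.
Proof. by move=> fg; apply: eq_esum => k _; rewrite fg. Qed.

Lemma nsum_ub f (B : \bar R) :
  (forall s : seq T, uniq s -> ((\sum_(k <- s) f k)%:E <= B)%E) -> (nsum f <= B)%E.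
Proof.
move=> H; apply: ge_ereal_sup => _ [X [Xf _] <-].
rewrite fsbig_finite //= sumEFin; exact: H.
Qed.

Lemma nsum_lb f (s : seq T) : (forall k, 0 <= f k) -> uniq s ->
  ((\sum_(k <- s) f k)%:E <= nsum f)%E.
Proof.
move=> f0 us; apply: esum_ge; exists [set` s].
  split => //; exact: finite_seq.
by rewrite -sumEFin fsbig_seq.
Qed.

Lemma nsum_lb1 f (k : T) : (forall k, 0 <= f k) -> ((f k)%:E <= nsum f)%E.
Proof. by move=> f0; have := @nsum_lb f [:: k] f0 isT; rewrite big_seq1. Qed.

Lemma nsumZ f c : (forall k, 0 <= f k) -> 0 <= c ->
  nsum (fun k => c * f k) = (c%:E * nsum f)%E.
Proof.
move=> f0; rewrite le_eqVlt => /predU1P[<-|c0].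
  by rewrite mul0e; apply: esum1 => k _; rewrite mul0r.
(* One inequality for all positive factors is enough: applied to [c * f] with the factor [c^-1] it
   gives the converse. *)
have H (h : T -> R) (d : R) : (forall k, 0 <= h k) -> 0 < d ->
    (nsum (fun k => d * h k)%R <= d%:E * nsum h)%E.
  move=> h0 d0; apply: nsum_ub => s us; rewrite -mulr_sumr EFinM.
  by rewrite lee_pmul2l//; exact: nsum_lb.
apply/eqP; rewrite eq_le H//=.
have cf k : 0 <= c * f k by rewrite mulr_ge0 // ltW.
have ci : 0 < c^-1 by rewrite invr_gt0.
have := H _ _ cf ci.
under eq_nsum do rewrite mulKf ?gt_eqF//.
by rewrite -(lee_pmul2l (x := c%:E))// muleA -EFinM divff ?gt_eqF// mul1e.
Qed.

Lemma nsumD f g : (forall k, 0 <= f k) -> (forall k, 0 <= g k) ->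
  nsum (fun k => f k + g k) = (nsum f + nsum g)%E.
Proof.
by move=> f0 g0; rewrite /nsum -esumD// => k _; rewrite lee_fin.
Qed.

Lemma sum_CS f g (s : seq T) :
  (\sum_(k <- s) f k * g k) ^+ 2 <=
  (\sum_(k <- s) f k ^+ 2) * (\sum_(k <- s) g k ^+ 2).
Proof.
set A := \sum_(k <- s) f k ^+ 2; set B := \sum_(k <- s) f k * g k.
set C := \sum_(k <- s) g k ^+ 2.
have H t : 0 <= A * t ^+ 2 - 2 * B * t + C.
  suff -> : A * t ^+ 2 - 2 * B * t + C = \sum_(k <- s) (f k * t - g k) ^+ 2.
    by apply: sumr_ge0 => k _; exact: sqr_ge0.
  rewrite /A /B /C mulr_sumr !mulr_suml -sumrB -big_split/=.
  by apply: eq_bigr => k _; ring.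
have A0 : 0 <= A by apply: sumr_ge0 => k _; exact: sqr_ge0.
have [A0'|An] := eqVneq A 0.
  have [->|Bn] := eqVneq B 0; first by rewrite A0' expr0n mul0r.
  (* For A = 0 the quadratic is affine in t, and at this point its value is -1. *)
  have := H ((C + 1) / (2 * B)).
  have -> : 2 * B * ((C + 1) / (2 * B)) = C + 1 by field.
  by rewrite A0' mul0r; lra.
have Ap : 0 < A by rewrite lt_def An.
have := H (B / A).
have -> : A * (B / A) ^+ 2 - 2 * B * (B / A) + C = (A * C - B ^+ 2) / A by field.
by rewrite pmulr_lge0 ?invr_gt0// subr_ge0.
Qed.

Lemma sumle_ub f (B : R) :
  (forall s : seq T, uniq s -> \sum_(k <- s) f k <= B) -> sumle f B.
Proof. by move=> H; apply: nsum_ub => s /H; rewrite lee_fin. Qed.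

Lemma sumle_lb f (B : R) (s : seq T) : (forall k, 0 <= f k) -> sumle f B ->
  uniq s -> \sum_(k <- s) f k <= B.
Proof.
by move=> f0 fB us; rewrite -lee_fin (le_trans _ fB)// nsum_lb.
Qed.

Lemma sumle_lb1 f (B : R) k : (forall k, 0 <= f k) -> sumle f B -> f k <= B.
Proof. by move=> f0 fB; rewrite -lee_fin (le_trans _ fB)// nsum_lb1. Qed.

Lemma sumle_ge0 f (B : R) : (forall k, 0 <= f k) -> sumle f B -> 0 <= B.
Proof. by move=> f0 fB; rewrite -lee_fin (le_trans _ fB)// nsum_ge0. Qed.

Lemma le_sumle f g (A B : R) : (forall k, f k <= g k) -> A <= B ->
  sumle g A -> sumle f B.
Proof.
move=> fg AB gA; apply: le_trans (le_nsum fg) _.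
by apply: le_trans gA _; rewrite lee_fin.
Qed.

Lemma sumleZ f c (A : R) : (forall k, 0 <= f k) -> 0 <= c ->
  sumle f A -> sumle (fun k => c * f k) (c * A).
Proof.
by move=> f0 c0 fA; rewrite /sumle nsumZ// EFinM lee_wpmul2l// lee_fin.
Qed.

Lemma sumleD f g (A B : R) : (forall k, 0 <= f k) -> (forall k, 0 <= g k) ->
  sumle f A -> sumle g B -> sumle (fun k => f k + g k) (A + B).
Proof. by move=> f0 g0 fA gB; rewrite /sumle nsumD// EFinD leeD. Qed.

Lemma sumle_CS f g A B : (forall k, 0 <= f k) -> (forall k, 0 <= g k) ->
  sumle (fun k => f k ^+ 2) A -> sumle (fun k => g k ^+ 2) B ->
  sumle (fun k => f k * g k) (Num.sqrt (A * B)).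
Proof.
move=> f0 g0 fA gB; apply: sumle_ub => s us.
have h : 0 <= \sum_(k <- s) f k * g k by apply: sumr_ge0 => k _; rewrite mulr_ge0.
rewrite -[leLHS]ger0_norm// -sqrtr_sqr; apply: ler_wsqrtr.
apply: le_trans (sum_CS _ _ _) _; apply: ler_pM.
- by apply: sumr_ge0 => k _; exact: sqr_ge0.
- by apply: sumr_ge0 => k _; exact: sqr_ge0.
- by apply: sumle_lb us => // k; exact: sqr_ge0.
- by apply: sumle_lb us => // k; exact: sqr_ge0.
Qed.

(** Dominated convergence for the counting measure, along an arbitrary filter. A finite set [s]
    carries all of the sum of [G] but e / 2; on [s] the limit is that of a finite sum, and off [s]
    the terms stay below the tail of [G]. *)
Lemma sumle_dominated (S : Type) (F : set_system S) (FF : Filter F)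
    (f : S -> T -> R) (G : T -> R) (B : R) :
  (\forall s \near F, forall k, 0 <= f s k <= G k) ->
  (forall k, f s k @[s --> F] --> 0) -> (forall k, 0 <= G k) ->
  sumle G B ->
  forall e, 0 < e -> \forall s \near F, sumle (f s) e.
Proof.
move=> fG f0 G0 GB e e0.
have Gfin : nsum G \is a fin_num.
  by rewrite ge0_fin_numE ?nsum_ge0// (le_lt_trans GB)// ltry.
have e20 : 0 < e / 2 by rewrite divr_gt0.
have [_ [A [Af _] <-] GA] := @ub_ereal_sup_adherent _ _ (e/2) e20 Gfin.
have /finite_seqP[s' As'] := Af.
pose s := undup s'.
have us : uniq s by exact: undup_uniq.
have GAs : (nsum G < (\sum_(k <- s) G k + e / 2)%:E)%E.
  rewrite EFinD -lteBlDr// (lt_le_trans GA)//.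
  have -> : A = [set` s] by rewrite As'; apply/seteqP; split => x /=; rewrite mem_undup.
  by rewrite -fsbig_seq// sumEFin.
have sm : \forall r \near F, \sum_(k <- s) f r k < e / 2.
  have : (fun r => \sum_(k <- s) f r k) @ F --> (\sum_(k <- s) 0 : R).
    apply: cvg_big => //; exact: add_continuous.
  rewrite big1_eq => /cvgrPdist_lt/(_ _ e20); apply: filterS => r.
  by rewrite sub0r normrN; apply: le_lt_trans; exact: ler_norm.
near=> r.
have fr : forall k, 0 <= f r k <= G k by near: r.
apply: sumle_ub => u uu.
rewrite (bigID (mem s))/= [e]splitr; apply: lerD.
  rewrite -big_filter; apply: (@le_trans _ _ (\sum_(k <- s) f r k)); last first.
    by apply: ltW; near: r.
  rewrite [leRHS](bigID (mem u))/= -[in leRHS]big_filter.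
  rewrite (perm_big [seq i <- s | i \in u]) /=.
    by rewrite lerDl; apply: sumr_ge0 => k _; case/andP: (fr k).
  apply: uniq_perm; rewrite ?filter_uniq// => x.
  by rewrite !mem_filter andbC.
rewrite -big_filter; set v := [seq _ <- _ | _].
apply: (@le_trans _ _ (\sum_(k <- v) G k)).
  by apply: ler_sum => k _; case/andP: (fr k).
rewrite -(lerD2l (\sum_(k <- s) G k)) -big_cat/=.
apply: ltW; rewrite -lte_fin; apply: le_lt_trans GAs.
apply: nsum_lb => //; rewrite cat_uniq us filter_uniq// andbT/=.
apply/hasPn => x; rewrite mem_filter => /andP[xs _]; exact: xs.
Unshelve. all: by end_near.
Qed.

End NonnegSums.

Section Cvg0.
Variables (R : realType) (S : Type) (F : set_system S).
Implicit Types u v : S -> R.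

Lemma cvg0D {FF : Filter F} u v : u @ F --> 0 -> v @ F --> 0 ->
  (fun n => u n + v n) @ F --> 0.
Proof. by move=> u0 v0; rewrite -[0]addr0; exact: cvgD. Qed.

Lemma cvg0Ml {FF : Filter F} c u : u @ F --> 0 -> (fun n => c * u n) @ F --> 0.
Proof. by move=> u0; rewrite -(mulr0 c); apply: cvgM => //; exact: cvg_cst. Qed.

Lemma cvg0_le {FF : Filter F} u v : (\forall n \near F, 0 <= u n <= v n) ->
  v @ F --> 0 -> u @ F --> 0.
Proof. by move=> uv v0; apply: (squeeze_cvgr uv _ v0); exact: cvg_cst. Qed.

Lemma le_cvg0 {FF : ProperFilter F} (a : R) v : v @ F --> 0 ->
  (\forall n \near F, a <= v n) -> a <= 0.
Proof.
move=> v0 av; rewrite leNgt; apply/negP => a0.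
have [n [avn]] := filter_ex (filterI av (cvgr_lt _ v0 _ a0)).
by rewrite ltNge avn.
Qed.

End Cvg0.

(** * Complex moduli and symmetric sums over the integers *)

Section Complex.
Variable R : realType.
Implicit Types x y z : R[i].

Lemma normc_ge0 x : 0 <= normc x.
Proof. by case: x => a b; exact: sqrtr_ge0. Qed.

Lemma normc_def2 x : normc x = Num.sqrt (Re x ^+ 2 + Im x ^+ 2).
Proof. by case: x. Qed.

Lemma normc_sqr x : normc x ^+ 2 = Re x ^+ 2 + Im x ^+ 2.
Proof. by rewrite normc_def2 sqr_sqrtr// addr_ge0 ?sqr_ge0. Qed.

Lemma normcD x y : normc (x + y) <= normc x + normc y.
Proof. exact: le_normcD. Qed.

Lemma normc_opp x : normc (- x) = normc x.
Proof. by rewrite !normc_def2; case: x => a b /=; rewrite !sqrrN. Qed.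

Lemma normcB x y : normc (x - y) <= normc x + normc y.
Proof. by rewrite -(normc_opp y) normcD. Qed.

Lemma normc_distC x y : normc (x - y) = normc (y - x).
Proof. by rewrite -normc_opp opprB. Qed.

Lemma normc_conj x : normc (x^*) = normc x.
Proof. by rewrite !normc_def2; case: x => a b /=; rewrite sqrrN. Qed.

Lemma normc_Re x : `|Re x| <= normc x.
Proof.
by rewrite normc_def2 -sqrtr_sqr; apply: ler_wsqrtr; rewrite lerDl sqr_ge0.
Qed.

Lemma normc_Im x : `|Im x| <= normc x.
Proof.
by rewrite normc_def2 -sqrtr_sqr; apply: ler_wsqrtr; rewrite lerDr sqr_ge0.
Qed.

Lemma normc_ReIm x : normc x <= `|Re x| + `|Im x|.
Proof.
rewrite normc_def2 -[leRHS]ger0_norm ?addr_ge0// -sqrtr_sqr.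
apply: ler_wsqrtr; rewrite sqrrD !real_normK ?num_real//.
by rewrite lerD2r lerDl mulrn_wge0// mulr_ge0.
Qed.

Lemma normc_real (a : R) : normc a%:C = `|a|.
Proof. by rewrite /= expr0n addr0 sqrtr_sqr. Qed.

Lemma normc_eq0 x : normc x = 0 -> x = 0.
Proof. exact: Normc.eq0_normc. Qed.

Lemma normc_0 : normc (0 : R[i]) = 0.
Proof. exact: Normc.normc0. Qed.

Lemma normc_sum (I : Type) (s : seq I) (P : pred I) (F : I -> R[i]) :
  normc (\sum_(i <- s | P i) F i) <= \sum_(i <- s | P i) normc (F i).
Proof.
elim/big_rec2 : _ => [|i y z _ IH]; first by rewrite normc_0.
by apply: le_trans (normcD _ _) _; rewrite lerD2l.
Qed.

Lemma ReD x y : Re (x + y) = Re x + Re y. Proof. by case: x y => ? ? []. Qed.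
Lemma ImD x y : Im (x + y) = Im x + Im y. Proof. by case: x y => ? ? []. Qed.
Lemma ReN x : Re (- x) = - Re x. Proof. by case: x. Qed.
Lemma ImN x : Im (- x) = - Im x. Proof. by case: x. Qed.
Lemma ReM x y : Re (x * y) = Re x * Re y - Im x * Im y.
Proof. by case: x y => ? ? []. Qed.
Lemma ImM x y : Im (x * y) = Re x * Im y + Im x * Re y.
Proof. by case: x y => ? ? []. Qed.

Lemma complex_ext x y : Re x = Re y -> Im x = Im y -> x = y.
Proof. by case: x y => a b [c d] /= -> ->. Qed.

Lemma Re_sum (I : Type) (s : seq I) (P : pred I) (F : I -> R[i]) :
  Re (\sum_(i <- s | P i) F i) = \sum_(i <- s | P i) Re (F i).
Proof. by apply: (big_morph _ ReD). Qed.

Lemma Im_sum (I : Type) (s : seq I) (P : pred I) (F : I -> R[i]) :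
  Im (\sum_(i <- s | P i) F i) = \sum_(i <- s | P i) Im (F i).
Proof. by apply: (big_morph _ ImD). Qed.

Definition zrange (n : nat) : seq int := [seq i%:Z - n%:Z | i <- iota 0 n.*2.+1].
Arguments zrange : simpl never.

Lemma zrange_uniq n : uniq (zrange n).
Proof. by rewrite map_inj_uniq ?iota_uniq// => i j; lia. Qed.

Lemma mem_zrange n (k : int) : (k \in zrange n) = (`|k| <= n)%N.
Proof.
apply/mapP/idP => [[q]|kn]; first by rewrite mem_iota => ? ->; lia.
exists (absz (k + n%:Z)); [rewrite mem_iota|]; lia.
Qed.

Lemma zrange_le (g : int -> R) m n : (m <= n)%N -> (forall k, 0 <= g k) ->
  \sum_(k <- zrange m) g k <= \sum_(k <- zrange n) g k.
Proof.
move=> mn g0; rewrite [leRHS](bigID (fun k => k \in zrange m))/=.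
rewrite -[X in _ <= X + _]big_filter.
have pe : perm_eq [seq i <- zrange n | i \in zrange m] (zrange m).
  apply: uniq_perm; rewrite ?filter_uniq ?zrange_uniq// => x.
  by rewrite mem_filter !mem_zrange; lia.
by rewrite (perm_big _ pe)/= lerDl sumr_ge0.
Qed.

Lemma sumle_zrange (f : int -> R) B : (forall k, 0 <= f k) ->
  (forall n, \sum_(k <- zrange n) f k <= B) -> sumle f B.
Proof.
move=> f0 H; apply: sumle_ub => s us.
have [n sn] : exists n, forall k, k \in s -> (`|k| <= n)%N.
  by exists (\max_(k <- s) absz k)%N => k ks; exact: leq_bigmax_seq.
apply: le_trans (H n).
rewrite [leRHS](bigID (mem s))/= -[X in _ <= X + _]big_filter.
have pe : perm_eq [seq i <- zrange n | i \in s] s.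
  apply: uniq_perm; rewrite ?filter_uniq ?zrange_uniq// => x.
  by rewrite mem_filter mem_zrange; case xs: (x \in s) => //=; exact: sn.
by rewrite (perm_big _ pe)/= lerDl sumr_ge0.
Qed.

(* Symmetric partial sums: this is the form in which products of Fourier
   series produce their convolution sums. *)
Definition zcvg (f : int -> R[i]) (l : R[i]) : Prop :=
  (fun n => normc (\sum_(k <- zrange n) f k - l)) @ \oo --> 0.

(** The default 0 stands for divergent sums; [csumP] rules it out for absolutely summable
    families. *)
Definition csum f : R[i] := xget 0 [set l | zcvg f l].

Lemma zcvg_unique f l l' : zcvg f l -> zcvg f l' -> l = l'.
Proof.
move=> fl fl'; apply/eqP; rewrite -subr_eq0; apply/eqP/normc_eq0/eqP.
rewrite eq_le normc_ge0 andbT.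
apply: (le_cvg0 (cvg0D fl fl')); apply: nearW => n /=.
have -> : l - l' = (\sum_(k <- zrange n) f k - l') - (\sum_(k <- zrange n) f k - l).
  by ring.
by rewrite [leRHS]addrC; exact: normcB.
Qed.

Lemma csum_eq f l : zcvg f l -> csum f = l.
Proof.
by move=> fl; rewrite /csum; case: xgetP => [m _ fm|/(_ l)//]; exact: zcvg_unique fm fl.
Qed.

Lemma zcvgP f (l : R[i]) :
  (fun n => \sum_(k <- zrange n) Re (f k)) @ \oo --> Re l ->
  (fun n => \sum_(k <- zrange n) Im (f k)) @ \oo --> Im l -> zcvg f l.
Proof.
move=> hr hi; have h : (fun n => `|\sum_(k <- zrange n) Re (f k) - Re l| +
    `|\sum_(k <- zrange n) Im (f k) - Im l|) @ \oo --> 0.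
  by apply: cvg0D; apply/norm_cvg0P/subr_cvg0.
rewrite /zcvg; apply: cvg0_le h; apply: nearW => n.
by rewrite normc_ge0 (le_trans (normc_ReIm _))//= ReD ImD ReN ImN Re_sum Im_sum.
Qed.

Lemma zsum_cvg (f : int -> R) B : sumle (fun k => `|f k|) B ->
  cvgn (fun n => \sum_(k <- zrange n) f k).
Proof.
move=> fB.
have H (g : int -> R) : (forall k, 0 <= g k <= `|f k|) -> cvgn (fun n => \sum_(k <- zrange n) g k).
  move=> g0; apply: nondecreasing_is_cvgn.
    by move=> m n mn; apply: zrange_le => // k; case/andP: (g0 k).
  exists B => _ [n _ <-]; apply: sumle_lb (zrange_uniq n) => [k|].
    by case/andP: (g0 k).
  by apply: le_sumle fB => // k; case/andP: (g0 k).
(* Positive and negative parts of [f]: their terms lie between 0 and [|f k|], so their symmetric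
   partial sums are increasing and bounded. *)
have -> : (fun n => \sum_(k <- zrange n) f k) =
    (fun n => \sum_(k <- zrange n) (`|f k| + f k) / 2) -
    (fun n => \sum_(k <- zrange n) (`|f k| - f k) / 2).
  by apply/funext => n; rewrite !fctE -sumrB; apply: eq_bigr => k _; field.
by apply: is_cvgB; apply: H => k; have := ler_norm (f k); have := ler_norm (- f k);
  rewrite normrN; lra.
Qed.

Lemma csumP f B : sumle (fun k => normc (f k)) B ->
  zcvg f (csum f) /\ normc (csum f) <= B.
Proof.
move=> fB.
have fr : sumle (fun k => `|Re (f k)|) B by apply: le_sumle fB => // k; exact: normc_Re.
have fi : sumle (fun k => `|Im (f k)|) B by apply: le_sumle fB => // k; exact: normc_Im.
have [l fl] : exists l, zcvg f l.
  exists (lim ((fun n => \sum_(k <- zrange n) Re (f k)) @ \oo) +i*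
          lim ((fun n => \sum_(k <- zrange n) Im (f k)) @ \oo)).
  by apply: zcvgP => /=; [exact: (zsum_cvg fr)|exact: (zsum_cvg fi)].
rewrite (csum_eq fl); split => //.
rewrite -subr_le0; apply: (le_cvg0 fl); apply: nearW => n; rewrite lerBlDr addrC.
have -> : l = \sum_(k <- zrange n) f k - (\sum_(k <- zrange n) f k - l) by ring.
apply: le_trans (normcB _ _) _; rewrite opprB addrCA subrr addr0 lerD2r.
apply: le_trans (normc_sum _ _ _) _.
by apply: sumle_lb (zrange_uniq n) => // k; exact: normc_ge0.
Qed.

Lemma zcvgD f g l l' : zcvg f l -> zcvg g l' -> zcvg (fun k => f k + g k) (l + l').
Proof.
move=> fl gl; rewrite /zcvg; apply: cvg0_le (cvg0D fl gl); apply: nearW => n.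
rewrite normc_ge0 big_split/= opprD addrACA; exact: normcD.
Qed.

Lemma zcvgZ f l c : zcvg f l -> zcvg (fun k => c * f k) (c * l).
Proof.
move=> fl.
have h : (fun n => normc c * normc (\sum_(k <- zrange n) f k - l)) @ \oo --> 0.
  by rewrite -(mulr0 (normc c)); apply: cvgM => //; exact: cvg_cst.
rewrite /zcvg; apply: cvg0_le h; apply: nearW => n.
by rewrite normc_ge0/= -mulr_sumr -mulrBr Normc.normcM.
Qed.

Lemma eq_zcvg f g l : f =1 g -> zcvg f l -> zcvg g l.
Proof. by move=> /funext ->. Qed.

(** The ranges [zrange n] are stable under k -> -k, so the reflected conjugate series has the
    conjugate partial sums. *)
Lemma zcvg_conj f l : zcvg f l -> zcvg (fun k => (f (- k))^*) (l^*).
Proof.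
rewrite /zcvg; apply: cvg_trans; apply: near_eq_cvg; apply: nearW => n.
rewrite -normc_conj rmorphB rmorph_sum/=; congr (normc (_ - _)).
rewrite -(big_map (fun k => - k) predT (fun k => (f k)^*)).
apply: perm_big; apply: uniq_perm; rewrite ?zrange_uniq//.
  by rewrite map_inj_uniq ?zrange_uniq//; exact: oppr_inj.
move=> x; rewrite -[x]opprK mem_map; last exact: oppr_inj.
by rewrite !mem_zrange opprK; lia.
Qed.

End Complex.

(** * Limits of complex-valued functions along a filter *)

Section ComplexCont.
Variables (R : realType) (S : Type) (F : set_system S).
Context {FF : Filter F}.
Implicit Types (y z : S -> R[i]) (l : R[i]).

Definition ccont y l : Prop := (fun s => normc (y s - l)) @ F --> 0.

Lemma ccont_Re y l : ccont y l -> (fun s => Re (y s)) @ F --> Re l.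
Proof.
move=> yl; apply/subr_cvg0/norm_cvg0P; apply: cvg0_le yl; apply: nearW => s.
by rewrite normr_ge0/= -ReN -ReD normc_Re.
Qed.

Lemma ccont_Im y l : ccont y l -> (fun s => Im (y s)) @ F --> Im l.
Proof.
move=> yl; apply/subr_cvg0/norm_cvg0P; apply: cvg0_le yl; apply: nearW => s.
by rewrite normr_ge0/= -ImN -ImD normc_Im.
Qed.

Lemma ccont_ReIm y l : (fun s => Re (y s)) @ F --> Re l ->
  (fun s => Im (y s)) @ F --> Im l -> ccont y l.
Proof.
move=> hr hi.
have yr : (fun s => `|Re (y s) - Re l|) @ F --> 0 by apply/norm_cvg0P/subr_cvg0.
have yi : (fun s => `|Im (y s) - Im l|) @ F --> 0 by apply/norm_cvg0P/subr_cvg0.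
rewrite /ccont; apply: cvg0_le (cvg0D yr yi); apply: nearW => s.
by rewrite normc_ge0 (le_trans (normc_ReIm _))// ReD ImD ReN ImN.
Qed.

Lemma ccontM y z l l' : ccont y l -> ccont z l' ->
  ccont (fun s => y s * z s) (l * l').
Proof.
move=> yl zl; have [yr yi] := (ccont_Re yl, ccont_Im yl).
have [zr zi] := (ccont_Re zl, ccont_Im zl).
apply: ccont_ReIm.
  under eq_fun do rewrite ReM; rewrite ReM.
  by apply: cvgB; apply: cvgM.
under eq_fun do rewrite ImM; rewrite ImM.
by apply: cvgD; apply: cvgM.
Qed.

Lemma ccont_cst l : ccont (fun=> l) l.
Proof. by apply: ccont_ReIm; exact: cvg_cst. Qed.

Lemma ccont_real (u : S -> R) (b : R) : u @ F --> b ->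
  ccont (fun s => (u s)%:C) b%:C.
Proof. by move=> ub; apply: ccont_ReIm => //=; exact: cvg_cst. Qed.

End ComplexCont.

(** The rate [b] passes to the limit by letting m tend to infinity. For the Picard iterates it is
    uniform in the mode and in time, which is what makes the limit continuous. *)
Lemma complex_cauchy (R : realType) (z : nat -> R[i]) (b : nat -> R) :
  b @ \oo --> 0 -> (forall m n, (n <= m)%N -> normc (z m - z n) <= b n) ->
  exists l : R[i], forall n, normc (z n - l) <= b n.
Proof.
move=> b0 zb.
have cv (h : R[i] -> R) : (forall x y, `|h x - h y| <= normc (x - y)) ->
    cvgn (fun n => h (z n)).
  move=> hz; apply/cauchy_cvgP/cauchy_exP => eps eps0.
  have /cvgrPdist_lt/(_ _ eps0)[N _ HN] := b0.
  exists (h (z N)); exists N => // m /= Nm.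
  rewrite /ball/=; apply: le_lt_trans (hz _ _) _; rewrite normc_distC.
  apply: le_lt_trans (zb _ _ Nm) _.
  have := HN N (leqnn N); rewrite sub0r normrN; apply: le_lt_trans; exact: ler_norm.
have cr : cvgn (fun n => Re (z n)) by apply: cv => x y; rewrite -ReN -ReD normc_Re.
have ci : cvgn (fun n => Im (z n)) by apply: cv => x y; rewrite -ImN -ImD normc_Im.
pose l := limn (fun n => Re (z n)) +i* limn (fun n => Im (z n)).
exists l => n; have zl : ccont \oo z l by apply: ccont_ReIm.
rewrite -subr_le0; apply: (le_cvg0 zl); exists n => // m /= nm.
rewrite lerBlDr.
have -> : z n - l = (z m - l) - (z m - z n) by ring.
apply: le_trans (normcB _ _) _; rewrite lerD2l.
exact: zb.
Qed.

(** * The Duhamel formula *)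

Section Duhamel.
Variable R : realType.
Implicit Types (y g : R -> R[i]) (t : R).

Definition cderiv y t (d : R[i]) : Prop :=
  is_derive t 1 (fun s => Re (y s)) (Re d) /\
  is_derive t 1 (fun s => Im (y s)) (Im d).

(** Integrating from -1 makes the derivative two-sided at t = 0, the left end of the time intervals;
    subtracting [F 0] then restores the value 0 there. *)
Lemma primitive (h : R -> R) : continuous h ->
  exists H : R -> R, H 0 = 0 /\ forall t, -1 < t -> is_derive t 1 H (h t).
Proof.
move=> ch.
pose F x := (\int[lebesgue_measure]_(t in `[-1, x]) (h t))%R.
have dF t : -1 < t -> is_derive t 1 F (h t).
  move=> t1; have tu : t < t + 1 by rewrite ltrDl.
  have [dF F'] := @continuous_FTC1_closed _ h (-1) t (t+1) tu
    (continuous_compact_integrable (segment_compact (a:=-1) (b:=t+1))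
      (continuous_subspaceT ch)) t1 (ch t).
  by rewrite -F' derive1E; exact: derivableP.
exists (fun x => F x - F 0); split; first by rewrite subrr.
move=> t /dF dFt; apply: is_derive_eq.
by rewrite subr0.
Qed.

Lemma continuous_expRM (m : R) : continuous (fun s : R => expR (m * s)).
Proof.
move=> x; apply: continuous_comp; first exact: mulrl_continuous.
exact: continuous_expR.
Qed.

Lemma continuous_cosM (m : R) : continuous (fun s : R => cos (m * s)).
Proof.
move=> x; apply: continuous_comp; first exact: mulrl_continuous.
exact: continuous_cos.
Qed.

Lemma continuous_sinM (m : R) : continuous (fun s : R => sin (m * s)).
Proof.
move=> x; apply: continuous_comp; first exact: mulrl_continuous.
exact: continuous_sin.
Qed.

Lemma duhamel_exists (a p : R[i]) g :
  continuous (fun s => Re (g s)) -> continuous (fun s => Im (g s)) ->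
  exists y : R -> R[i], y 0 = p /\
    forall t, -1 < t -> cderiv y t (a * y t + g t).
Proof.
move=> gr gi; pose m := Re a; pose w := Im a.
have cc (u v : R -> R) : continuous u -> continuous v -> continuous (fun s => u s * v s).
  by move=> cu cv x; apply: cvgM; [exact: cu|exact: cv].
have [H1 [H10 dH1]] := @primitive (fun s => expR (- m * s) *
    (cos (w * s) * Re (g s) + sin (w * s) * Im (g s))) (cc _ _ (@continuous_expRM _)
  (fun x => cvgD (cc _ _ (@continuous_cosM w) gr x) (cc _ _ (@continuous_sinM w) gi x))).
have [H2 [H20 dH2]] := @primitive (fun s => expR (- m * s) *
    (cos (w * s) * Im (g s) - sin (w * s) * Re (g s))) (cc _ _ (@continuous_expRM _)
  (fun x => cvgB (cc _ _ (@continuous_cosM w) gi x) (cc _ _ (@continuous_sinM w) gr x))).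
exists (fun s => (expR (m * s) * (cos (w * s) * (Re p + H1 s) - sin (w * s) * (Im p + H2 s))) +i*
                 (expR (m * s) * (cos (w * s) * (Im p + H2 s) + sin (w * s) * (Re p + H1 s)))).
split.
  apply: complex_ext => /=; rewrite mulr0 expR0 mulr0 cos0 sin0 H10 H20; ring.
move=> t t1; have d1 := dH1 t t1; have d2 := dH2 t t1.
have ee : expR (m * t) * expR (- m * t) = 1 by rewrite -expRD mulNr subrr expR0.
have cs := cos2Dsin2 (w * t).
split; rewrite ?ReD ?ImD ?ReM ?ImM /=; apply: is_derive_eq; rewrite /GRing.scale/= -/m -/w.
  (* The factor inserted here equals 1; with it the two sides agree as polynomials. *)
  have e : Re (g t) = expR (m * t) * expR (- m * t) *
    (cos (w * t) ^+ 2 + sin (w * t) ^+ 2) * Re (g t) by rewrite ee cs !mul1r.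
  by rewrite [X in _ = _ + X]e; ring.
have e : Im (g t) = expR (m * t) * expR (- m * t) *
  (cos (w * t) ^+ 2 + sin (w * t) ^+ 2) * Im (g t) by rewrite ee cs !mul1r.
by rewrite [X in _ = _ + X]e; ring.
Qed.

(** A mean value inequality for Z(s) = e^(-as) y(s), whose derivative is e^(-as) g(s). Testing Z
    against its own increment Z(t) - Z(0), of modulus N, reduces it to the monotonicity of the real
    function [phi], and phi(0) <= phi(t) reads N^2 <= N times the expected bound. Thus no integral
    of [g] is formed and a pointwise bound is all that enters. The weight [expR (rho * s)] serves
    the uniqueness theorem; existence takes rho = 0. *)
Lemma duhamel_bound (a : R[i]) y g (t Gam rho : R) :
  0 <= t ->
  (forall s, 0 < s < t -> cderiv y s (a * y s + g s)) ->
  {within `[0, t], continuous (fun s => Re (y s))} ->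
  {within `[0, t], continuous (fun s => Im (y s))} ->
  (forall s, 0 <= s <= t -> normc (g s) <= Gam * expR (rho * s)) ->
  0 < rho - Re a ->
  normc (y t) <= expR (Re a * t) * normc (y 0) + Gam * expR (rho * t) / (rho - Re a).
Proof.
move=> t0 dy cr ci gG r0; pose m := - Re a; pose w := Im a.
(* [Z1] and [Z2] are the real and imaginary parts of e^(-as) y(s), since m = - Re a. *)
pose Z1 s := expR (m * s) * (cos (w * s) * Re (y s) + sin (w * s) * Im (y s)).
pose Z2 s := expR (m * s) * (cos (w * s) * Im (y s) - sin (w * s) * Re (y s)).
pose c1 := Z1 t - Z1 0; pose c2 := Z2 t - Z2 0.
pose N := normc (c1 +i* c2).
pose phi s := N * Gam * expR ((rho + m) * s) / (rho + m) - (c1 * Z1 s + c2 * Z2 s).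
have rm : rho + m = rho - Re a by [].
have Gam0 : 0 <= Gam.
  have := gG 0; rewrite mulr0 expR0 mulr1 lexx t0 => /(_ isT).
  by apply: le_trans; exact: normc_ge0.
have N2 : N ^+ 2 = c1 ^+ 2 + c2 ^+ 2 by rewrite normc_sqr.
have N0 : 0 <= N by exact: normc_ge0.
have CS (u v x z : R) : u * x + v * z <= normc (u +i* v) * normc (x +i* z).
  apply: (@le_trans _ _ (normc ((u +i* v) * (x +i* z)^*))).
    apply: le_trans (ler_norm _) _; apply: le_trans (normc_Re _).
    by rewrite ReM /= mulrN opprK.
  by rewrite Normc.normcM normc_conj.
have dphi s : 0 < s < t -> exists2 d : R, is_derive s 1 phi d & 0 <= d.
  move=> /[dup] sI /dy [d1 d2].
  rewrite ReD ReM in d1; rewrite ImD ImM in d2.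
  exists (N * Gam * expR ((rho + m) * s) - expR (m * s) *
     (c1 * (cos (w * s) * Re (g s) + sin (w * s) * Im (g s)) +
      c2 * (cos (w * s) * Im (g s) - sin (w * s) * Re (g s)))).
    apply: is_derive_eq; rewrite /GRing.scale/= !mulr1 /m /w.
    by field; rewrite gt_eqF.
  have h := CS c1 c2 (cos (w * s) * Re (g s) + sin (w * s) * Im (g s))
     (cos (w * s) * Im (g s) - sin (w * s) * Re (g s)).
  have e : normc ((cos (w * s) * Re (g s) + sin (w * s) * Im (g s)) +i*
     (cos (w * s) * Im (g s) - sin (w * s) * Re (g s))) = normc (g s).
    rewrite /= normc_def2; congr Num.sqrt.
    rewrite -[RHS]mul1r -(cos2Dsin2 (w * s)); ring.
  rewrite e -/N in h.
  have gs : normc (g s) <= Gam * expR (rho * s).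
    by apply: gG; case/andP: sI => /ltW -> /ltW ->.
  have := expR_ge0 (m * s); rewrite subr_ge0 [(rho + m) * s]mulrDl expRD => E0.
  apply: le_trans (ler_wpM2l E0 (le_trans h (ler_wpM2l N0 gs))) _.
  by rewrite le_eqVlt; apply/orP; left; apply/eqP; ring.
have cphi : {within `[0, t], continuous phi}.
  have cT (u : R -> R) : continuous u -> {within `[0, t], continuous u}.
    exact: continuous_subspaceT.
  have cM (u v : R -> R) : {within `[0, t], continuous u} -> {within `[0, t], continuous v} ->
     {within `[0, t], continuous (fun s => u s * v s)}.
    by move=> cu cv x; apply: cvgM; [exact: cu|exact: cv].
  have cD (u v : R -> R) : {within `[0, t], continuous u} -> {within `[0, t], continuous v} ->
     {within `[0, t], continuous (fun s => u s + v s)}.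
    by move=> cu cv x; apply: cvgD; [exact: cu|exact: cv].
  have cB (u v : R -> R) : {within `[0, t], continuous u} -> {within `[0, t], continuous v} ->
     {within `[0, t], continuous (fun s => u s - v s)}.
    by move=> cu cv x; apply: cvgB; [exact: cu|exact: cv].
  have cC (k : R) : {within `[0, t], continuous (fun=> k)} by apply: cT; exact: cst_continuous.
  have ce := cT _ (@continuous_expRM m); have cs := cT _ (@continuous_sinM w).
  have cc := cT _ (@continuous_cosM w); have ce' := cT _ (@continuous_expRM (rho + m)).
  apply: (cB); first by apply: (cM) => //; apply: (cM) => //; exact: cC.
  apply: (cD); apply: (cM); rewrite ?/Z1 ?/Z2; do ?exact: cC.
    by apply: (cM) => //; apply: (cD); exact: cM.
  by apply: (cM) => //; apply: (cB); exact: cM.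
have mono : phi 0 <= phi t.
  have h1 x : x \in `]0, t[ -> derivable phi x 1.
    by rewrite in_itv/= => /dphi[d dd _]; exact: ex_derive.
  have h2 x : x \in `]0, t[ -> 0 <= phi^`()%classic x.
    by rewrite in_itv/= => /dphi[d dd d0]; rewrite derive1E derive_val.
  exact: (ger0_derive1_ndecr h1 h2 cphi (lexx 0) t0 (lexx t)).
have Nle : N <= Gam * expR ((rho + m) * t) / (rho + m).
  have [->|Nn] := eqVneq N 0.
    by rewrite divr_ge0 ?mulr_ge0 ?expR_ge0// rm ltW.
  have Np : 0 < N by rewrite lt_def Nn.
  rewrite -(ler_pM2l Np) -expr2 N2.
  have h0 : 0 <= N * Gam / (rho + m) by rewrite divr_ge0 ?mulr_ge0// rm ltW.
  move: mono; rewrite /phi mulr0 expR0 mulr1.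
  have -> : c1 ^+ 2 + c2 ^+ 2 = c1 * Z1 t + c2 * Z2 t - (c1 * Z1 0 + c2 * Z2 0).
    by rewrite /c1 /c2; ring.
  lra.
have Z10 : Z1 0 = Re (y 0) by rewrite /Z1 !mulr0 expR0 cos0 sin0; ring.
have Z20 : Z2 0 = Im (y 0) by rewrite /Z2 !mulr0 expR0 cos0 sin0; ring.
have yt : normc (y t) = expR (- m * t) * normc (Z1 t +i* Z2 t).
  rewrite -[expR _]ger0_norm ?expR_ge0// -normc_real -Normc.normcM.
  rewrite !normc_def2; congr Num.sqrt; rewrite !(ReM, ImM) /= !mul0r subr0 addr0 /Z1 /Z2.
  have ee : expR (- m * t) * expR (m * t) = 1 by rewrite -expRD mulNr addNr expR0.
  rewrite !(mulrA (expR (- m * t))) ee !mul1r.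
  rewrite -[LHS]mul1r -(cos2Dsin2 (w * t)); ring.
have Zt : normc (Z1 t +i* Z2 t) <= normc (y 0) + N.
  have -> : Z1 t +i* Z2 t = y 0 + (c1 +i* c2).
    by apply: complex_ext; rewrite ?ReD ?ImD /= /c1 /c2 ?Z10 ?Z20; ring.
  exact: normcD.
have ma : Re a = - m by rewrite opprK.
have eE : expR (- m * t) * expR ((rho + m) * t) = expR (rho * t).
  by rewrite -expRD; congr expR; ring.
rewrite -rm yt ma.
apply: le_trans (ler_wpM2l (expR_ge0 _) (le_trans Zt (lerD (lexx _) Nle))) _.
by rewrite mulrDr lerD2l -eE le_eqVlt; apply/orP; left; apply/eqP; ring.
Qed.

End Duhamel.

Lemma cderiv_ccont (R : realType) (y : R -> R[i]) t d :
  cderiv y t d -> ccont (nbhs t) y (y t).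
Proof.
move=> [dr di]; apply: ccont_ReIm.
  by apply: differentiable_continuous; apply/derivable1_diffP; exact: ex_derive.
by apply: differentiable_continuous; apply/derivable1_diffP; exact: ex_derive.
Qed.

Lemma ccont_comp (R : realType) (u : R -> R) (y : R -> R[i]) (t : R) l :
  {for t, continuous u} -> ccont (nbhs (u t)) y l -> ccont (nbhs t) (y \o u) l.
Proof. by move=> ut yl; have h := cvg_comp u _ ut yl; exact: h. Qed.

(** * Quadratic systems with dissipative diagonal part *)

Section Quadratic.
Variable R : realType.
Implicit Types (f g M : int -> R) (p q : int -> R[i]) (sg : int -> int -> R[i]).

Lemma sumle_inj (T U : choiceType) (f : U -> R) (h : T -> U) A :
  (forall k, 0 <= f k) -> injective h -> sumle f A -> sumle (fun k => f (h k)) A.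
Proof.
move=> f0 hi fA; apply: sumle_ub => s us.
rewrite -(big_map h predT) /=; apply: sumle_lb => //.
by rewrite map_inj_uniq.
Qed.

Lemma subl_inj (k : int) : injective (fun j => k - j).
Proof. by move=> i j; lia. Qed.

(** Young's inequality for l^1 * l^1. Summing over a finite set of k keeps the interchange with the
    sum over j elementary, and for each j the sum over k of [g (k - j)] is at most [B] by
    injectivity of the shift. *)
Lemma sum_conv f g A B (s : seq int) : (forall k, 0 <= f k) -> (forall k, 0 <= g k) ->
  sumle f A -> sumle g B -> uniq s ->
  (\sum_(k <- s) nsum (fun j => f j * g (k - j))%R <= (A * B)%:E)%E.
Proof.
move=> f0 g0 fA gB us.
have B0 := sumle_ge0 g0 gB.
have -> : (\sum_(k <- s) nsum (fun j => f j * g (k - j))%R =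
  nsum (fun j => B * f j - f j * (B - \sum_(k <- s) g (k - j)))%R)%E.
  under eq_nsum do rewrite mulrBr [B * _]mulrC opprB addrC subrK.
  rewrite /nsum -[LHS]/(\sum_(k <- s) esum setT (fun j => (f j * g (k - j))%R%:E))%E.
  under eq_esum do rewrite mulr_sumr -sumEFin.
  rewrite esum_sum// => k j _ _; by rewrite lee_fin mulr_ge0.
apply: (@le_sumle _ _ _ (fun j => B * f j) (B * A)).
- move=> j; rewrite lerBlDr lerDl mulr_ge0// subr_ge0.
  rewrite -(big_map (fun k => k - j) predT) /=; apply: sumle_lb => //.
  by rewrite map_inj_uniq// => i l; lia.
- by rewrite mulrC.
- exact: sumleZ.
Qed.

Definition conv (e : int -> int -> R) f g (k : int) : R :=
  fine (nsum (fun j => e k j * (f j * g (k - j)))).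

Section conv_bound.
Variables (e : int -> int -> R) (gam A B : R) (f g : int -> R).
Hypotheses (e0 : forall k j, 0 <= e k j) (f0 : forall k, 0 <= f k)
  (g0 : forall k, 0 <= g k) (gam0 : 0 <= gam)
  (eg : forall k, sumle (fun j => e k j ^+ 2) (gam ^+ 2))
  (fA : sumle (fun j => f j ^+ 2) A) (gB : sumle (fun j => g j ^+ 2) B).

Let c k := fine (nsum (fun j => f j ^+ 2 * g (k - j) ^+ 2)).

Let cE k : nsum (fun j => f j ^+ 2 * g (k - j) ^+ 2) = (c k)%:E.
Proof.
rewrite fineK// ge0_fin_numE ?nsum_ge0// => [|j]; last by rewrite mulr_ge0 ?sqr_ge0.
apply: (@le_lt_trans _ _ (A * B)%:E); last by rewrite ltry.
have := @sum_conv _ _ _ _ [:: k] (fun j => sqr_ge0 (f j)) (fun j => sqr_ge0 (g j)) fA gB isT.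
by rewrite big_seq1.
Qed.

Lemma conv_ge0 k : 0 <= conv e f g k.
Proof. by apply: fine_ge0; apply: nsum_ge0 => j; rewrite !mulr_ge0. Qed.

Let conv_c k : sumle (fun j => e k j * (f j * g (k - j))) (Num.sqrt (gam ^+ 2 * c k)).
Proof.
apply: sumle_CS => // [j|]; first by rewrite mulr_ge0.
by rewrite /sumle -cE; under eq_nsum do rewrite exprMn.
Qed.

Lemma convP k : nsum (fun j => e k j * (f j * g (k - j))) = (conv e f g k)%:E.
Proof.
rewrite fineK// ge0_fin_numE ?nsum_ge0// => [|j]; last by rewrite !mulr_ge0.
by rewrite (le_lt_trans (conv_c k))// ltry.
Qed.

Lemma conv_sumle k : sumle (fun j => e k j * (f j * g (k - j))) (conv e f g k).
Proof. by rewrite /sumle convP. Qed.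

(** Cauchy-Schwarz in j against [e k], whose squares sum to at most [gam ^+ 2] for every k, leaves
    the plain convolution of f^2 and g^2. These are two l^1 sequences, so [sum_conv] applies. *)
Lemma conv_l2 : sumle (fun k => conv e f g k ^+ 2) (gam ^+ 2 * (A * B)).
Proof.
have c0 k : 0 <= c k.
  by apply: fine_ge0; apply: nsum_ge0 => j; rewrite mulr_ge0 ?sqr_ge0.
apply: (@le_sumle _ _ _ (fun k => gam ^+ 2 * c k) (gam ^+ 2 * (A * B))) => //.
  move=> k; have := conv_c k; rewrite /sumle convP lee_fin => h.
  rewrite -[leRHS]sqr_sqrtr ?mulr_ge0 ?sqr_ge0//.
  by rewrite lerXn2r ?nnegrE ?conv_ge0 ?sqrtr_ge0.
apply: sumleZ => //; first exact: sqr_ge0.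
apply: sumle_ub => s us; rewrite -lee_fin -sumEFin.
under eq_bigr do rewrite -cE.
by apply: (@sum_conv (fun j => f j ^+ 2) (fun j => g j ^+ 2)) => // k; exact: sqr_ge0.
Qed.

End conv_bound.

Definition quad sg p (k : int) : R[i] := csum (fun j => sg k j * (p j * p (k - j))).

Section quad_bound.
Variables (sg : int -> int -> R[i]) (e : int -> int -> R) (gam S c : R)
  (M : int -> R) (k : int).
Hypotheses (e0 : forall k j, 0 <= e k j) (gam0 : 0 <= gam) (S0 : 0 <= S)
  (c0 : 0 <= c)
  (eg : forall k, sumle (fun j => e k j ^+ 2) (gam ^+ 2))
  (sge : forall j, normc (sg k j) <= c * e k j)
  (M0 : forall j, 0 <= M j) (MS : sumle (fun j => M j ^+ 2) (S ^+ 2)).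

Lemma quad_term p j : (forall j, normc (p j) <= M j) ->
  normc (sg k j * (p j * p (k - j))) <= c * (e k j * (M j * M (k - j))).
Proof.
move=> pM; rewrite !Normc.normcM [leRHS]mulrA; apply: ler_pM; rewrite ?mulr_ge0 ?normc_ge0//.
by apply: ler_pM; rewrite ?normc_ge0.
Qed.

Lemma quad_sumle p : (forall j, normc (p j) <= M j) ->
  sumle (fun j => normc (sg k j * (p j * p (k - j)))) (c * conv e M M k).
Proof.
move=> pM; apply: le_sumle (fun j => quad_term j pM) (lexx _) _.
apply: sumleZ => //; last exact: conv_sumle eg MS MS _.
by move=> j; rewrite !mulr_ge0.
Qed.

Lemma quad_norm p : (forall j, normc (p j) <= M j) ->
  normc (quad sg p k) <= c * conv e M M k.
Proof. by move=> /quad_sumle/csumP[]. Qed.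

Lemma quadB_sumle p q (D : R) : (forall j, normc (p j) <= M j) ->
  (forall j, normc (q j) <= M j) ->
  sumle (fun j => normc (sg k j * (p j * p (k - j) - q j * q (k - j)))) D ->
  normc (quad sg p k - quad sg q k) <= D.
Proof.
move=> pM qM; rewrite (_ : (fun j => _) =
    (fun j => normc (sg k j * (p j * p (k - j)) + -1 * (sg k j * (q j * q (k - j)))))).
  move=> /csumP[h hD]; have [h1 _] := csumP (quad_sumle pM).
  have [h2 _] := csumP (quad_sumle qM).
  by move: hD; rewrite (zcvg_unique h (zcvgD h1 (zcvgZ (-1) h2))) mulN1r.
by apply/funext => j; congr normc; ring.
Qed.

(** The difference is measured in the sup norm only, because the l^2 majorant [M] is already common
    to both. In each of the two terms of p p - q q one factor is below [A] and the other below [M],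
    and Cauchy-Schwarz pairs [e k] with [M]; hence 2 * gam * S * A. *)
Lemma quad_lip p q A : (forall j, normc (p j) <= M j) ->
  (forall j, normc (q j) <= M j) -> (forall j, normc (p j - q j) <= A) ->
  normc (quad sg p k - quad sg q k) <= c * (2 * gam * S * A).
Proof.
move=> pM qM pqA; apply: quadB_sumle => //.
have A0 : 0 <= A by apply: le_trans (pqA 0); exact: normc_ge0.
have h1 : sumle (fun j => e k j * M j) (gam * S).
  rewrite -[gam * S]ger0_norm ?mulr_ge0// -sqrtr_sqr exprMn.
  exact: sumle_CS.
have h2 : sumle (fun j => e k j * M (k - j)) (gam * S).
  rewrite -[gam * S]ger0_norm ?mulr_ge0// -sqrtr_sqr exprMn.
  apply: sumle_CS => //.
  by apply: (@sumle_inj _ _ (fun j => M j ^+ 2)) => // [j|]; [exact: sqr_ge0|exact: subl_inj].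
have e1 j : 0 <= e k j * M j by rewrite mulr_ge0.
have e2 j : 0 <= e k j * M (k - j) by rewrite mulr_ge0.
have h := sumleZ (fun j => addr_ge0 (e1 j) (e2 j)) (mulr_ge0 c0 A0) (sumleD e1 e2 h1 h2).
apply: le_sumle h; last by rewrite le_eqVlt; apply/orP; left; apply/eqP; ring.
move=> j.
have -> : p j * p (k - j) - q j * q (k - j) =
  p j * (p (k - j) - q (k - j)) + (p j - q j) * q (k - j) by ring.
rewrite Normc.normcM.
apply: (@le_trans _ _ (c * e k j * (M j * A + A * M (k - j)))).
  apply: ler_pM; rewrite ?normc_ge0//; apply: le_trans (normcD _ _) _.
  by rewrite !Normc.normcM lerD// ler_pM// normc_ge0.
by rewrite le_eqVlt; apply/orP; left; apply/eqP; ring.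
Qed.

Lemma quad_ccont (q : R -> int -> R[i]) (F : set_system R) {FF : Filter F} p :
  (\forall s \near F, forall j, normc (q s j) <= M j) ->
  (forall j, normc (p j) <= M j) ->
  (forall j, ccont F (fun s => q s j) (p j)) ->
  ccont F (fun s => quad sg (q s) k) (quad sg p k).
Proof.
move=> qM pM qc; rewrite /ccont.
pose f s j := normc (sg k j * (q s j * q s (k - j) - p j * p (k - j))).
have h : forall e, 0 < e -> \forall s \near F, sumle (f s) e.
  apply: (@sumle_dominated _ _ _ F FF f (fun j => 2 * (c * (e k j * (M j * M (k - j)))))
    (2 * (c * conv e M M k))).
  - move: qM; apply: filterS => s qM j; rewrite normc_ge0/= /f mulrBr.
    apply: le_trans (normcB _ _) _.
    by rewrite mulrDl mul1r lerD// quad_term.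
  - move=> j; rewrite /f; under eq_fun do rewrite Normc.normcM.
    by apply: cvg0Ml; apply: (ccontM (qc j) (qc (k - j))).
  - by move=> j; rewrite !mulr_ge0.
  - apply: sumleZ => //; first by move=> j; rewrite !mulr_ge0.
    apply: sumleZ => //; last exact: conv_sumle eg MS MS _.
    by move=> j; rewrite !mulr_ge0.
apply/cvgrPdist_le => eps eps0; near=> s.
rewrite sub0r normrN ger0_norm ?normc_ge0//; apply: quadB_sumle => //.
  by near: s.
by near: s; exact: h.
Unshelve. all: by end_near.
Qed.

End quad_bound.
End Quadratic.

(** * Existence by Picard iteration *)

Section Existence.
Variable R : realType.
Variables (a : int -> R[i]) (sg : int -> int -> R[i]) (e : int -> int -> R)
  (gam S0 : R) (theta kappa : R -> R) (I : set R) (f0 : int -> R[i]).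
Hypotheses (a0 : forall k, Re (a k) < 0)
  (sge : forall k j, normc (sg k j) <= - Re (a k) * e k j)
  (e0 : forall k j, 0 <= e k j) (gam0 : 0 <= gam)
  (eg : forall k, sumle (fun j => e k j ^+ 2) (gam ^+ 2))
  (ctheta : continuous theta) (theta01 : forall t, I t -> 0 <= theta t <= 1)
  (ckappa : continuous kappa) (kappaI : forall t, I (kappa t))
  (kappaK : forall t, I t -> kappa t = t) (I0 : I 0)
  (Ige0 : forall t, I t -> 0 <= t)
  (Idown : forall t s, I t -> 0 <= s <= t -> I s)
  (S00 : 0 <= S0) (fS : sumle (fun k => normc (f0 k) ^+ 2) (S0 ^+ 2))
  (small : 8 * gam * S0 <= 1).

(** Composing [theta] with the retraction [kappa] keeps it in [0, 1] on the whole line. With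
    iterates frozen in the same way the source is continuous everywhere, so that [duhamel_exists]
    yields solutions with two-sided derivatives at the ends of I. *)
Let src (q : int -> R -> R[i]) k t : R[i] :=
  (theta (kappa t))%:C * quad sg (fun j => q j t) k.

Let sol (q : int -> R -> R[i]) k : R -> R[i] :=
  xget (fun=> 0) [set y | y 0 = f0 k /\
    forall t, -1 < t -> cderiv y t (a k * y t + src q k t)].

Let solP q k : (forall t, ccont (nbhs t) (src q k) (src q k t)) ->
  sol q k 0 = f0 k /\
  forall t, -1 < t -> cderiv (sol q k) t (a k * sol q k t + src q k t).
Proof.
move=> cs; rewrite /sol; case: xgetP => [y -> //|H]; exfalso.
have [y Hy] := @duhamel_exists _ (a k) (f0 k) (src q k)
  (fun t => ccont_Re (cs t)) (fun t => ccont_Im (cs t)).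
exact: H y Hy.
Qed.

(* The iterates, precomposed with the retraction onto I. *)
Let it : nat -> int -> R -> R[i] :=
  fix it n := if n is n'.+1 then fun k t => sol (it n') k (kappa t) else fun _ _ => 0.

(** Majorants of the iterates, uniform in time. The factor [- Re (a k)] in the bound on the kernel
    is cancelled by the division in the Duhamel estimate, so only [e] is left in the recursion. *)
Let Maj : nat -> int -> R :=
  fix Maj n := if n is n'.+1
    then fun k => normc (f0 k) + conv e (Maj n') (Maj n') k else fun=> 0.

Let Maj_ge0 n k : 0 <= Maj n k.
Proof.
elim: n k => [//|n IH] k /=; rewrite addr_ge0 ?normc_ge0//.
exact: conv_ge0.
Qed.

Let sq4 : 4 * S0 ^+ 2 = (2 * S0) ^+ 2. Proof. by ring. Qed.

(** The ball of radius 2 S0 in l^2 is invariant: by (x + y)^2 <= 2 x^2 + 2 y^2 and [conv_l2], the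
    new square sum is at most 2 (S0^2 + 16 gam^2 S0^4), which is below 4 S0^2 as soon as 4 gam S0 <=
    1. *)
Let Maj_S n : sumle (fun k => Maj n k ^+ 2) ((2 * S0) ^+ 2).
Proof.
rewrite -sq4; elim: n => [|n IH].
  by apply: sumle_ub => s _; rewrite big1 ?mulr_ge0 ?sqr_ge0// => k _ /=; rewrite expr0n.
have h := conv_l2 e0 (Maj_ge0 n) (Maj_ge0 n) gam0 eg IH IH.
have h2 := sumleD (fun k => sqr_ge0 (normc (f0 k)))
  (fun k => sqr_ge0 (conv e (Maj n) (Maj n) k)) fS h.
apply: le_sumle (sumleZ _ (_ : 0 <= 2) h2) => //.
- by move=> k /=; have := sqr_ge0 (normc (f0 k) - conv e (Maj n) (Maj n) k); nra.
- have : (8 * gam * S0) ^+ 2 <= 1 by rewrite expr_le1// !mulr_ge0.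
  have := sqr_ge0 S0; nra.
- by move=> k; rewrite addr_ge0 ?sqr_ge0.
Qed.

Let Maj_mono n k : Maj n k <= Maj n.+1 k.
Proof.
elim: n k => [|n IH] k; first exact: Maj_ge0.
rewrite [leLHS]/= [leRHS]/= lerD2l -lee_fin.
rewrite -(convP e0 (Maj_ge0 n) (Maj_ge0 n) eg (Maj_S n) (Maj_S n)).
rewrite -(convP e0 (Maj_ge0 n.+1) (Maj_ge0 n.+1) eg (Maj_S n.+1) (Maj_S n.+1)).
apply: le_nsum => j; apply: ler_wpM2l => //.
by apply: ler_pM; rewrite ?Maj_ge0.
Qed.

(** All iterates share this majorant. Since [Maj n k] increases with n, the supremum is a limit and
    inherits the l^2 bound. *)
Let M k := sup (range (fun n => Maj n k)).

Let Maj_homo k : {homo (fun n => Maj n k) : m n / (m <= n)%N >-> m <= n}.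
Proof. by apply/nondecreasing_seqP => n; exact: Maj_mono. Qed.

Let Maj_ub k : has_ubound (range (fun n => Maj n k)).
Proof.
exists (2 * S0) => _ [n _ <-].
have := sumle_lb1 k (fun k => sqr_ge0 _) (Maj_S n).
by rewrite ler_pXn2r ?nnegrE ?Maj_ge0 ?mulr_ge0.
Qed.

Let Maj_M n k : Maj n k <= M k.
Proof. by apply: ub_le_sup; [exact: Maj_ub|exists n]. Qed.

Let M_ge0 k : 0 <= M k.
Proof. exact: le_trans (Maj_ge0 0 k) (Maj_M 0 k). Qed.

Let M_S : sumle (fun k => M k ^+ 2) ((2 * S0) ^+ 2).
Proof.
apply: sumle_ub => s us.
have h : (fun n => \sum_(k <- s) Maj n k ^+ 2) @ \oo --> \sum_(k <- s) M k ^+ 2.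
  apply: cvg_big => [|k _]; first exact: add_continuous.
  have hk : (fun n => Maj n k) @ \oo --> M k.
    by apply: nondecreasing_cvgn; [exact: Maj_homo|exact: Maj_ub].
  by rewrite expr2; under eq_fun do rewrite expr2; exact: cvgM.
apply: (ler_cvg_to h (cvg_cst _)); apply: nearW => n.
by apply: sumle_lb (Maj_S n) us => k; exact: sqr_ge0.
Qed.

Let S2 : 0 <= 2 * S0. Proof. by rewrite mulr_ge0. Qed.
Let ma0 k : 0 <= - Re (a k). Proof. by rewrite oppr_ge0 ltW. Qed.

Let src_ccont (q : int -> R -> R[i]) k (t : R) : (forall j t, normc (q j t) <= M j) ->
  (forall j t, ccont (nbhs t) (q j) (q j t)) -> ccont (nbhs t) (src q k) (src q k t).
Proof.
move=> qM qc; apply: ccontM.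
  by apply: ccont_real; apply: continuous_comp; [exact: ckappa|exact: ctheta].
apply: (quad_ccont e0 (ma0 k) eg (sge k) M_ge0 M_S) => //.
  by apply: nearW => s j.
Qed.

Let sol_duh (y g : R -> R[i]) k t G : I t ->
  (forall s, -1 < s -> cderiv y s (a k * y s + g s)) ->
  (forall s, normc (g s) <= - Re (a k) * G) ->
  normc (y t) <= normc (y 0) + G.
Proof.
move=> It dy gG; have t0 := Ige0 It.
have G0 : 0 <= G.
  have := le_trans (normc_ge0 _) (gG 0); rewrite pmulr_rge0//.
  by rewrite oppr_gt0.
have cy : forall s, s \in `[0, t] -> ccont (nbhs s) y (y s).
  move=> s; rewrite in_itv/= => /andP[s0 _]; apply: cderiv_ccont (dy s _).
  exact: lt_le_trans s0.
have := @duhamel_bound _ (a k) y g t (- Re (a k) * G) 0 t0.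
move=> /(_ _ _ _ _ _) h; apply: le_trans (h _ _ _ _ _) _.
- by move=> s /andP[s0 _]; apply: dy; exact: lt_trans s0.
- by apply: continuous_in_subspaceT => s /set_mem/= st; exact: (ccont_Re (cy s st)).
- by apply: continuous_in_subspaceT => s /set_mem/= st; exact: (ccont_Im (cy s st)).
- by move=> s _; rewrite mul0r expR0 mulr1.
- by rewrite sub0r oppr_gt0.
- rewrite mul0r expR0 mulr1 sub0r.
  have an : - Re (a k) != 0 by rewrite oppr_eq0 lt_eqF.
  rewrite [X in _ + X]mulrC mulKf// lerD2r ler_piMl ?normc_ge0// expR_le1.
  by rewrite nmulr_rle0.
Qed.

Let normM_theta t (z : R[i]) : normc ((theta (kappa t))%:C * z) <= normc z.
Proof.
rewrite Normc.normcM normc_real.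
have /andP[h0 h1] := theta01 (kappaI t).
by rewrite ger0_norm// ler_piMl ?normc_ge0.
Qed.

Let itP n : (forall k t, normc (it n k t) <= Maj n k) /\
  (forall k t, ccont (nbhs t) (it n k) (it n k t)).
Proof.
elim: n => [|n [IHb IHc]].
  by split => k t; [rewrite (_ : it 0 k t = 0)// normc_0|exact: ccont_cst].
have cs k t : ccont (nbhs t) (src (it n) k) (src (it n) k t).
  by apply: src_ccont => // j s; exact: le_trans (IHb j s) (Maj_M n j).
split=> k t; have [y0 dy] := solP (cs k).
  rewrite /= -y0; apply: sol_duh (kappaI t) dy _ => s.
  apply: le_trans (normM_theta s _) _.
  apply: (quad_norm e0 (ma0 k) eg (sge k) (Maj_ge0 n) (Maj_S n)).
  by move=> j; exact: IHb.
have -> : it n.+1 k = sol (it n) k \o kappa by [].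
have h := @cderiv_ccont _ _ _ _ (dy (kappa t) _).
have k1 : -1 < kappa t by apply: lt_le_trans (Ige0 (kappaI t)).
apply: (@ccont_comp _ kappa (sol (it n) k) t); first exact: ckappa.
exact: (h k1).
Qed.

Let it_M n k t : normc (it n k t) <= M k.
Proof. exact: le_trans ((itP n).1 k t) (Maj_M n k). Qed.

Let it_src n k t : ccont (nbhs t) (src (it n) k) (src (it n) k t).
Proof. by apply: src_ccont => [j s|]; [exact: it_M|exact: (itP n).2]. Qed.

(** Here the 8 of [small] is spent: the majorant has norm 2 S0, so [quad_lip] gives the factor 2 *
    gam * (2 * S0), which has to be at most 1/2. *)
Let lip2 q q' k A : (forall j t, normc (q j t) <= M j) ->
  (forall j t, normc (q' j t) <= M j) ->
  (forall t, ccont (nbhs t) (src q k) (src q k t)) ->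
  (forall t, ccont (nbhs t) (src q' k) (src q' k t)) ->
  (forall j t, normc (q j t - q' j t) <= A) -> 
  forall t, I t -> normc (sol q k t - sol q' k t) <= A / 2.
Proof.
move=> qM q'M cq cq' qq' t It.
have A0 : 0 <= A := le_trans (normc_ge0 _) (qq' 0 t).
have [y0 dy] := solP cq; have [y0' dy'] := solP cq'.
pose g s := src q k s - src q' k s.
have dd s : -1 < s -> cderiv (fun s => sol q k s - sol q' k s) s
    (a k * (sol q k s - sol q' k s) + g s).
  move=> s1; have [d1 d2] := dy s s1; have [d1' d2'] := dy' s s1.
  have -> : a k * (sol q k s - sol q' k s) + g s =
    (a k * sol q k s + src q k s) - (a k * sol q' k s + src q' k s).
    by rewrite /g; ring.
  split.
    under eq_fun do rewrite ReD ReN.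
    by rewrite ReD ReN; exact: is_deriveB.
  under eq_fun do rewrite ImD ImN.
  by rewrite ImD ImN; exact: is_deriveB.
have := sol_duh It dd (G := A / 2) => /=.
rewrite y0 y0' subrr normc_0 add0r; apply => s.
rewrite /g -mulrBr; apply: le_trans (normM_theta s _) _.
have := @quad_lip _ _ e gam (2 * S0) (- Re (a k)) M k e0 gam0 S2 (ma0 k) eg
  (sge k) M_ge0 M_S (fun j => q j s) (fun j => q' j s) A
  (fun j => qM j s) (fun j => q'M j s) (fun j => qq' j s).
move=> h; apply: le_trans h _; apply: (ler_wpM2l (ma0 k)).
by have := ler_wpM2r A0 small; lra.
Qed.

Let diff n k t : normc (it n.+1 k t - it n k t) <= 2 * S0 / 2 ^+ n.
Proof.
elim: n k t => [|n IH] k t.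
  rewrite expr0 divr1 subr0; apply: le_trans ((itP 1).1 k t) _.
  have := sumle_lb1 k (fun k => sqr_ge0 _) (Maj_S 1).
  by rewrite ler_pXn2r ?nnegrE ?Maj_ge0 ?mulr_ge0.
rewrite exprSr invfM mulrA.
apply: (@lip2 (it n.+1) (it n) k _ _ _ _ _ _ (kappa t) (kappaI t)).
- by move=> j s; exact: it_M.
- by move=> j s; exact: it_M.
- by move=> s; exact: it_src.
- by move=> s; exact: it_src.
- by move=> j s; exact: IH.
Qed.

Let cau n m k t : (n <= m)%N -> normc (it m k t - it n k t) <= 4 * S0 / 2 ^+ n.
Proof.
move=> nm; rewrite -(subnK nm); move: (m - n)%N => d.
suff : normc (it (d + n) k t - it n k t) <= 4 * S0 / 2 ^+ n - 4 * S0 / 2 ^+ (d + n).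
  move=> h; apply: le_trans h _; rewrite lerBlDr lerDl.
  by rewrite divr_ge0 ?mulr_ge0// exprn_ge0.
elim: d => [|d IH]; first by rewrite add0n !subrr normc_0.
have -> : it (d.+1 + n) k t - it n k t =
  (it (d.+1 + n) k t - it (d + n) k t) + (it (d + n) k t - it n k t) by ring.
apply: le_trans (normcD _ _) _.
have := diff (d + n) k t; rewrite -addSn => h.
apply: le_trans (lerD h IH) _.
rewrite addSn exprS le_eqVlt; apply/orP; left; apply/eqP.
by field; rewrite !expf_neq0.
Qed.

Let geo : (fun n => 4 * S0 / 2 ^+ n) @ \oo --> 0.
Proof.
apply: cvg0Ml; under eq_fun do rewrite -exprVn.
by apply: cvg_expr; rewrite ger0_norm ?invr_ge0// invf_lt1// ltr1n.
Qed.

Let lim_ex k t : exists l : R[i], forall n, normc (it n k t - l) <= 4 * S0 / 2 ^+ n.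
Proof. by apply: complex_cauchy geo _ => m n; exact: cau. Qed.

Let q k t : R[i] := projT1 (cid (lim_ex k t)).

Let qP n k t : normc (it n k t - q k t) <= 4 * S0 / 2 ^+ n.
Proof. exact: (projT2 (cid (lim_ex k t))). Qed.

Let q_M k t : normc (q k t) <= M k.
Proof.
rewrite -subr_le0; apply: (le_cvg0 geo); apply: nearW => n; rewrite lerBlDr.
have -> : q k t = it n k t - (it n k t - q k t) by ring.
apply: le_trans (normcB _ _) _; rewrite addrC.
by apply: lerD; [exact: qP|exact: it_M].
Qed.

Let q_ccont k t : ccont (nbhs t) (q k) (q k t).
Proof.
apply/cvgrPdist_le => eps eps0.
have e3 : 0 < eps / 3 by rewrite divr_gt0.
have /cvgrPdist_le/(_ _ e3)[N _ HN] := geo.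
have HN' : 4 * S0 / 2 ^+ N <= eps / 3.
  by have := HN N (leqnn N); rewrite sub0r normrN; apply: le_trans; exact: ler_norm.
have /cvgrPdist_le/(_ _ e3) := (itP N).2 k t; apply: filterS => s.
rewrite !sub0r !normrN ![`|normc _|]ger0_norm ?normc_ge0// => h.
have -> : q k s - q k t = (it N k s - it N k t) - (it N k s - q k s) + (it N k t - q k t).
  by ring.
apply: le_trans (normcD _ _) _.
have h1 := le_trans (qP N k t) HN'; have h2 := le_trans (qP N k s) HN'.
by apply: le_trans (lerD (le_trans (normcB _ _) (lerD h h2)) h1) _; lra.
Qed.

Let q_src k t : ccont (nbhs t) (src q k) (src q k t).
Proof. by apply: src_ccont. Qed.

Let sol_q k t : I t -> sol q k t = q k t.
Proof.
move=> It; apply/eqP; rewrite -subr_eq0; apply/eqP/normc_eq0/eqP.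
rewrite eq_le normc_ge0 andbT; apply: (le_cvg0 geo); apply: nearW => n.
have -> : sol q k t - q k t = (it n.+1 k t - q k t) - (it n.+1 k t - sol q k t) by ring.
have h1 := qP n.+1 k t.
have h2 : normc (it n.+1 k t - sol q k t) <= (4 * S0 / 2 ^+ n) / 2.
  change (normc (sol (it n) k (kappa t) - sol q k t) <= (4 * S0 / 2 ^+ n) / 2).
  rewrite (kappaK It); apply: (@lip2 (it n) q k _ _ _ _ _ _ t It) => //.
apply: le_trans (normcB _ _) _; apply: le_trans (lerD h1 h2) _.
rewrite exprSr invfM mulrA -splitr.
by [].
Qed.

Theorem picard : exists (p : int -> R -> R[i]) (N : int -> R),
  [/\ (forall k, 0 <= N k), sumle (fun k => N k ^+ 2) ((2 * S0) ^+ 2),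
      (forall k t, I t -> normc (p k t) <= N k), (forall k, p k 0 = f0 k) &
      forall k t, I t -> cderiv (p k) t
        (a k * p k t + (theta t)%:C * quad sg (fun j => p j t) k)].
Proof.
(* On I the functions [q] and [sol q] agree. The limit [q] is frozen outside I, whereas [sol q] has
   a two-sided derivative at the ends of I as well. *)
exists (sol q), M; split => //.
- by move=> k t It; rewrite sol_q.
- by move=> k; have [] := solP (q_src k).
- move=> k t It; have [_ /(_ t)] := solP (q_src k).
  rewrite (lt_le_trans _ (Ige0 It)) ?ltrN10// => /(_ isT).
  rewrite /src kappaK//.
  suff -> : (fun j => q j t) = (fun j => sol q j t) by [].
  by apply/funext => j; rewrite sol_q.
Qed.

End Existence.

(** * Uniqueness for the infinite system *)

Section Uniqueness.
Variable R : realType.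
Variables (a : int -> R[i]) (sg : int -> int -> R[i]) (e : int -> int -> R)
  (gam S T rho : R) (theta : R -> R) (p q : int -> R -> R[i]) (M : int -> R).
Hypotheses (rho0 : 0 <= rho) (a0 : forall k, 0 < rho - Re (a k))
  (sge : forall k j, normc (sg k j) <= (rho - Re (a k)) * e k j)
  (e0 : forall k j, 0 <= e k j) (gam0 : 0 <= gam)
  (eg : forall k, sumle (fun j => e k j ^+ 2) (gam ^+ 2))
  (theta01 : forall t, 0 <= t <= T -> 0 <= theta t <= 1)
  (M0 : forall k, 0 <= M k) (S0 : 0 <= S) (MS : sumle (fun k => M k ^+ 2) (S ^+ 2))
  (small : 4 * gam * S <= 1).

Let solves (p : int -> R -> R[i]) :=
  [/\ forall k t, 0 <= t <= T -> normc (p k t) <= M k,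
      forall k, {within `[0, T], continuous (fun s => Re (p k s))},
      forall k, {within `[0, T], continuous (fun s => Im (p k s))} &
      forall k t, 0 < t < T -> cderiv (p k) t
        (a k * p k t + (theta t)%:C * quad sg (fun j => p j t) k)].

(** Each pass through the Duhamel bound halves the difference in the norm weighted by e^(-rho t):
    [quad_lip] contributes 2 * gam * S <= 1/2, and the factor [rho - Re (a k)] of the kernel cancels
    against the divisor. The induction starts from |p - q| <= 2 M k <= 2 S. *)
Theorem ode_unique : solves p -> solves q -> (forall k, p k 0 = q k 0) ->
  forall k t, 0 <= t <= T -> p k t = q k t.
Proof.
move=> [pM pr pi dp] [qM qr qi dq] pq0.
have geo : (fun n => 2 * S / 2 ^+ n) @ \oo --> 0.
  apply: cvg0Ml; under eq_fun do rewrite -exprVn.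
  by apply: cvg_expr; rewrite ger0_norm ?invr_ge0// invf_lt1// ltr1n.
have H n : forall k t, 0 <= t <= T ->
    normc (p k t - q k t) <= 2 * S / 2 ^+ n * expR (rho * t).
  elim: n => [|n IH] k t /[dup] tT /andP[t0 t1].
    have MkS : M k <= S.
      have := sumle_lb1 k (fun k => sqr_ge0 _) MS.
      by rewrite ler_pXn2r ?nnegrE.
    rewrite expr0 divr1; apply: (@le_trans _ _ (2 * S * 1)).
      by apply: le_trans (normcB _ _) _; have := pM k t tT; have := qM k t tT; lra.
    by rewrite ler_wpM2l ?mulr_ge0// -expR0 ler_expR mulr_ge0.
  pose g s : R[i] := (theta s)%:C * (quad sg (fun j => p j s) k - quad sg (fun j => q j s) k).
  pose y s := p k s - q k s.
  have dy s : 0 < s < t -> cderiv y s (a k * y s + g s).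
    move=> /andP[s0 st]; have sT : 0 < s < T by rewrite s0 (lt_le_trans st).
    have [d1 d2] := dp k s sT; have [d1' d2'] := dq k s sT.
    have -> : a k * y s + g s = (a k * p k s + (theta s)%:C * quad sg (fun j => p j s) k) -
       (a k * q k s + (theta s)%:C * quad sg (fun j => q j s) k) by rewrite /y /g; ring.
    split; rewrite /y.
      under eq_fun do rewrite ReD ReN.
      by rewrite ReD ReN; exact: is_deriveB.
    under eq_fun do rewrite ImD ImN.
    by rewrite ImD ImN; exact: is_deriveB.
  have sub : `[0, t] `<=` `[0, T].
    by move=> x /=; rewrite !in_itv/= => /andP[-> xt]; rewrite (le_trans xt).
  have cr : {within `[0, t], continuous (fun s => Re (y s))}.
    have -> : (fun s => Re (y s)) = (fun s => Re (p k s) - Re (q k s)).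
      by apply/funext => s; rewrite ReD ReN.
    by apply: continuous_subspaceW sub _ => x; apply: cvgB; [exact: pr|exact: qr].
  have ci : {within `[0, t], continuous (fun s => Im (y s))}.
    have -> : (fun s => Im (y s)) = (fun s => Im (p k s) - Im (q k s)).
      by apply/funext => s; rewrite ImD ImN.
    by apply: continuous_subspaceW sub _ => x; apply: cvgB; [exact: pi|exact: qi].
  have gG s : 0 <= s <= t ->
      normc (g s) <= (rho - Re (a k)) * (2 * S / 2 ^+ n.+1) * expR (rho * s).
    move=> /andP[s0 st]; have sT : 0 <= s <= T by rewrite s0 (le_trans st).
    rewrite /g Normc.normcM normc_real.
    have /andP[h0 h1] := theta01 sT.
    apply: (@le_trans _ _ (1 * normc (quad sg (fun j => p j s) k - quad sg (fun j => q j s) k))).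
      by rewrite ler_wpM2r ?normc_ge0// ger0_norm.
    rewrite mul1r.
    have h := @quad_lip _ _ e gam S (rho - Re (a k)) M k e0 gam0 S0 (ltW (a0 k)) eg
      (sge k) M0 MS (fun j => p j s) (fun j => q j s) (2 * S / 2 ^+ n * expR (rho * s))
      (fun j => pM j s sT) (fun j => qM j s sT) (fun j => IH j s sT).
    apply: le_trans h _; rewrite -[leRHS]mulrA; apply: (ler_wpM2l (ltW (a0 k))).
    rewrite mulrA; apply: (ler_wpM2r (expR_ge0 _)).
    have h2 : 0 <= 2 * S / 2 ^+ n by rewrite divr_ge0 ?mulr_ge0// exprn_ge0.
    by rewrite exprSr invfM [leRHS]mulrA; have := ler_wpM2r h2 small; lra.
  have := duhamel_bound t0 dy cr ci gG (a0 k).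
  rewrite /y pq0 subrr normc_0 mulr0 add0r => h; apply: le_trans h _.
  rewrite le_eqVlt; apply/orP; left; apply/eqP.
  by field; rewrite expf_neq0//= gt_eqF.
move=> k t tT; apply/eqP; rewrite -subr_eq0; apply/eqP/normc_eq0/eqP.
rewrite eq_le normc_ge0 andbT.
have geo' : (fun n => 2 * S / 2 ^+ n * expR (rho * t)) @ \oo --> 0.
  by under eq_fun do rewrite mulrC; exact: cvg0Ml.
by apply: (le_cvg0 geo'); apply: nearW => n; exact: H.
Qed.

End Uniqueness.

(** * Fourier series on the circle *)

Section L1.
Variable R : realType.
Local Notation mu := (@lebesgue_measure R).
Local Notation S1 := (@S1 R).
Implicit Types (f g phi : R -> R).

Definition int1 f : Prop := mu.-integrable S1 (EFin \o f).
Definition I1 f : R := \int[mu]_(x in S1) f x.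

Lemma mS1 : measurable (S1 : set (measurableTypeR R)). Proof. exact: measurable_itv. Qed.

Lemma muS1 : mu S1 = (2 * pi)%:E.
Proof.
rewrite /Defs.S1 lebesgue_measure_itv/= lte_fin gtrN ?pi_gt0//.
by rewrite -EFinD opprK mulr2n mulrDl mul1r.
Qed.

Lemma pi2_gt0 : 0 < 2 * pi :> R.
Proof. by rewrite mulr_gt0// pi_gt0. Qed.

Lemma inLp1P f : inLp 1%E f <-> int1 f.
Proof.
rewrite /inLp Lfun1_integrable /int1 (integrable_mkcond _ mS1).
by rewrite restrict_EFin.
Qed.

Lemma int1_measurable f : int1 f -> measurable_fun S1 f.
Proof. by move=> /integrableP[/measurable_EFinP]. Qed.

Lemma int1D f g : int1 f -> int1 g -> int1 (fun x => f x + g x).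
Proof. by move=> hf hg; exact: (integrableD mS1 hf hg). Qed.

Lemma int1Z c f : int1 f -> int1 (fun x => c * f x).
Proof. by move=> hf; exact: (integrableZl mS1 c hf). Qed.

Lemma int1N f : int1 f -> int1 (fun x => - f x).
Proof. by move=> /(int1Z (-1)); under eq_fun do rewrite mulN1r. Qed.

Lemma int1B f g : int1 f -> int1 g -> int1 (fun x => f x - g x).
Proof. by move=> hf hg; apply: int1D => //; exact: int1N. Qed.

Lemma int1_le f g : measurable_fun S1 f -> (forall x, S1 x -> `|f x| <= g x) ->
  int1 g -> int1 f.
Proof.
move=> mf fg hg; apply: le_integrable hg => //; first exact: mS1.
  exact/measurable_EFinP.
by move=> x Sx; rewrite /= lee_fin (le_trans (fg x Sx))// ler_norm.
Qed.

Lemma int1_abs f : int1 f -> int1 (fun x => `|f x|).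
Proof. by move=> hf; apply: (integrable_norm hf). Qed.

Lemma int1_cst c : int1 (fun=> c).
Proof.
apply/integrableP; split; first exact: measurable_cst.
rewrite integral_cst//= ?muS1 ?mule_lty//; last exact: mS1.
by rewrite -EFinM ltry.
Qed.

Lemma int1Ml f phi (C : R) : measurable_fun S1 phi -> (forall x, `|phi x| <= C) ->
  int1 f -> int1 (fun x => f x * phi x).
Proof.
move=> mp pC hf; apply: (@int1_le _ (fun x => C * `|f x|)).
- by apply: measurable_funM => //; exact: int1_measurable.
- by move=> x _; rewrite normrM mulrC ler_wpM2r.
- by apply: int1Z; exact: int1_abs.
Qed.

Lemma I1D f g : int1 f -> int1 g -> I1 (fun x => f x + g x) = I1 f + I1 g.
Proof. by move=> hf hg; rewrite /I1 RintegralD//; exact: mS1. Qed.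

Lemma I1B f g : int1 f -> int1 g -> I1 (fun x => f x - g x) = I1 f - I1 g.
Proof. by move=> hf hg; rewrite /I1 RintegralB//; exact: mS1. Qed.

Lemma I1Z c f : int1 f -> I1 (fun x => c * f x) = c * I1 f.
Proof. by move=> hf; rewrite /I1 RintegralZl//; exact: mS1. Qed.

Lemma eq_I1 f g : (forall x, f x = g x) -> I1 f = I1 g.
Proof. by move=> fg; apply: eq_Rintegral => x _; exact: fg. Qed.

Lemma I1_cst c : I1 (fun=> c) = c * (2 * pi).
Proof. by rewrite /I1 (@Rintegral_cst _ _ _ mu S1 (@mS1)); congr (_ * _); exact: (congr1 fine muS1). Qed.

Lemma le_I1 f g : int1 f -> int1 g -> (forall x, S1 x -> f x <= g x) -> I1 f <= I1 g.
Proof. by move=> hf hg fg; apply: le_Rintegral => //; exact: mS1. Qed.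

Lemma I1_ge0 f : (forall x, 0 <= f x) -> 0 <= I1 f.
Proof. by move=> f0; apply: Rintegral_ge0. Qed.

Lemma I1_norm f : int1 f -> `|I1 f| <= I1 (fun x => `|f x|).
Proof. by move=> hf; apply: le_normr_Rintegral => //; exact: mS1. Qed.

Lemma I1_EFin f : int1 f -> (\int[mu]_(x in S1) (f x)%:E)%E = (I1 f)%:E.
Proof.
move=> hf; rewrite /I1 /Rintegral fineK//.
exact: (integrable_fin_num mS1 hf).
Qed.

Lemma I1_ae f g : int1 f -> int1 g -> ae_eqS1 f g -> I1 f = I1 g.
Proof.
move=> hf hg fg; rewrite /I1 /Rintegral; congr fine.
apply: ae_eq_integral => //.
- exact: mS1.
- exact: measurable_int hf.
- exact: measurable_int hg.
- by apply: filterS fg => x h /h /= ->.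
Qed.

Lemma int1_sum (I : Type) (s : seq I) (F : I -> R -> R) :
  (forall i, int1 (F i)) -> int1 (fun x => \sum_(i <- s) F i x).
Proof.
move=> hF; elim: s => [|i s IH].
  by under eq_fun do rewrite big_nil; exact: int1_cst.
by under eq_fun do rewrite big_cons; exact: int1D.
Qed.

Lemma mcos (b : R) : measurable_fun S1 (fun x => cos (b * x)).
Proof.
apply: measurable_funTS; apply: continuous_measurable_fun => x.
by apply: continuous_comp; [exact: mulrl_continuous|exact: continuous_cos].
Qed.

Lemma msin (b : R) : measurable_fun S1 (fun x => sin (b * x)).
Proof.
apply: measurable_funTS; apply: continuous_measurable_fun => x.
by apply: continuous_comp; [exact: mulrl_continuous|exact: continuous_sin].
Qed.

Lemma int1cos f (b : R) : int1 f -> int1 (fun x => f x * cos (b * x)).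
Proof. by apply: (@int1Ml _ _ 1); [exact: mcos|move=> x; exact: cos_max]. Qed.

Lemma int1sin f (b : R) : int1 f -> int1 (fun x => f x * sin (b * x)).
Proof. by apply: (@int1Ml _ _ 1); [exact: msin|move=> x; exact: sin_max]. Qed.

Definition sq1 f : Prop := measurable_fun S1 f /\ int1 (fun x => f x ^+ 2).
Definition I2 f : R := I1 (fun x => f x ^+ 2).

Lemma sq1M f g : sq1 f -> sq1 g -> int1 (fun x => f x * g x).
Proof.
move=> [mf f2] [mg g2]; apply: (@int1_le _ (fun x => f x ^+ 2 + g x ^+ 2)).
- exact: measurable_funM.
- move=> x _; rewrite normrM -[f x ^+ 2]real_normK ?num_real//.
  rewrite -[g x ^+ 2]real_normK ?num_real//.
  by have := sqr_ge0 (`|f x| - `|g x|); have := normr_ge0 (f x); have := normr_ge0 (g x); nra.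
- exact: int1D.
Qed.

Lemma sq1_cst c : sq1 (fun=> c).
Proof. by split; [exact: measurable_cst|exact: int1_cst]. Qed.

Lemma sq1_int1 f : sq1 f -> int1 f.
Proof.
move=> hf; have := sq1M hf (sq1_cst 1).
by under eq_fun do rewrite mulr1.
Qed.

Lemma sq1D f g : sq1 f -> sq1 g -> sq1 (fun x => f x + g x).
Proof.
move=> hf hg; have fg := sq1M hf hg; case: hf hg => [mf f2] [mg g2].
split; first exact: measurable_funD.
under eq_fun do rewrite sqrrD.
by apply: int1D => //; apply: int1D => //; under eq_fun do rewrite -mulr_natl; exact: int1Z.
Qed.

Lemma sq1Z c f : sq1 f -> sq1 (fun x => c * f x).
Proof.
move=> [mf f2]; split; first by apply: measurable_funM => //; exact: measurable_cst.
by under eq_fun do rewrite exprMn; exact: int1Z.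
Qed.

Lemma sq1B f g : sq1 f -> sq1 g -> sq1 (fun x => f x - g x).
Proof.
move=> hf /(sq1Z (-1)) hg; have := sq1D hf hg.
by under eq_fun do rewrite mulN1r.
Qed.

Lemma I2_ge0 f : 0 <= I2 f.
Proof. by apply: I1_ge0 => x; exact: sqr_ge0. Qed.

Lemma I1_CS f g : sq1 f -> sq1 g -> I1 (fun x => f x * g x) ^+ 2 <= I2 f * I2 g.
Proof.
move=> hf hg; have fg := sq1M hf hg; have [_ f2] := hf; have [_ g2] := hg.
set A := I2 f; set B := I1 _; set C := I2 g.
have H t : 0 <= A * t ^+ 2 - 2 * B * t + C.
  suff -> : A * t ^+ 2 - 2 * B * t + C = I1 (fun x => (t * f x - g x) ^+ 2).
    by apply: I1_ge0 => x; exact: sqr_ge0.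
  rewrite (@eq_I1 _ (fun x => t ^+ 2 * f x ^+ 2 - (2 * t) * (f x * g x) + g x ^+ 2)); last first.
    by move=> x; ring.
  rewrite I1D//; last by apply: int1B; exact: int1Z.
  rewrite I1B ?I1Z//; do ?exact: int1Z.
  by rewrite /A /B /C /I2; ring.
have A0 : 0 <= A by exact: I2_ge0.
have [A0'|An] := eqVneq A 0.
  have [->|Bn] := eqVneq B 0; first by rewrite A0' expr0n mul0r.
  have := H ((C + 1) / (2 * B)).
  have -> : 2 * B * ((C + 1) / (2 * B)) = C + 1 by field.
  by rewrite A0' mul0r; lra.
have Ap : 0 < A by rewrite lt_def An.
have := H (B / A).
have -> : A * (B / A) ^+ 2 - 2 * B * (B / A) + C = (A * C - B ^+ 2) / A by field.
by rewrite pmulr_lge0 ?invr_gt0// subr_ge0.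
Qed.

Lemma I1_CS_abs f g : sq1 f -> sq1 g ->
  I1 (fun x => `|f x * g x|) <= Num.sqrt (I2 f * I2 g).
Proof.
move=> hf hg.
have ha h : sq1 h -> sq1 (fun x => `|h x|).
  move=> [mh h2]; split; first exact: measurableT_comp.
  by under eq_fun do rewrite real_normK ?num_real//.
have := I1_CS (ha _ hf) (ha _ hg).
rewrite /I2 (@eq_I1 (fun x => `|f x| ^+ 2) (fun x => f x ^+ 2)); last first.
  by move=> x; rewrite real_normK ?num_real.
rewrite (@eq_I1 (fun x => `|g x| ^+ 2) (fun x => g x ^+ 2)); last first.
  by move=> x; rewrite real_normK ?num_real.
rewrite (@eq_I1 (fun x => `|f x * g x|) (fun x => `|f x| * `|g x|)); last first.
  by move=> x; rewrite normrM.
move=> h; have h0 : 0 <= I1 (fun x => `|f x| * `|g x|) by apply: I1_ge0 => x; rewrite mulr_ge0.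
by rewrite -[leLHS]ger0_norm// -sqrtr_sqr; exact: ler_wsqrtr.
Qed.

Lemma inLp2P f : inLp 2%:E f <-> sq1 f.
Proof.
rewrite /inLp; split.
  move=> /[dup] /Lfun2_integrable_sqr h; rewrite inE => /andP[+ _].
  rewrite inE/= => mf; split.
    by apply/(measurable_restrictT _ mS1).
  rewrite /int1 (integrable_mkcond _ mS1) restrict_EFin.
  apply: eq_integrable h => // x _ /=.
  by rewrite /patch; case: ifP => //; rewrite expr0n.
move=> [mf f2]; rewrite inE; apply/andP; split; rewrite inE/=.
  by apply/(measurable_restrictT _ mS1).
rewrite /finite_norm unlock/=; apply: poweR_lty.
move: f2; rewrite /int1 (integrable_mkcond _ mS1) restrict_EFin => /integrableP[_].
apply: le_lt_trans; rewrite le_eqVlt; apply/orP; left; apply/eqP.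
apply: eq_integral => x _ /=.
rewrite /patch; case: ifP => _; first by rewrite powR_mulrn// normrX.
by rewrite normr0 powR0.
Qed.

Lemma L2norm_sqrt f : sq1 f -> L2norm f = Num.sqrt (I2 f).
Proof.
move=> [mf f2]; rewrite /L2norm unlock/= fine_poweR powR12_sqrt; last first.
  by apply: fine_ge0; apply: integral_ge0 => x _; rewrite lee_fin powR_ge0.
congr Num.sqrt; rewrite /I2 /I1 Rintegral_mkcond /Rintegral; congr fine.
apply: eq_integral => x _ /=.
rewrite /patch; case: ifP => _; first by rewrite powR_mulrn// real_normK ?num_real.
by rewrite normr0 powR0.
Qed.

Lemma L2norm_sqr f : sq1 f -> L2norm f ^+ 2 = I2 f.
Proof. by move=> hf; rewrite L2norm_sqrt// sqr_sqrtr// I2_ge0. Qed.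

End L1.

(** * Fourier coefficients, trigonometric polynomials and Bessel's inequality *)

Section Trig.
Variable R : realType.
Local Notation mu := (@lebesgue_measure R).
Local Notation S1 := (@S1 R).
Implicit Types (f g phi : R -> R) (j k : int).

Lemma fhatE f k : fhat f k =
  ((2 * pi)^-1 * I1 (fun x => f x * cos (k%:~R * x))) +i*
  (- ((2 * pi)^-1 * I1 (fun x => f x * sin (k%:~R * x)))).
Proof. by []. Qed.

Lemma fhatD f g : int1 f -> int1 g ->
  fhat (fun x => f x + g x) = fun k => fhat f k + fhat g k.
Proof.
move=> hf hg; apply/funext => k; rewrite !fhatE; apply: complex_ext.
  rewrite [RHS]ReD [LHS]/= -mulrDr -I1D; do ?exact: int1cos.
  by congr (_ * _); apply: eq_I1 => x; rewrite mulrDl.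
rewrite [RHS]ImD [LHS]/= -opprD -mulrDr -I1D; do ?exact: int1sin.
by congr (- (_ * _)); apply: eq_I1 => x; rewrite mulrDl.
Qed.

Lemma fhatZ (c : R) f : int1 f -> fhat (fun x => c * f x) = fun k => c%:C * fhat f k.
Proof.
move=> hf; apply/funext => k; rewrite !fhatE; apply: complex_ext.
  rewrite [RHS]ReM /= mul0r subr0 mulrCA -(@I1Z _ c); last exact: int1cos.
  by congr (_ * _); apply: eq_I1 => x; rewrite mulrA.
rewrite [RHS]ImM /= mul0r addr0 mulrN mulrCA -(@I1Z _ c); last exact: int1sin.
by congr (- (_ * _)); apply: eq_I1 => x; rewrite mulrA.
Qed.

Lemma fhatB f g : int1 f -> int1 g ->
  fhat (fun x => f x - g x) = fun k => fhat f k - fhat g k.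
Proof.
move=> hf hg; have h := fhatD hf (int1Z (-1) hg).
under eq_fun do rewrite -(mulN1r (g _)).
rewrite h; apply/funext => k; rewrite fhatZ//.
by rewrite rmorphN1 mulN1r.
Qed.


Lemma fhat_conj f k : int1 f -> fhat f (- k) = (fhat f k)^*.
Proof.
move=> hf; rewrite !fhatE; apply: complex_ext => /=.
  by congr (_ * _); apply: eq_I1 => x; rewrite mulrNz mulNr cosN.
congr (- _); rewrite -mulrN; congr (_ * _); rewrite -mulN1r -I1Z; last exact: int1sin.
by apply: eq_I1 => x; rewrite mulrNz mulNr sinN mulN1r mulrN.
Qed.

Lemma fhat_cos f j k : int1 f -> fhat (fun x => f x * cos (j%:~R * x)) k =
  (2^-1)%:C * (fhat f (k - j) + fhat f (k + j)).
Proof.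
move=> hf; rewrite !fhatE; apply: complex_ext.
  rewrite [RHS]ReM [X in _ = _ * X - _]ReD /= mul0r subr0 -mulrDr mulrCA; congr (_ * _).
  rewrite -I1D; do ?exact: int1cos; rewrite -I1Z; last by apply: int1D; exact: int1cos.
  apply: eq_I1 => x; rewrite rmorphB rmorphD/= mulrBl mulrDl cosB cosD.
  by field.
rewrite [RHS]ImM [X in _ = _ * X + _]ImD /= mul0r addr0 -opprD -mulrDr mulrN; congr (- _).
rewrite mulrCA; congr (_ * _).
rewrite -I1D; do ?exact: int1sin; rewrite -I1Z; last by apply: int1D; exact: int1sin.
apply: eq_I1 => x; rewrite rmorphB rmorphD/= mulrBl mulrDl sinB sinD.
by field.
Qed.

Lemma fhat_sin f j k : int1 f -> fhat (fun x => f x * sin (j%:~R * x)) k =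
  (0 +i* 2^-1) * (fhat f (k + j) - fhat f (k - j)).
Proof.
move=> hf; rewrite !fhatE.
have e1 : I1 (fun x => f x * sin (j%:~R * x) * cos (k%:~R * x)) =
    2^-1 * (I1 (fun x => f x * sin ((k + j)%:~R * x)) -
            I1 (fun x => f x * sin ((k - j)%:~R * x))).
  rewrite -I1B; do ?exact: int1sin; rewrite -I1Z; last by apply: int1B; exact: int1sin.
  apply: eq_I1 => x; rewrite rmorphB rmorphD/= mulrBl mulrDl sinB sinD.
  by field.
have e2 : I1 (fun x => f x * sin (j%:~R * x) * sin (k%:~R * x)) =
    2^-1 * (I1 (fun x => f x * cos ((k - j)%:~R * x)) -
            I1 (fun x => f x * cos ((k + j)%:~R * x))).
  rewrite -I1B; do ?exact: int1cos; rewrite -I1Z; last by apply: int1B; exact: int1cos.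
  apply: eq_I1 => x; rewrite rmorphB rmorphD/= mulrBl mulrDl cosB cosD.
  by field.
by rewrite e1 e2; move: (2 * pi)^-1 => q; apply: complex_ext => /=; field.
Qed.

Lemma sin_kpi k : sin (k%:~R * pi) = 0 :> R.
Proof.
have H (n : nat) : sin (n%:R * pi) = 0 :> R.
  have := alternatingn (@sinDpi R) n 0.
  by rewrite add0r sin0 mulr0 mulr_natl.
case: k => n; first exact: H.
by rewrite NegzE mulrNz mulNr sinN H oppr0.
Qed.

Lemma I1_deriv (f F : R -> R) : continuous f -> (forall x : R, is_derive x 1 F (f x)) ->
  I1 f = F pi - F (- pi).
Proof.
move=> cf dF; have pp : - pi < pi :> R by rewrite gtrN ?pi_gt0.
have cF : continuous F.
  move=> x; apply: differentiable_continuous; apply/derivable1_diffP.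
  exact: ex_derive.
rewrite /I1 /Rintegral (@continuous_FTC2 _ f F _ _ pp)//.
- exact: continuous_subspaceT.
- split; first by move=> x _; exact: ex_derive.
  + by apply: cvg_at_right_filter; exact: cF.
  + by apply: cvg_at_left_filter; exact: cF.
- by move=> x _; rewrite derive1E derive_val.
Qed.

Lemma fhat1 k : fhat (fun=> 1) k = if k == 0 then 1 else 0 :> R[i].
Proof.
have cc (b : R) : continuous (fun x : R => cos (b * x)).
  by move=> x; apply: continuous_comp; [exact: mulrl_continuous|exact: continuous_cos].
have cs (b : R) : continuous (fun x : R => sin (b * x)).
  by move=> x; apply: continuous_comp; [exact: mulrl_continuous|exact: continuous_sin].
have p0 := @pi2_gt0 R.
rewrite fhatE; have [->|k0] := eqVneq k 0.
  apply: complex_ext => /=.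
    rewrite (@eq_I1 _ _ (fun=> 1)); first by rewrite I1_cst mul1r mulVf// gt_eqF.
    by move=> x; rewrite mul0r cos0 mul1r.
  rewrite (@eq_I1 _ _ (fun=> 0)); first by rewrite I1_cst mul0r mulr0 oppr0.
  by move=> x; rewrite mul0r sin0 mul1r.
have kn : k%:~R != 0 :> R by rewrite intr_eq0.
apply: complex_ext => /=.
  rewrite (@eq_I1 _ _ (fun x => cos (k%:~R * x))); last by move=> x; rewrite mul1r.
  have -> : I1 (fun x : R => cos (k%:~R * x)) =
      k%:~R^-1 * sin (k%:~R * pi) - k%:~R^-1 * sin (k%:~R * - pi).
    apply: (@I1_deriv _ (fun x => k%:~R^-1 * sin (k%:~R * x))); first exact: cc.
    move=> x; apply: is_derive_eq.
    by rewrite /GRing.scale/= mulr1 mulrCA mulVf// mulr1.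
  by rewrite mulrN sinN sin_kpi oppr0 mulr0 subr0 mulr0.
rewrite (@eq_I1 _ _ (fun x => sin (k%:~R * x))); last by move=> x; rewrite mul1r.
have -> : I1 (fun x : R => sin (k%:~R * x)) =
    - k%:~R^-1 * cos (k%:~R * pi) - - k%:~R^-1 * cos (k%:~R * - pi).
  apply: (@I1_deriv _ (fun x => - k%:~R^-1 * cos (k%:~R * x))); first exact: cs.
  move=> x; apply: is_derive_eq.
  by rewrite /GRing.scale/= mulr1 !mulNr mulrN opprK mulrCA mulVf// mulr1.
by rewrite mulrN cosN subrr mulr0 oppr0.
Qed.

(** The real part of the sum of a_j e^(ijx) over |j| <= n. For [herm a] that sum is real, so nothing
    is lost. *)
Definition tpol (a : distr R) n (x : R) : R :=
  \sum_(j <- zrange n) (Re (a j) * cos (j%:~R * x) - Im (a j) * sin (j%:~R * x)).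

Definition herm (a : distr R) : Prop := forall k, a (- k) = (a k)^*.

Lemma tpol_meas a n : measurable_fun S1 (tpol a n).
Proof.
apply: measurable_sum => j; apply: measurable_funB; apply: measurable_funM;
  by [exact: measurable_cst|exact: mcos|exact: msin].
Qed.

Lemma tpol_bound a n x : `|tpol a n x| <= \sum_(j <- zrange n) (`|Re (a j)| + `|Im (a j)|).
Proof.
apply: le_trans (ler_norm_sum _ _ _) _; apply: ler_sum => j _.
apply: le_trans (ler_normB _ _) _; rewrite !normrM.
by apply: lerD; rewrite ler_piMr//; [exact: cos_max|exact: sin_max].
Qed.

Lemma sq1_tpol a n : sq1 (tpol a n).
Proof.
split; first exact: tpol_meas.
set C := \sum_(j <- zrange n) (`|Re (a j)| + `|Im (a j)|).
apply: (@int1_le _ _ (fun=> C ^+ 2)); last exact: int1_cst.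
  by apply: measurable_funX; exact: tpol_meas.
by move=> x _; rewrite normrX lerXn2r ?nnegrE// ?tpol_bound// (le_trans _ (tpol_bound a n x)).
Qed.

Lemma fhat_sum (s : seq int) (F : int -> R -> R) k : (forall i, int1 (F i)) ->
  fhat (fun x => \sum_(i <- s) F i x) k = \sum_(i <- s) fhat (F i) k.
Proof.
move=> hF; elim: s => [|i s IH].
  rewrite big_nil; under eq_fun do rewrite big_nil -(mul0r 1).
  by rewrite fhatZ ?mul0r//; exact: int1_cst.
under eq_fun do rewrite big_cons.
by rewrite fhatD// ?IH ?big_cons//; exact: int1_sum.
Qed.

Lemma fhat_tpolM a g n k : herm a -> int1 g ->
  fhat (fun x => g x * tpol a n x) k = \sum_(j <- zrange n) a j * fhat g (k - j).
Proof.
move=> ha hg.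
pose F j x := Re (a j) * (g x * cos (j%:~R * x)) - Im (a j) * (g x * sin (j%:~R * x)).
have hF j : int1 (F j).
  by apply: int1B; apply: int1Z; [exact: int1cos|exact: int1sin].
have -> : (fun x => g x * tpol a n x) = (fun x => \sum_(j <- zrange n) F j x).
  apply/funext => x; rewrite mulr_sumr; apply: eq_bigr => j _; rewrite /F; ring.
rewrite fhat_sum//.
(* The real term of index j contributes one half at the shift k - j and one half at k + j.
   Reflecting j in the second half merges both. *)
have E j : fhat (F j) k = (2^-1)%:C * (a j * fhat g (k - j)) +
    (2^-1)%:C * (a (- j) * fhat g (k - - j)).
  rewrite /F fhatB; [|exact/int1Z/int1cos|exact/int1Z/int1sin].
  rewrite !fhatZ; [|exact/int1sin|exact/int1cos].
  rewrite fhat_cos// fhat_sin// opprK ha.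
  move: (fhat g (k - j)) (fhat g (k + j)) (a j) => [c d] [c' d'] [u v].
  by apply: complex_ext => /=; field.
under eq_bigr do rewrite E.
rewrite big_split/=.
have -> : \sum_(j <- zrange n) (2^-1)%:C * (a (- j) * fhat g (k - - j)) =
    \sum_(j <- zrange n) (2^-1)%:C * (a j * fhat g (k - j)).
  rewrite -(big_map (fun j => - j) predT (fun j => (2^-1)%:C * (a j * fhat g (k - j)))).
  apply: perm_big; apply: uniq_perm; rewrite ?zrange_uniq//.
    by rewrite map_inj_uniq ?zrange_uniq//; exact: oppr_inj.
  move=> x; rewrite -[x]opprK mem_map; last exact: oppr_inj.
  by rewrite !mem_zrange opprK; lia.
rewrite -big_split/=; apply: eq_bigr => j _.
rewrite -mulrDl -rmorphD/= -[2^-1]mul1r -splitr.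
by rewrite rmorph1 mul1r.
Qed.

Lemma fhat_tpol a n k : herm a -> fhat (tpol a n) k = if (`|k| <= n)%N then a k else 0.
Proof.
move=> ha; have -> : tpol a n = (fun x => 1 * tpol a n x).
  by apply/funext => x; rewrite mul1r.
rewrite fhat_tpolM//; last exact: int1_cst.
under eq_bigr do rewrite fhat1 subr_eq0.
rewrite -mem_zrange; case: ifPn => kn.
  rewrite (bigD1_seq k) ?zrange_uniq//= eqxx mulr1 big1_seq ?addr0// => j.
  by rewrite eq_sym => /andP[/negbTE-> _]; rewrite mulr0.
rewrite big1_seq// => j /andP[_ jn]; case: eqP => [kj|_]; last by rewrite mulr0.
by rewrite kj jn in kn.
Qed.

Lemma I1_fhat f : I1 f = 2 * pi * Re (fhat f 0).
Proof.
rewrite fhatE/= mulrA divff ?mul1r ?gt_eqF ?pi2_gt0//.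
by apply: eq_I1 => x; rewrite mul0r cos0 mulr1.
Qed.

Lemma I1_tpolM f n : int1 f -> 
  I1 (fun x => f x * tpol (fhat f) n x) = 2 * pi * \sum_(j <- zrange n) normc (fhat f j) ^+ 2.
Proof.
move=> hf; rewrite I1_fhat fhat_tpolM//; last by move=> k; exact: fhat_conj.
rewrite Re_sum; congr (_ * _); apply: eq_bigr => j _.
by rewrite sub0r fhat_conj// ReM normc_sqr; case: (fhat f j) => u v /=; ring.
Qed.

Lemma I2_tpol a n : herm a ->
  I2 (tpol a n) = 2 * pi * \sum_(j <- zrange n) normc (a j) ^+ 2.
Proof.
move=> ha; rewrite /I2 -[X in _ = _ * X](_ : \sum_(j <- zrange n) normc (fhat (tpol a n) j) ^+ 2 = _).
  rewrite -I1_tpolM; last exact/sq1_int1/sq1_tpol.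
  apply: eq_I1 => x; rewrite expr2; congr (_ * _).
  apply: eq_big_seq => j; rewrite mem_zrange => jn.
  by rewrite fhat_tpol// jn.
by apply: eq_big_seq => j; rewrite mem_zrange => jn; rewrite fhat_tpol// jn.
Qed.

Lemma bessel f : sq1 f -> sumle (fun k => normc (fhat f k) ^+ 2) ((2 * pi)^-1 * I2 f).
Proof.
move=> hf; have f1 := sq1_int1 hf.
have H n : \sum_(j <- zrange n) normc (fhat f j) ^+ 2 <= (2 * pi)^-1 * I2 f.
  rewrite ler_pdivlMl ?pi2_gt0//.
  have hT := sq1_tpol (fhat f) n.
  have : 0 <= I2 (fun x => f x - tpol (fhat f) n x) by exact: I2_ge0.
  rewrite /I2 (@eq_I1 _ _ (fun x => f x ^+ 2 - 2 * (f x * tpol (fhat f) n x) + tpol (fhat f) n x ^+ 2)); last first.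
    by move=> x; ring.
  have i1 := int1Z 2 (sq1M hf hT); have i2 := hf.2; have i3 := hT.2.
  rewrite I1D//; last exact: int1B.
  rewrite I1B// I1Z; last exact: sq1M.
  rewrite I1_tpolM// -/(I2 (tpol _ _)) I2_tpol; last by move=> k; exact: fhat_conj.
  lra.
by apply: sumle_zrange H => k; exact: sqr_ge0.
Qed.

End Trig.

(** * Polynomials approximating a step *)

Section StepPolynomials.
Variable R : realType.
Implicit Types (y z : R).

(* On [0, 1] these polynomials are bounded by 1 and converge to the indicator
   of [0, 1/2[ away from 1/2. *)
Definition step (n : nat) y : R := (1 - y ^+ n) ^+ (2 ^ n).

Lemma bernoulli_le m z : 0 <= z -> 1 + m%:R * z <= (1 + z) ^+ m.
Proof.
move=> z0; elim: m => [|m IH]; first by rewrite mul0r addr0 expr0.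
rewrite exprS; apply: le_trans (ler_wpM2l _ IH); last lra.
have : 0 <= m%:R * z * z by rewrite !mulr_ge0.
by rewrite -addn1 natrD; lra.
Qed.

Lemma bernoulli_sub m z : 0 <= z <= 1 -> 1 - m%:R * z <= (1 - z) ^+ m.
Proof.
move=> /andP[z0 z1]; elim: m => [|m IH]; first by rewrite mul0r subr0 expr0.
rewrite exprS; apply: le_trans (ler_wpM2l _ IH); last lra.
have : 0 <= m%:R * z * z by rewrite !mulr_ge0.
by rewrite -addn1 natrD; lra.
Qed.

Lemma step01 n y : 0 <= y <= 1 -> 0 <= step n y <= 1.
Proof.
move=> /andP[y0 y1]; have h : 0 <= 1 - y ^+ n <= 1.
  by have := exprn_ge0 n y0; have := exprn_ile1 n y0 y1; lra.
case/andP: h => h0 h1; rewrite /step exprn_ge0//= exprn_ile1//.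
Qed.

Lemma natr_pow2 n : (2 ^ n)%:R = 2 ^+ n :> R. Proof. by rewrite natrX. Qed.

Lemma step_cvg1 y : 0 <= y < 2^-1 -> (fun n => step n y) @ \oo --> (1 : R).
Proof.
move=> /andP[y0 y1].
have h : (fun n => 1 - (2 * y) ^+ n) @ \oo --> (1 : R).
  rewrite -[X in _ --> X]subr0; apply: cvgB; first exact: cvg_cst.
  by apply: cvg_expr; rewrite ger0_norm ?mulr_ge0//; lra.
have h' : (fun _ : nat => 1 : R) @ \oo --> (1 : R) by exact: cvg_cst.
apply: (squeeze_cvgr _ h h'); apply: nearW => n.
have y01 : 0 <= y <= 1 by lra.
have /andP[_ ->] := step01 n y01; rewrite andbT exprMn -natr_pow2.
by apply: bernoulli_sub; rewrite exprn_ge0// exprn_ile1//; lra.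
Qed.

(** Multiply by (1 + y^n)^(2^n): by Bernoulli this factor is at least (2 y)^n, while the product is
    (1 - y^(2n))^(2^n), at most 1. Hence [step n y] is at most (2 y)^(-n). *)
Lemma step_cvg0 y : 2^-1 < y <= 1 -> (fun n => step n y) @ \oo --> 0.
Proof.
move=> /andP[y0 y1]; have yp : 0 < y by lra.
have h : (fun n => ((2 * y)^-1) ^+ n) @ \oo --> 0.
  by apply: cvg_expr; rewrite ger0_norm ?invr_ge0 ?mulr_ge0 ?(ltW yp)// invf_lt1 ?mulr_gt0//; lra.
apply: cvg0_le h; apply: nearW => n.
have y01 : 0 <= y <= 1 by lra.
have /andP[-> _] := step01 n y01; rewrite /= exprVn -div1r ler_pdivlMr ?exprn_gt0 ?mulr_gt0//.
have yn0 : 0 <= y ^+ n by rewrite exprn_ge0// ltW.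
have yn1 : y ^+ n <= 1 by rewrite exprn_ile1// ltW.
apply: (@le_trans _ _ (step n y * (1 + y ^+ n) ^+ (2 ^ n))).
  apply: ler_wpM2l; first by case/andP: (step01 n y01).
  apply: le_trans (bernoulli_le _ yn0); rewrite exprMn natr_pow2 lerDr//.
have z2 : 0 <= 1 - y ^+ n ^+ 2 <= 1.
  by rewrite subr_ge0 exprn_ile1//= lerBlDr lerDl sqr_ge0.
rewrite /step -exprMn (_ : _ * _ = 1 - y ^+ n ^+ 2); last by ring.
by case/andP: z2 => z0 z1; exact: exprn_ile1.
Qed.

End StepPolynomials.

(** * Injectivity of the Fourier coefficients on L^1 *)

Section Uniqueness.
Variable R : realType.
Local Notation mu := (@lebesgue_measure R).
Local Notation S1 := (@S1 R).
Implicit Types (f g phi psi : R -> R) (k : int).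

Lemma negligible_set1 (x : R) : mu.-negligible [set x].
Proof.
by exists [set x]; split => //; exact: lebesgue_measure_set1.
Qed.

Definition fnull f := int1 f /\ forall k, fhat f k = 0.
(** Such multipliers form an algebra that contains the constants, cos and sin, hence every [step n]
    of a trigonometric polynomial. These approximate indicators of intervals, which is how vanishing
    coefficients force vanishing primitives. *)
Definition fmult phi := forall f, fnull f -> fnull (fun x => f x * phi x).

Lemma fmult_cos : fmult cos.
Proof.
move=> f [hf f0]; have -> : (fun x => f x * cos x) = (fun x => f x * cos ((1 : int)%:~R * x)).
  by apply/funext => x; rewrite mul1r.
split; first exact: int1cos.
by move=> k; rewrite fhat_cos// !f0 addr0 mulr0.
Qed.

Lemma fmult_sin : fmult sin.
Proof.
move=> f [hf f0]; have -> : (fun x => f x * sin x) = (fun x => f x * sin ((1 : int)%:~R * x)).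
  by apply/funext => x; rewrite mul1r.
split; first exact: int1sin.
by move=> k; rewrite fhat_sin// !f0 subr0 mulr0.
Qed.

Lemma fmult_cst c : fmult (fun=> c).
Proof.
move=> f [hf f0]; under eq_fun do rewrite mulrC.
by split; [exact: int1Z|move=> k; rewrite fhatZ// f0 mulr0].
Qed.

Lemma fmultD phi psi : fmult phi -> fmult psi -> fmult (fun x => phi x + psi x).
Proof.
move=> hp hq f ff; have [p1 p2] := hp f ff; have [q1 q2] := hq f ff.
under eq_fun do rewrite mulrDr.
by split; [exact: int1D|move=> k; rewrite fhatD// p2 q2 addr0].
Qed.

Lemma fmultM phi psi : fmult phi -> fmult psi -> fmult (fun x => phi x * psi x).
Proof.
by move=> hp hq f /hp/hq; under eq_fun do rewrite -mulrA.
Qed.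

Lemma fmultX phi n : fmult phi -> fmult (fun x => phi x ^+ n).
Proof.
move=> hp; elim: n => [|n IH]; first by under eq_fun do rewrite expr0; exact: fmult_cst.
by under eq_fun do rewrite exprS; exact: fmultM.
Qed.

Lemma fmult_step phi n : fmult phi -> fmult (fun x => step n (phi x)).
Proof.
move=> hp; apply: (@fmultX (fun x => 1 - phi x ^+ n)).
have := fmultD (@fmult_cst 1) (fmultM (@fmult_cst (-1)) (fmultX n hp)).
by under eq_fun do rewrite mulN1r.
Qed.

(* q is positive on ]-pi, b[ and negative on ]b, pi[ *)
Let q (b x : R) : R := 2 * sin ((x + pi) / 2) * sin ((b - x) / 2).

(** Product to sum: q = cos (x - (b - pi) / 2) - cos ((b + pi) / 2), a trigonometric polynomial of
    degree 1. *)
Let qE b x : q b x = cos ((b - pi) / 2) * cos x + sin ((b - pi) / 2) * sin x - cos ((b + pi) / 2).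
Proof.
rewrite /q; have -> : (x + pi) / 2 = (x - (b - pi) / 2 + (b + pi) / 2) / 2 by field.
have -> : (b - x) / 2 = ((b + pi) / 2 - (x - (b - pi) / 2)) / 2 by field.
set A := x - _; set B := (b + pi) / 2.
have -> : cos ((b - pi) / 2) * cos x + sin ((b - pi) / 2) * sin x = cos A.
  by rewrite /A cosB; ring.
have eA : A = (A + B) / 2 - (B - A) / 2 by field.
have eB : B = (A + B) / 2 + (B - A) / 2 by field.
by rewrite [in RHS]eA [X in _ = _ - cos X]eB cosB cosD; ring.
Qed.

(** The affine map sends [-2, 2], where q takes its values, to [0, 1], and q > 0 to the values below
    1/2, where [step n] tends to 1. *)
Let q_fmult b : fmult (fun x => (2 - q b x) / 4).
Proof.
have h := fmultD (fmultD (@fmult_cst ((2 + cos ((b + pi) / 2)) / 4))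
  (fmultM (@fmult_cst (- cos ((b - pi) / 2) / 4)) fmult_cos))
  (fmultM (@fmult_cst (- sin ((b - pi) / 2) / 4)) fmult_sin).
have -> // : (fun x => (2 - q b x) / 4) = (fun x => (2 + cos ((b + pi) / 2)) / 4 +
  - cos ((b - pi) / 2) / 4 * cos x + - sin ((b - pi) / 2) / 4 * sin x).
by apply/funext => x; rewrite qE; field.
Qed.

Let q_bound b x : 0 <= (2 - q b x) / 4 <= 1.
Proof.
have h : `|q b x| <= 2.
  rewrite /q !normrM ger0_norm// -mulrA -[leRHS]mulr1 ler_wpM2l//.
  by rewrite -[leRHS]mulr1 ler_pM// ?sin_max.
by move: h; rewrite ler_norml => /andP[h1 h2]; lra.
Qed.

Let q_pos b x : - pi < x < b -> b < pi -> 0 < q b x.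
Proof.
move=> /andP[x0 xb] bp; rewrite /q !mulr_gt0//; apply: sin_gt0_pi; lra.
Qed.

Let q_neg b x : - pi < b -> b < x < pi -> q b x < 0.
Proof.
move=> b0 /andP[bx xp]; rewrite /q.
have s1 : 0 < sin ((x + pi) / 2) by apply: sin_gt0_pi; lra.
have s2 : 0 < sin ((x - b) / 2) by apply: sin_gt0_pi; lra.
have -> : (b - x) / 2 = - ((x - b) / 2) by field.
by rewrite sinN mulrN oppr_lt0 !mulr_gt0.
Qed.

Let mq b : measurable_fun S1 (fun x => (2 - q b x) / 4).
Proof.
have -> : (fun x => (2 - q b x) / 4) = (fun x => (2 + cos ((b + pi) / 2)) / 4 +
  - cos ((b - pi) / 2) / 4 * cos (1 * x) + - sin ((b - pi) / 2) / 4 * sin (1 * x)).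
  by apply/funext => x; rewrite qE !mul1r; field.
apply: measurable_funD; last by apply: measurable_funM; [exact: measurable_cst|exact: msin].
apply: measurable_funD; first exact: measurable_cst.
by apply: measurable_funM; [exact: measurable_cst|exact: mcos].
Qed.

Let mstep b n : measurable_fun S1 (fun x => step n ((2 - q b x) / 4)).
Proof.
apply: measurable_funX; apply: measurable_funB; first exact: measurable_cst.
by apply: measurable_funX; exact: mq.
Qed.

(** The integral of [f] against each step polynomial is a zeroth Fourier coefficient of a null
    function, hence 0. By dominated convergence these integrals tend to the integral of [f] over the
    part of the circle left of b. *)
Lemma fnull_primitive f b : fnull f -> - pi < b < pi -> \int[mu]_(x in `[- pi, b]) f x = 0.
Proof.
move=> ff /andP[b0 b1]; have [hf _] := ff.
pose chi (x : R) : R := (x <= b)%R%:R.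
have mchi : measurable_fun S1 chi.
  rewrite (_ : chi = \1_(`]-oo, b] : set (measurableTypeR R))); last first.
    by apply/funext => x; rewrite indicE /chi mem_setE in_itv.
  by apply: measurable_indic; exact: measurable_itv.
have mf := int1_measurable hf.
have chi1 x : `|chi x| <= 1 by rewrite /chi; case: (x <= b); rewrite ?normr1 ?normr0.
have T0 n : (\int[mu]_(x in S1) (f x * step n ((2 - q b x) / 4))%:E = 0)%E.
  have [h1 h2] := fmult_step n (@q_fmult b) ff.
  by rewrite I1_EFin// I1_fhat h2 mulr0.
have key : (\int[mu]_(x in S1) (f x * chi x)%:E = 0)%E.
  pose fn n (x : R) := (f x * step n ((2 - q b x) / 4))%:E.
  have d1 n : measurable_fun S1 (fn n).
    by apply/measurable_EFinP; exact: measurable_funM.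
  have d2 : measurable_fun S1 (fun x => (f x * chi x)%:E).
    by apply/measurable_EFinP; exact: measurable_funM.
  have d3 : {ae mu, forall x, S1 x -> fn ^~ x @ \oo --> (f x * chi x)%:E}.
    (* At these three points q vanishes and the argument of [step] is the critical value 1/2. *)
    have N0 : mu.-negligible [set - pi; b; pi].
      by do ?apply: negligibleU; exact: negligible_set1.
    apply: negligibleS N0 => x /= /not_implyP[Sx ncv].
    apply: contrapT => xn; apply: ncv.
    have xb : x != b by apply/eqP => e; apply: xn; left; right.
    have xp : x != pi by apply/eqP => e; apply: xn; right.
    have xm : x != - pi by apply/eqP => e; apply: xn; left; left.
    move: Sx; rewrite /Defs.S1/= in_itv/= => /andP[x0 x1].
    apply: cvg_EFin; first exact: nearW.
    apply: cvgM; first exact: cvg_cst.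
    have /andP[q0 q1] := q_bound b x.
    rewrite /chi; have [xlb|xlb] := leP x b.
      apply: step_cvg1; rewrite q0/=.
      suff : 0 < q b x by lra.
      by apply: q_pos => //; rewrite !lt_def xm x0 eq_sym xb xlb.
    apply: step_cvg0; rewrite q1 andbT.
    suff : q b x < 0 by lra.
    by apply: q_neg => //; rewrite xlb lt_def eq_sym xp x1.
  have d4 : {ae mu, forall x n, S1 x -> (`|fn n x| <= `|f x|%:E)%E}.
    apply: nearW => x n _ /=; rewrite lee_fin normrM ler_piMr//.
    have /andP[s0 s1] := step01 n (q_bound b x).
    by rewrite ger0_norm.
  have [_ _ h] := @dominated_convergence _ _ R mu S1 (@mS1 R) fn _ _ d1 d2 d3 (int1_abs hf) d4.
  apply/esym; apply: (cvg_unique _ _ h) => //.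
  rewrite (_ : (fun n => _) = cst 0%E); first exact: cvg_cst.
  by apply/funext => n; exact: T0.
have -> : `[- pi, b]%classic = S1 `&` `]-oo, b]%classic :> set R.
  rewrite predeqE => x; rewrite /= /Defs.S1 /= !in_itv/=; split.
    by move=> /andP[-> h]; split => //; rewrite (le_trans h)// ltW.
  by move=> [/andP[-> _] ->].
rewrite Rintegral_mkcondr; rewrite /Rintegral -[0]/(fine 0%E); congr fine; rewrite -key.
apply: eq_integral => x _; rewrite /patch mem_setE in_itv/= /chi.
by case: (x <= b); rewrite ?mulr1 ?mulr0.
Qed.

(** Lebesgue differentiation: the primitive from -pi vanishes on ]-pi, pi[, and its derivative is
    [f] almost everywhere. *)
Lemma fhat_inj0 f : fnull f -> ae_eqS1 f (fun=> 0).
Proof.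
move=> ff; have [hf _] := ff.
pose g := f \_ S1.
have ig : mu.-integrable setT (EFin \o g).
  by move: hf; rewrite /int1 (integrable_mkcond _ (@mS1 R)) restrict_EFin.
have locg : locally_integrable setT g by apply: integrable_locally_restrict => //; exact: mS1.
have iy y : mu.-integrable [set` Interval (BLeft (- pi)) (BRight y)] (EFin \o g).
  by apply: integrableS ig => //; exact: measurable_itv.
have ftc' : {ae mu, forall x : R, - pi < x ->
    derivable (fun x => \int[mu]_(t in `[- pi, x]) g t) x 1 /\
    (fun x => \int[mu]_(t in `[- pi, x]) g t)^`()%classic x = g x}.
  move: (FTC1 iy locg); apply: filterS; first exact: (ae_filter_ringOfSetsType mu).
  by move=> y h y0; apply: h; rewrite lte_fin.
have N0 : mu.-negligible [set - pi; pi : R].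
  by do ?apply: negligibleU; exact: negligible_set1.
have ae0 : {ae mu, forall x, ~ [set - pi; pi : R] x}.
  by apply: negligibleS N0 => x /= /contrapT.
move: ae0 ftc'; apply: filterS2; first exact: (ae_filter_ringOfSetsType mu).
move=> x xn ftc'; rewrite /Defs.S1/= in_itv/= => /andP[x0 x1].
have xp : x < pi by rewrite lt_def x1 andbT eq_sym; apply/eqP => e; apply: xn; right.
have xm : - pi < x by rewrite lt_def x0 andbT; apply/eqP => e; apply: xn; left.
have [dF F'] := ftc' xm.
have gx : g x = f x by rewrite /g patchE mem_set//= /Defs.S1/= in_itv/= x0 x1.
rewrite -gx -F' derive1E (@near_eq_derive _ _ _ _ (fun=> 0)) ?derive_cst//; last first.
  have : \forall y \near x, - pi < y < pi.
    near=> y; apply/andP; split; near: y; [exact: lt_nbhsr|exact: lt_nbhsl].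
  apply: filterS => y yI; rewrite -(fnull_primitive ff yI).
  apply: eq_Rintegral => t; rewrite inE/= in_itv/= => /andP[t0 t1].
  rewrite /g patchE mem_set//= /Defs.S1/= in_itv/= t0 (le_trans t1)//.
  by case/andP: yI => _ /ltW.
Unshelve. all: by end_near. Qed.

Lemma fhat_inj f g : int1 f -> int1 g -> fhat f = fhat g -> ae_eqS1 f g.
Proof.
move=> hf hg fg; have : fnull (fun x => f x - g x).
  by split; [exact: int1B|move=> k; rewrite fhatB// fg subrr].
move=> /fhat_inj0; apply: filterS => x h /h /eqP.
by rewrite subr_eq0 => /eqP.
Qed.

End Uniqueness.

(** * Completeness of L^2 along fast Cauchy sequences *)

Section FastCauchy.
Variable R : realType.
Local Notation mu := (@lebesgue_measure R).
Local Notation S1 := (@S1 R).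

Variables (P : nat -> R -> R) (B C : R).
Hypotheses (sqP : forall j, sq1 (P j)) (PB : forall j, I2 (P j) <= B)
  (PC : forall j, I2 (fun x => P j.+1 x - P j x) <= C * (2^-1 ^+ j) ^+ 2).

Let h j x := `|P j.+1 x - P j x|.
Let S x : \bar R := (\sum_(0 <= j <oo) (h j x)%:E)%E.
Let K := Num.sqrt (C * (2 * pi)).

Let hsq j : sq1 (fun x => P j.+1 x - P j x). Proof. exact: sq1B. Qed.

Let hint j : int1 (h j). Proof. by apply: int1_abs; exact: sq1_int1. Qed.

(** Cauchy-Schwarz against the constant 1 bounds the L^1 norms of the increments by a geometric
    sequence. So [S] is integrable, finite almost everywhere, and dominates the sequence together
    with [|P 0 x|]. *)
Let hI j : I1 (h j) <= K * 2^-1 ^+ j.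
Proof.
have := I1_CS_abs (hsq j) (sq1_cst 1).
rewrite (@eq_I1 _ _ (h j)); last by move=> x; rewrite mulr1.
move=> hle; apply: le_trans hle _.
have p0 : 0 <= 2^-1 ^+ j :> R by rewrite exprn_ge0// invr_ge0.
have C0 : 0 <= C.
  by have := le_trans (I2_ge0 _) (PC 0); rewrite expr0 expr1n mulr1.
have -> : 2^-1 ^+ j = Num.sqrt ((2^-1 ^+ j) ^+ 2) :> R by rewrite sqrtr_sqr ger0_norm.
rewrite [I2 (fun=> 1)]/I2 (@eq_I1 _ _ (fun=> 1)); last by move=> x; rewrite expr1n.
have pp := @pi2_gt0 R.
have -> : K * Num.sqrt ((2^-1 ^+ j) ^+ 2) = Num.sqrt (C * (2 * pi) * (2^-1 ^+ j) ^+ 2).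
  by rewrite /K [RHS]sqrtrM// mulr_ge0// ltW.
rewrite I1_cst mul1r; apply: ler_wsqrtr.
by rewrite [leRHS]mulrAC ler_wpM2r ?PC// ltW.
Qed.

Let mh j : measurable_fun S1 (EFin \o h j).
Proof. exact: measurable_int (hint j). Qed.

Let h0 j x : (0 <= (h j x)%:E)%E. Proof. by rewrite lee_fin /h. Qed.

Let intS : (\int[mu]_(x in S1) S x < +oo)%E.
Proof.
rewrite integral_nneseries//; last exact: mS1.
apply: (@le_lt_trans _ _ (2 * K)%:E); last by rewrite ltry.
have K0 : 0 <= K by exact: sqrtr_ge0.
apply: lime_le; first by apply: is_cvg_nneseries => n _ _; apply: integral_ge0 => x _.
apply: nearW => n.
under eq_bigr do rewrite I1_EFin//.
rewrite sumEFin lee_fin; apply: (@le_trans _ _ (\sum_(0 <= j < n) K * 2^-1 ^+ j)).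
  by apply: ler_sum => j _.
suff -> : \sum_(0 <= j < n) K * 2^-1 ^+ j = 2 * K - 2 * K * 2^-1 ^+ n.
  by rewrite lerBlDr lerDl !mulr_ge0// exprn_ge0// invr_ge0.
elim: n => [|n IH]; first by rewrite big_geq// expr0 mulr1 subrr.
by rewrite big_nat_recr//= IH exprS; field.
Qed.

Let S0 x : (0 <= S x)%E. Proof. by apply: nneseries_ge0. Qed.

Let mS : measurable_fun S1 S.
Proof.
apply: (@ge0_emeasurable_sum _ _ R S1 (fun j x => (h j x)%:E) xpredT) => [j x _ _|j _].
  exact: h0.
exact: mh.
Qed.

Let iS : mu.-integrable S1 S.
Proof.
apply/integrableP; split; first exact: mS.
by under eq_integral do rewrite gee0_abs//; exact: intS.
Qed.

Let Pseries x n : P n x = P 0 x + series (fun j => P j.+1 x - P j x) n.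
Proof. by rewrite /series/= telescope_sumr// addrC subrK. Qed.

Let Pcvg x : (S x < +oo)%E -> cvgn (fun n => P n x).
Proof.
move=> Sx; have c1 : cvgn (series (fun j => h j x)) by apply: nnseries_is_cvg => // i; exact: normr_ge0.
have c2 : cvgn (series (fun j => P j.+1 x - P j x)) by exact: normed_cvg.
have -> : (fun n => P n x) = (fun n => P 0 x + series (fun j => P j.+1 x - P j x) n).
  by apply/funext => n; exact: Pseries.
by apply: is_cvgD => //; exact: is_cvg_cst.
Qed.

(** A limit superior is defined and measurable everywhere; it is the limit wherever [S x] is
    finite. *)
Let f x : R := fine (limn_esup (fun n => (P n x)%:E)).

Let f_lim x : (S x < +oo)%E -> (fun n => P n x) @ \oo --> f x.
Proof.
move=> /Pcvg/cvg_ex[l Pl]; rewrite /f.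
have Pl' : (fun n => (P n x)%:E) @ \oo --> l%:E by apply: cvg_EFin => //; exact: nearW.
by rewrite (cvg_limn_einf_sup Pl').2.
Qed.

Let mf : measurable_fun S1 f.
Proof.
apply: measurableT_comp; first exact: fine_measurable.
apply: measurable_fun_limn_esup => n; exact: measurable_int (sq1_int1 (sqP n)).
Qed.

Let aeS : {ae mu, forall x, S1 x -> (S x < +oo)%E}.
Proof.
have := integrable_ae (@mS1 R) iS; apply: filterS => x H Sx.
by have := H Sx; rewrite ge0_fin_numE.
Qed.

Let g x : \bar R := (`|P 0 x|%:E + S x)%E.

Let ig : mu.-integrable S1 g.
Proof. by apply: integrableD => //; [exact: mS1|exact: int1_abs (sq1_int1 (sqP 0))]. Qed.

Let Pg x n : ((`|P n x|)%:E <= g x)%E.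
Proof.
rewrite Pseries; apply: (@le_trans _ _ (`|P 0 x| + series (fun j => h j x) n)%:E).
  rewrite lee_fin; apply: le_trans (ler_normD _ _) _; rewrite lerD2l.
  by rewrite /series/=; exact: ler_norm_sum.
rewrite EFinD leeD2l// /series/= -sumEFin.
by apply: nneseries_lim_ge.
Qed.

Let dct (phi : R -> R) : measurable_fun S1 phi -> (forall x, `|phi x| <= 1) ->
  int1 (fun x => f x * phi x) /\
  (fun n => I1 (fun x => P n x * phi x)) @ \oo --> I1 (fun x => f x * phi x).
Proof.
move=> mp p1.
have d1 n : measurable_fun S1 (fun x => (P n x * phi x)%:E).
  by apply/measurable_EFinP; apply: measurable_funM => //; case: (sqP n).
have d2 : measurable_fun S1 (fun x => (f x * phi x)%:E).
  by apply/measurable_EFinP; exact: measurable_funM.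
have d3 : {ae mu, forall x, S1 x -> (fun n => (P n x * phi x)%:E) @ \oo --> (f x * phi x)%:E}.
  move: aeS; apply: filterS; first exact: (ae_filter_ringOfSetsType mu).
  move=> x H /H/f_lim Pf.
  by apply: cvg_EFin; [exact: nearW|apply: cvgM => //; exact: cvg_cst].
have d4 : {ae mu, forall x n, S1 x -> (`|(P n x * phi x)%:E| <= g x)%E}.
  apply: nearW => x n _; apply: le_trans (Pg x n).
  by rewrite /= lee_fin normrM ler_piMr.
have [i1 _ c1] := @dominated_convergence _ _ R mu S1 (@mS1 R) _ _ _ d1 d2 d3 ig d4.
split => //; rewrite /I1 /Rintegral; apply: fine_cvg.
by rewrite fineK//; exact: (integrable_fin_num (@mS1 R) i1).
Qed.

Let f_sq : sq1 f /\ I2 f <= B.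
Proof.
have fa : (\int[mu]_(x in S1) (f x ^+ 2)%:E <= B%:E)%E.
  have md n : measurable_fun S1 (fun x => (P n x ^+ 2)%:E).
    by apply/measurable_EFinP; apply: measurable_funX; case: (sqP n).
  have pd n x : S1 x -> (0 <= (P n x ^+ 2)%:E)%E by rewrite lee_fin sqr_ge0.
  have := fatou mu (@mS1 R) md pd.
  rewrite [X in (X <= _)%E -> _](_ : _ = \int[mu]_(x in S1) (f x ^+ 2)%:E)%E; last first.
    apply: ae_eq_integral; first exact: mS1.
    - rewrite (_ : (fun x => _) = (fun x => - limn_esup (fun n => - (P n x ^+ 2)%:E))%E).
        apply: measurableT_comp => //; apply: measurable_fun_limn_esup => n.
        by under eq_fun do rewrite -EFinN; apply/measurable_EFinP; apply: measurableT_comp => //; apply/measurable_EFinP; exact: md.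
      by apply/funext => x; rewrite (limn_esupN (fun n => (P n x ^+ 2)%:E)) oppeK.
    - by apply/measurable_EFinP; exact: measurable_funX.
    - move: aeS; apply: filterS; first exact: (ae_filter_ringOfSetsType mu).
  move=> x H /H/f_lim Pf /=.
      have c : (fun n => (P n x ^+ 2)%:E) @ \oo --> (f x ^+ 2)%:E.
        by apply: cvg_EFin; [exact: nearW|rewrite expr2; under eq_fun do rewrite expr2; exact: cvgM].
      by rewrite (cvg_limn_einf_sup c).1.
  move=> h1; apply: le_trans h1 _; rewrite limn_einf_lim.
  apply: lime_le; first exact: is_cvg_einfs.
  apply: nearW => n; apply: (@le_trans _ _ (\int[mu]_(x in S1) (P n x ^+ 2)%:E)%E).
    by apply: ereal_inf_lbound; exists n => /=.
  by rewrite I1_EFin; [rewrite lee_fin; exact: PB|case: (sqP n)].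
have i2 : int1 (fun x => f x ^+ 2).
  apply/integrableP; split; first by apply/measurable_EFinP; exact: measurable_funX.
  under eq_integral do rewrite gee0_abs ?lee_fin ?sqr_ge0//.
  by rewrite (le_lt_trans fa)// ltry.
by split; [split|rewrite -lee_fin /I2 -I1_EFin].
Qed.

(** Square integrability of the limit comes from Fatou. Convergence tested against bounded functions
    is what the Fourier coefficients require, the test functions being cosines and sines. *)
Lemma fast_cauchy : exists f, [/\ sq1 f, I2 f <= B &
  forall phi : R -> R, measurable_fun S1 phi -> (forall x, `|phi x| <= 1) ->
  (fun n => I1 (fun x => P n x * phi x)) @ \oo --> I1 (fun x => f x * phi x)].
Proof.
exists f; have [f1 f2] := f_sq; split => // phi mp p1.
by have [] := dct mp p1.
Qed.

End FastCauchy.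

(** * The Riesz-Fischer theorem and products of L^2 functions *)

Section RieszFischer.
Variable R : realType.
Local Notation mu := (@lebesgue_measure R).
Local Notation S1 := (@S1 R).
Implicit Types (a : distr R) (f g : R -> R).

Definition cut a (n : nat) : distr R := fun k => if (`|k| <= n)%N then 0 else a k.

Lemma cut_herm a n : herm a -> herm (cut a n).
Proof. by move=> ha k; rewrite /cut abszN ha; case: ifP => // _; rewrite conjc0. Qed.

Lemma tpol_cut a m n x : (n <= m)%N -> tpol a m x - tpol a n x = tpol (cut a n) m x.
Proof.
move=> nm; apply/eqP; rewrite subr_eq; apply/eqP.
rewrite /tpol (bigID (mem (zrange n)))/= addrC; congr (_ + _).
  rewrite [RHS](bigID (mem (zrange n)))/= [X in _ = X + _]big1_seq ?add0r.
    by apply: eq_bigr => j; rewrite mem_zrange /cut => /negbTE ->.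
  by move=> j /andP[]; rewrite mem_zrange /cut => -> _ /=; rewrite !mul0r subrr.
rewrite -big_filter; apply: perm_big.
apply: uniq_perm; rewrite ?filter_uniq ?zrange_uniq// => y.
by rewrite mem_filter !mem_zrange; lia.
Qed.

Lemma tail_small a A e : sumle (fun k => normc (a k) ^+ 2) A -> 0 < e ->
  exists N : nat, forall n, (N <= n)%N -> sumle (fun k => normc (cut a n k) ^+ 2) e.
Proof.
move=> aA e0.
have [] := @sumle_dominated _ _ _ (\oo : set_system nat) _ (fun n k => normc (cut a n k) ^+ 2)
  (fun k => normc (a k) ^+ 2) A _ _ (fun k => sqr_ge0 _) aA e e0.
- apply: nearW => n k; rewrite sqr_ge0/= /cut; case: ifP => // _.
  by rewrite normc_0 expr0n sqr_ge0.
- move=> k; apply: cvg_near_cst; exists `|k|%N => // n /= kn.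
  by rewrite /cut kn normc_0 expr0n.
- by move=> N _ H; exists N => n /H.
Qed.

Lemma sumle_tpol a A n : herm a -> sumle (fun k => normc (a k) ^+ 2) A ->
  I2 (tpol a n) <= 2 * pi * A.
Proof.
move=> ha aA; rewrite I2_tpol// ler_wpM2l ?(ltW (@pi2_gt0 R))//.
by apply: sumle_lb (zrange_uniq n) => // k; exact: sqr_ge0.
Qed.

Theorem riesz_fischer a A : herm a -> sumle (fun k => normc (a k) ^+ 2) A ->
  exists f, [/\ sq1 f, I2 f <= 2 * pi * A & fhat f = a].
Proof.
move=> ha aA.
have q0 j : 0 < (2^-1 ^+ j) ^+ 2 :> R by rewrite exprn_gt0// exprn_gt0// invr_gt0.
have [N HN] := choice (fun j => tail_small aA (q0 j)).
(* The sum of the [N i] makes [nn] monotone with [N j <= nn j]; the extra j makes it unbounded, so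
   that each mode k is eventually included. *)
pose nn j := (j + \sum_(i < j.+1) N i)%N.
have nnN j : (N j <= nn j)%N.
  by rewrite /nn big_ord_recr/= addnA; lia.
have nn_mono j : (nn j <= nn j.+1)%N by rewrite /nn leq_add// [leqRHS]big_ord_recr/= leq_addr.
pose P j := tpol a (nn j).
have sqP j : sq1 (P j) by exact: sq1_tpol.
have PB j : I2 (P j) <= 2 * pi * A by exact: sumle_tpol.
have PC j : I2 (fun x => P j.+1 x - P j x) <= (2 * pi) * (2^-1 ^+ j) ^+ 2.
  rewrite (_ : (fun x => _) = tpol (cut a (nn j)) (nn j.+1)).
    apply: sumle_tpol; first exact: cut_herm.
    exact: HN.
  by apply/funext => x; exact: tpol_cut.
have [f [f1 f2 f3]] := fast_cauchy sqP PB PC; exists f; split => //.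
apply/funext => k.
have Pk : \forall j \near \oo, fhat (P j) k = a k.
  exists `|k|%N => // j /= kj; rewrite fhat_tpol// ifT//.
  by apply: leq_trans kj _; rewrite /nn leq_addr.
have c1 := f3 _ (@mcos R k%:~R) (fun x => cos_max _).
have c2 := f3 _ (@msin R k%:~R) (fun x => sin_max _).
have pn : 2 * pi != 0 :> R by rewrite gt_eqF ?pi2_gt0.
have uniq_lim (u : nat -> R) (l l' : R) : u @ \oo --> l -> u @ \oo --> l' -> l = l'.
  by move=> ul ul'; exact: (norm_cvg_unique ul ul').
apply: complex_ext.
  apply: (uniq_lim (fun j => Re (fhat (P j) k))).
    by rewrite fhatE/=; apply: cvgM => //; exact: cvg_cst.
  by apply: cvg_near_cst; apply: filterS Pk => j ->.
apply: (uniq_lim (fun j => Im (fhat (P j) k))).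
  rewrite fhatE/=.
  by apply: cvgN; apply: cvgM => //; exact: cvg_cst.
by apply: cvg_near_cst; apply: filterS Pk => j ->.
Qed.

Lemma herm_fhat f : int1 f -> herm (fhat f).
Proof. by move=> hf k; exact: fhat_conj. Qed.

Lemma ae_int1 f g : measurable_fun S1 f -> ae_eqS1 f g -> int1 g -> int1 f.
Proof.
move=> mf fg /integrableP[mg ig]; apply/integrableP; split; first exact/measurable_EFinP.
suff -> : (\int[mu]_(x in S1) `|(EFin \o f) x| = \int[mu]_(x in S1) `|(EFin \o g) x|)%E by [].
apply: ae_eq_integral.
- exact: mS1.
- by apply: measurableT_comp => //; exact/measurable_EFinP.
- exact: measurableT_comp.
- by apply: filterS fg => x h /h /= ->.
Qed.

(** By injectivity of the coefficients, [f] agrees almost everywhere with the square integrable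
    function that Riesz-Fischer builds from them. *)
Lemma parseval_le f A : int1 f -> sumle (fun k => normc (fhat f k) ^+ 2) A ->
  sq1 f /\ I2 f <= 2 * pi * A.
Proof.
move=> hf fA; have [g [g1 g2 g3]] := riesz_fischer (herm_fhat hf) fA.
have fg : ae_eqS1 f g by apply: fhat_inj => //; exact: sq1_int1.
have mf := int1_measurable hf.
have fg2 : ae_eqS1 (fun x => f x ^+ 2) (fun x => g x ^+ 2).
  by apply: filterS fg => x h /h ->.
have f2 : int1 (fun x => f x ^+ 2).
  by apply: ae_int1 fg2 g1.2; exact: measurable_funX.
by split; [split|rewrite /I2 (I1_ae f2 g1.2 fg2)].
Qed.

Lemma funofP a A : herm a -> sumle (fun k => normc (a k) ^+ 2) A ->
  [/\ int1 (funof a), fhat (funof a) = a, sq1 (funof a) & I2 (funof a) <= 2 * pi * A].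
Proof.
move=> ha aA; have [f [f1 f2 f3]] := riesz_fischer ha aA.
have [h1 h2] : int1 (funof a) /\ fhat (funof a) = a.
  rewrite /funof; case: xgetP => [g _ [/inLp1P g1 g2]//|/(_ f)[]].
  by split => //; apply/inLp1P; exact: sq1_int1.
have fA : sumle (fun k => normc (fhat (funof a) k) ^+ 2) A by rewrite h2.
by have [h3 h4] := parseval_le h1 fA.
Qed.

(** The partial sum of the convolution is the coefficient of g T, where T is a partial Fourier sum
    of f ([fhat_tpolM]). The error is a coefficient of (f - T) g, controlled by its L^1 norm and
    thus by the L^2 norm of f - T. *)
Lemma fhatM f g k : sq1 f -> sq1 g ->
  zcvg (fun j => fhat f j * fhat g (k - j)) (fhat (fun x => f x * g x) k).
Proof.
move=> hf hg; have [f1 g1] := (sq1_int1 hf, sq1_int1 hg).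
have hb := bessel hf; have hh := herm_fhat f1.
have pp := @pi2_gt0 R.
apply/cvgrPdist_le => e e0.
(* Chosen so that 2 pi d * I2 g <= (pi e)^2; the summand 1 keeps the denominator positive when
   [I2 g] is 0. The factor pi comes from |Re| + |Im| <= pi^-1 times the L^1 norm. *)
pose d : R := (pi * e) ^+ 2 / (I2 g * (2 * pi) + 1).
have G0 : 0 <= I2 g * (2 * pi) by rewrite mulr_ge0 ?I2_ge0// ltW.
have d0 : 0 < d.
  by rewrite divr_gt0 ?exprn_gt0 ?mulr_gt0 ?pi_gt0//; lra.
have [N HN] := tail_small hb d0; exists N => // n /= Nn.
rewrite sub0r normrN ger0_norm ?normc_ge0//.
set T := tpol (fhat f) n.
have hT : sq1 T by exact: sq1_tpol.
have hD : sq1 (fun x => f x - T x) by exact: sq1B.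
have I2D : I2 (fun x => f x - T x) <= 2 * pi * d.
  apply: (parseval_le (sq1_int1 hD) _).2.
  apply: le_sumle (lexx _) (HN n Nn) => k'; rewrite fhatB//; last exact: sq1_int1.
  rewrite fhat_tpol// /cut; case: ifP => _; first by rewrite subrr.
  by rewrite subr0.
rewrite -fhat_tpolM// normc_distC.
have -> : fhat (fun x => f x * g x) k - fhat (fun x => g x * T x) k =
    fhat (fun x => (f x - T x) * g x) k.
  have -> : (fun x => (f x - T x) * g x) = (fun x => f x * g x - g x * T x).
    by apply/funext => x; ring.
  by rewrite fhatB//; exact: sq1M.
have hDg := sq1M hD hg; have aDg := int1_abs hDg.
have I0 : 0 <= I1 (fun x => `|(f x - T x) * g x|) by apply: I1_ge0.
apply: (@le_trans _ _ (pi^-1 * I1 (fun x => `|(f x - T x) * g x|))).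
  apply: le_trans (normc_ReIm _) _; rewrite fhatE/= normrN !normrM.
  have -> : pi^-1 = `|(2 * pi)^-1| + `|(2 * pi)^-1| :> R.
    rewrite ger0_norm ?invr_ge0 ?(ltW pp)// invfM -mulrDl.
    by rewrite (_ : 2^-1 + 2^-1 = 1) ?mul1r//; field.
  rewrite [leRHS]mulrDl.
  apply: lerD; apply: ler_wpM2l => //.
    apply: le_trans (I1_norm (int1cos _ hDg)) _; apply: le_I1 => //.
      by apply: int1_abs; exact: int1cos.
    by move=> x _; rewrite [leLHS]normrM ler_piMr// cos_max.
  apply: le_trans (I1_norm (int1sin _ hDg)) _; apply: le_I1 => //.
    by apply: int1_abs; exact: int1sin.
  by move=> x _; rewrite [leLHS]normrM ler_piMr// sin_max.
rewrite ler_pdivrMl ?pi_gt0//; apply: le_trans (I1_CS_abs hD hg) _.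
have pe : 0 <= pi * e :> R by rewrite mulr_ge0 ?pi_ge0// ltW.
rewrite -[leRHS]ger0_norm// -sqrtr_sqr; apply: ler_wsqrtr.
apply: le_trans (ler_wpM2r (I2_ge0 g) I2D) _.
rewrite (_ : _ * I2 g = (I2 g * (2 * pi)) * d); last by ring.
rewrite /d mulrCA ler_piMr ?sqr_ge0// ler_pdivrMr; last by lra.
by rewrite mul1r; lra.
Qed.

End RieszFischer.

(** * The symbols of the equation *)

Section Kernel.
Variable R : realType.
Implicit Types (k j m : int).

(** The inverse of 0 being 0, the corresponding summand vanishes at j = 0 and at j = k. *)
Definition ez k j : R := (j%:~R ^+ 2)^-1 + ((k - j)%:~R ^+ 2)^-1.

Lemma ez_ge0 k j : 0 <= ez k j.
Proof. by rewrite addr_ge0 // invr_ge0 sqr_ge0. Qed.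

Lemma int_sqr_ge1 k : k != 0 -> 1 <= (k%:~R : R) ^+ 2.
Proof.
move=> k0; rewrite -rmorphXn /= ler1z; suff : 0 < k ^+ 2 by [].
by rewrite lt_def sqrf_eq0 k0 sqr_ge0.
Qed.

Lemma invsq_ge0 k : 0 <= ((k%:~R : R) ^+ 2)^-1.
Proof. by rewrite invr_ge0 sqr_ge0. Qed.

Lemma invsq_le1 k : ((k%:~R : R) ^+ 2)^-1 <= 1.
Proof.
have [->|k0] := eqVneq k 0; first by rewrite expr0n /= invr0.
by rewrite invf_le1 ?int_sqr_ge1 // (lt_le_trans ltr01) // int_sqr_ge1.
Qed.

Lemma sum_zrangeS (f : int -> R) n :
  \sum_(k <- zrange n.+1) f k = f (- n.+1%:Z) + (f n.+1%:Z + \sum_(k <- zrange n) f k).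
Proof.
transitivity (\sum_(k <- [:: - n.+1%:Z, n.+1%:Z & zrange n]) f k); last by rewrite !big_cons.
apply: perm_big; apply: (@uniq_perm int); first exact: zrange_uniq.
  by rewrite 2!cons_uniq in_cons !mem_zrange zrange_uniq; lia.
by move=> k; rewrite mem_zrange 2!in_cons mem_zrange; lia.
Qed.

Lemma sumle_invsq : sumle (fun k : int => ((k%:~R : R) ^+ 2)^-1) 4.
Proof.
have z0 : \sum_(k <- zrange 0) ((k%:~R : R) ^+ 2)^-1 = 0.
  by rewrite big_cons big_nil expr0n /= invr0 addr0.
(* Telescoping by 1 / (x + 1)^2 <= 1 / x - 1 / (x + 1), doubled because k and -k both occur. *)
have S1 n : \sum_(k <- zrange n.+1) ((k%:~R : R) ^+ 2)^-1 <= 4 - 2 / n.+1%:R.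
  elim: n => [|n ih]; rewrite sum_zrangeS rmorphN /= sqrrN.
    by rewrite z0 expr1n invr1; lra.
  rewrite addrA; move: ih; set S := \sum_(_ <- _) _ => ih.
  rewrite -[n.+2%:~R]/(n.+2%:R) -[n.+2%:R]natr1; set x : R := n.+1%:R.
  have x0 : 0 < x by rewrite ltr0n.
  have h : (x + 1)^-1 ^+ 2 <= x^-1 - (x + 1)^-1.
    rewrite (_ : _ - _ = (x + 1)^-1 * x^-1); last by field; lra.
    rewrite expr2 ler_wpM2l ?invr_ge0 ?lef_pV2 ?posrE; lra.
  rewrite -exprVn; rewrite -/x in ih.
  by move: h ih; set p := (x + 1)^-1; set q := x^-1; lra.
apply: sumle_zrange => [k|[|n]]; first by rewrite invr_ge0 sqr_ge0.
  by rewrite z0; lra.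
apply: (le_trans (S1 n)); rewrite gerBl divr_ge0 //; lra.
Qed.

(** For x and y in [0, 1] one has (x + y)^2 <= 2 (x + y), and 2 (4 + 4) = 4^2. This 4 is the value
    of [gam] for the kernel [ez]. *)
Lemma sumle_ez k : sumle (fun j => ez k j ^+ 2) (4 ^+ 2).
Proof.
have -> : 4 ^+ 2 = 2 * (4 + 4) :> R by ring.
apply: (@le_sumle _ _ _ (fun j : int => 2 * ((j%:~R ^+ 2)^-1 + ((k - j)%:~R ^+ 2)^-1)) _ (2 * (4 + 4))) => [j||].
- rewrite /ez; have := invsq_le1 j; have := invsq_le1 (k - j).
  have := invsq_ge0 j; have := invsq_ge0 (k - j).
  by set a := (_ ^+ 2)^-1; set b := (_ ^+ 2)^-1 => *; nra.
- by [].
apply: sumleZ; [by move=> j; rewrite addr_ge0 ?invsq_ge0|lra|].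
apply: sumleD; [exact: invsq_ge0|by move=> j; apply: invsq_ge0|exact: sumle_invsq|].
exact: (sumle_inj invsq_ge0 (@subl_inj k) sumle_invsq).
Qed.

End Kernel.

(** * Multipliers, the linear symbol and the quadratic kernel *)

Section Symbols.
Variable R : realType.
Implicit Types (k j m : int).

Definition sD k : R[i] := 'i%C * k%:~R.
Definition sH k : R[i] := - 'i%C * (Num.sg k)%:~R.
Definition sL k : R[i] := (`|k%:~R : R|)%:C.
(** At k = 0 the inverse of 0 is 0, which is also the value of [Lam (-1)] there. *)
Definition sL1 k : R[i] := (`|k%:~R : R|^-1)%:C.
Definition sL2 k : R[i] := ((k%:~R : R) ^+ 2)%:C.
Definition sN (d : R) k : R[i] := (1 - d%:C * 'i%C * k%:~R) / (1 + d%:C ^+ 2 * `|k|%:~R ^+ 2).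

Lemma intC k : k%:~R = ((k%:~R : R)%:C) :> R[i].
Proof. by rewrite rmorph_int. Qed.

Lemma normcM (x y : R[i]) : normc (x * y) = normc x * normc y.
Proof. exact: Normc.normcM. Qed.

Lemma normc_i : normc ('i%C : R[i]) = 1.
Proof. by rewrite /= expr0n /= expr1n add0r sqrtr1. Qed.

Lemma normc_sD k : normc (sD k) = `|k%:~R : R|.
Proof. by rewrite normcM normc_i mul1r intC normc_real. Qed.

Lemma normc_sH k : normc (sH k) <= 1.
Proof.
rewrite normcM normc_opp normc_i mul1r intC normc_real.
by case: sgzP => //= _; rewrite ?normr0 ?normrN ?normr1.
Qed.

Lemma LamE1 : Lam 1 = multiplier (sL) :> (distr R -> distr R).
Proof.
rewrite /Lam; congr multiplier; apply/funext => j; rewrite /sL.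
by have [->|j0] := eqVneq j 0; rewrite ?normr0 // powRr1.
Qed.

Lemma LamEN1 : Lam (-1) = multiplier (sL1) :> (distr R -> distr R).
Proof.
rewrite /Lam; congr multiplier; apply/funext => j; rewrite /sL1.
by have [->|j0] := eqVneq j 0; rewrite ?normr0 ?invr0 // powR_inv1.
Qed.

Lemma LamE2 : Lam 2 = multiplier (sL2) :> (distr R -> distr R).
Proof.
rewrite /Lam; congr multiplier; apply/funext => j; rewrite /sL2.
have [->|j0] := eqVneq j 0; first by rewrite expr0n.
by rewrite powR_mulrn // real_normK // num_real.
Qed.

Lemma sD0 : sD 0 = 0. Proof. exact: mulr0. Qed.
Lemma sH0 : sH 0 = 0. Proof. exact: mulr0. Qed.

Lemma sD_conj k : sD (- k) = (sD k)^*.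
Proof. by rewrite /sD !intC rmorphN; apply: complex_ext; rewrite /=; ring. Qed.

Lemma sH_conj k : sH (- k) = (sH k)^*.
Proof. by rewrite /sH sgrN !intC; apply: complex_ext; rewrite /= ?rmorphN /=; ring. Qed.

Lemma sL_conj k : sL (- k) = (sL k)^*.
Proof. by rewrite /sL rmorphN normrN; apply: complex_ext; rewrite /= ?oppr0. Qed.

Lemma sL1_conj k : sL1 (- k) = (sL1 k)^*.
Proof. by rewrite /sL1 rmorphN normrN; apply: complex_ext; rewrite /= ?oppr0. Qed.

Lemma sL2_conj k : sL2 (- k) = (sL2 k)^*.
Proof. by rewrite /sL2 rmorphN sqrrN; apply: complex_ext; rewrite /= ?oppr0. Qed.

Lemma sNE d k : sN d k = (1 +i* (- (d * k%:~R))) * ((1 + d ^+ 2 * k%:~R ^+ 2)^-1)%:C.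
Proof.
rewrite /sN intC; congr (_ * _).
  by apply: complex_ext; rewrite /=; ring.
rewrite (_ : forall z : R, (z^-1)%:C = z%:C^-1); last exact: (fmorphV (real_complex R)).
congr _^-1.
rewrite rmorphD rmorphM !rmorphXn /=; congr (1 + _ * _).
rewrite intC -!rmorphXn /=; congr ((_)%:C).
have e : (`|k|) ^+ 2 = k ^+ 2 :> int by rewrite real_normK ?num_real.
exact: (congr1 (fun z : int => z%:~R) e).
Qed.

Lemma sN_conj d k : sN d (- k) = (sN d k)^*.
Proof. by rewrite !sNE rmorphN mulrN sqrrN; apply: complex_ext; rewrite /=; ring. Qed.

(** The modulus of the symbol is (1 + d^2 k^2)^(-1/2). The second bound is the gain of one
    derivative. *)
Lemma normc_sN d k : 0 < d -> normc (sN d k) <= 1 /\ normc (sN d k) * (d * `|k%:~R|) <= 1.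
Proof.
move=> d0; rewrite sNE normcM normc_real.
set x : R := k%:~R; have -> : d ^+ 2 * x ^+ 2 = (d * `|x|) ^+ 2.
  by rewrite exprMn real_normK // num_real.
have -> : normc (1 +i* (- (d * x))) = Num.sqrt (1 + (d * `|x|) ^+ 2).
  by rewrite /= expr1n sqrrN !exprMn real_normK // num_real.
set y := d * `|x|; have y0 : 0 <= y by rewrite mulr_ge0 // ltW.
set s := Num.sqrt _; have s2 : s ^+ 2 = 1 + y ^+ 2 by rewrite sqr_sqrtr // addr_ge0 // sqr_ge0.
have s1 : 1 <= s.
  by rewrite -(ler_pXn2r (n := 2)) ?nnegrE ?sqrtr_ge0 // s2 expr1n lerDl sqr_ge0.
have sy : y <= s.
  by rewrite -(ler_pXn2r (n := 2)) ?nnegrE ?sqrtr_ge0 // s2 lerDr.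
rewrite -s2 ger0_norm ?invr_ge0 ?sqr_ge0 // expr2 invfM mulrA divff ?mul1r; last by rewrite gt_eqF // (lt_le_trans ltr01).
by rewrite invf_le1 ?(lt_le_trans ltr01) // mulrC ler_pdivrMr ?(lt_le_trans ltr01) // mul1r.
Qed.



Definition lin (d b : R) k : R[i] :=
  sN d k * (sD k) + (2 * d)%:C * (sN d k * (sD k * sD k)) + sN d k * sH k
  - b%:C * (sN d k * (sH k * (sD k * sD k))) + (d ^+ 2)%:C * (sN d k * (sD k * (sD k * sD k))).

Lemma rhs_terms eps d b (a : distr R) k :
  let P1 := dmul a (multiplier sD a) in
  let P2 := dmul (multiplier sL1 a) a in
  let P3 := dmul (multiplier sL1 a) (multiplier sH a) in
  let P4 := dmul (multiplier sL1 a) (multiplier sL2 a) in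
  let P5 := dmul (multiplier sL1 a) (multiplier sH (multiplier sL2 a)) in
  let P6 := dmul a (multiplier sH (multiplier sD a)) in
  let P7 := dmul (multiplier sL1 a) (multiplier sD (multiplier sD a)) in
  rhs eps d b a k = lin d b k * a k - eps%:C * (sN d k * (
    2 * P1 k + sL k * (sH k * P2 k - P3 k) + b%:C * (sL k * (sH k * P4 k - P5 k))
    - d%:C * (sL k * (sH k * P1 k - P6 k)) + d%:C * (sD k * P1 k)
    + d%:C * (sL k * (sD k * (sD k * P2 k) - P7 k)))).
Proof.
move=> P1 P2 P3 P4 P5 P6 P7.
transitivity (sN d k * (sD k * a k) + (2 * d)%:C * (sN d k * (sD k * (sD k * a k)))
  + sN d k * (sH k * a k) - b%:C * (sN d k * (sH k * (sD k * (sD k * a k))))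
  + (d ^+ 2)%:C * (sN d k * (sD k * (sD k * (sD k * a k)))) - eps%:C * (sN d k * (
    2 * P1 k + sL k * (sH k * P2 k - P3 k) + b%:C * (sL k * (sH k * P4 k - P5 k))
    - d%:C * (sL k * (sH k * P1 k - P6 k)) + d%:C * (sD k * P1 k)
    + d%:C * (sL k * (sD k * (sD k * P2 k) - P7 k))))).
  by rewrite /rhs LamE1 LamEN1 LamE2.
by rewrite /lin; ring.
Qed.

(* N is inverse to 1 + delta d/dx. *)
Lemma linE d b k : 0 < d ->
  lin d b k = (1 + d%:C * sD k) * sD k + sN d k * sH k * (1 - b%:C * (sD k * sD k)).
Proof.
move=> d0; have h : sN d k * (1 + d%:C * sD k) = 1.
  rewrite sNE /sD intC; set x : R := k%:~R.
  have h1 : 1 + d ^+ 2 * x ^+ 2 != 0 by rewrite gt_eqF // ltr_wpDr ?ltr01 // mulr_ge0 ?sqr_ge0.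
  apply: complex_ext; rewrite /=; field; by rewrite exprMn.
transitivity (sN d k * (1 + d%:C * sD k) * ((1 + d%:C * sD k) * sD k) + sN d k * sH k * (1 - b%:C * (sD k * sD k))); last by rewrite h mul1r.
rewrite /lin rmorphXn rmorphM /= (_ : 2%:C = 2 :> R[i]); last by rewrite rmorph_nat.
ring.
Qed.

Lemma Re_lin d b k : 0 < d ->
  Re (lin d b k) = - (d * k%:~R ^+ 2 + d * `|k%:~R| * (1 + b * k%:~R ^+ 2) / (1 + d ^+ 2 * k%:~R ^+ 2)).
Proof.
move=> d0; rewrite linE // sNE /sD /sH !intC; set x : R := k%:~R; set g : R := (Num.sg k)%:~R.
have -> : `|x| = g * x by rewrite /g /x; case: sgzP => h; [rewrite h normr0 mul0r|rewrite gtr0_norm ?ltr0z // mul1r|rewrite ltr0_norm ?ltrz0 // rmorphN mulN1r].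
set D := (1 + d ^+ 2 * x ^+ 2)^-1; rewrite /=; ring.
Qed.


Lemma lin_conj d b k : lin d b (- k) = (lin d b k)^*.
Proof.
rewrite /lin sN_conj sD_conj sH_conj; move: (sN d k) (sD k) (sH k) (2 * d) (d ^+ 2) => N D H u v.
by case: N D H => [? ?] [? ?] [? ?]; apply: complex_ext; rewrite /=; ring.
Qed.

(** Both the full rate d and some multiple of k^2 are wanted. For |k| = 1 the dissipation d k^2 is
    used up by the rate, and the surplus is the contribution of the Hilbert transform, at least d /
    (1 + d^2); this is the origin of the factor 1 + d^2. For |k| >= 2 half of d k^2 already exceeds
    d. *)
Lemma Re_lin_le d b k : 0 < d -> 0 <= b -> k != 0 ->
  Re (lin d b k) <= - (d / (2 * (1 + d ^+ 2)) * k%:~R ^+ 2) - d.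
Proof.
move=> d0 b0 k0; rewrite Re_lin //; have := int_sqr_ge1 R k0.
have hx : `|k%:~R : R| ^+ 2 = k%:~R ^+ 2 by rewrite real_normK // num_real.
rewrite -hx => _; have hk : `|k%:~R : R| = 1 \/ 2 <= `|k%:~R : R|.
  rewrite -intr_norm; have [->|k1] := eqVneq `|k| 1; [by left|right].
  by rewrite (_ : 2 = 2%:~R) // ler_int; lia.
move: (`|k%:~R : R|) hk => x hx1.
have q0 : 0 < 1 + d ^+ 2 by rewrite ltr_wpDr ?sqr_ge0.
have q1 : 0 < 1 + d ^+ 2 * x ^+ 2 by rewrite ltr_wpDr // mulr_ge0 ?sqr_ge0.
have q2 : d / (2 * (1 + d ^+ 2)) <= d / 2.
  rewrite ler_pM2l // lef_pV2 ?posrE ?mulr_gt0 ?ltr0n //.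
  by rewrite ler_peMr // lerDl sqr_ge0.
case: hx1 => [->|x2].
  rewrite !expr1n !mulr1 -opprD lerN2 addrC lerD2l invfM mulrA ler_pM2r ?invr_gt0 //.
  by rewrite ler_pM2l //; lra.
rewrite -opprD lerN2.
have : 0 <= d * x * (1 + b * x ^+ 2) / (1 + d ^+ 2 * x ^+ 2).
  rewrite divr_ge0 ?(ltW q1) // mulr_ge0 ?addr_ge0 ?mulr_ge0 ?sqr_ge0 //; lra.
have : d / (2 * (1 + d ^+ 2)) * x ^+ 2 <= d / 2 * x ^+ 2 by rewrite ler_wpM2r ?sqr_ge0.
have : d * 2 ^+ 2 <= d * x ^+ 2 by rewrite ler_wpM2l ?(ltW d0) // ler_pXn2r ?nnegrE //; lra.
set A := d * x * _ / _; set B := d / _ * _; lra.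
Qed.

Lemma normc_lin d b k : 0 < d -> 0 <= b -> normc (lin d b k) <= (2 + d + b) * k%:~R ^+ 2.
Proof.
move=> d0 b0; have [->|k0] := eqVneq k 0.
  rewrite expr0n mulr0 (_ : lin d b 0 = 0) ?normc_0 //.
  by rewrite /lin sD0 sH0 !mulr0 !addr0 subr0.
rewrite linE //; apply: (le_trans (normcD _ _)).
have hx : `|k%:~R : R| ^+ 2 = k%:~R ^+ 2 by rewrite real_normK // num_real.
have h1 : 1 <= `|k%:~R : R|.
  by rewrite -(ler_pXn2r (n := 2)) ?nnegrE ?normr_ge0 // expr1n hx int_sqr_ge1.
have hA : normc (1 + d%:C * sD k) <= 1 + d * `|k%:~R|.
  by apply: (le_trans (normcD _ _)); rewrite (normcM d%:C) normc_sD !normc_real normr1 (ger0_norm (ltW d0)).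
have hB : normc (1 - b%:C * (sD k * sD k)) <= 1 + b * (`|k%:~R| * `|k%:~R|).
  by apply: (le_trans (normcB _ _)); rewrite (normcM b%:C) (normcM (sD k)) normc_sD !normc_real normr1 (ger0_norm b0).
have [hN _] := normc_sN k d0; have hH := normc_sH k.
have hNH : normc (sN d k * sH k) <= 1 by rewrite normcM mulr_ile1 ?normc_ge0.
rewrite (normcM _ (sD k)) (normcM (sN d k * _)) normc_sD -hx.
apply: (@le_trans _ _ ((1 + d * `|k%:~R|) * `|k%:~R| + 1 * (1 + b * (`|k%:~R| * `|k%:~R|)))).
  apply: lerD; first by apply: ler_wpM2r.
  by apply: ler_pM => //; exact: normc_ge0.
by nra.
Qed.

(* m stands for k - j. *)
Definition tau (e d b : R) k j : R[i] :=
  let m := k - j in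
  - (e%:C * (sN d k * (2 * sD m + sL k * ((sH k - sH m) * sL1 j)
    + b%:C * (sL k * ((sH k - sH m) * (sL1 j * sL2 m)))
    - d%:C * (sL k * ((sH k - sH m) * sD m)) + d%:C * (sD k * sD m)
    + d%:C * (sL k * ((sD k * sD k - sD m * sD m) * sL1 j))))).

Lemma tau_conj e d b k j : tau e d b (- k) (- j) = (tau e d b k j)^*.
Proof.
rewrite /tau (_ : - k - - j = - (k - j)); last by rewrite opprD.
move: (k - j) => m; rewrite !sN_conj !sD_conj !sH_conj !sL_conj !sL1_conj !sL2_conj.
move: (sN d k) (sD k) (sH k) (sL k) (sL1 j) (sH m) (sD m) (sL2 m) => N D H L L1 Hm Dm L2.
by case: N D H L L1 Hm Dm L2 => [? ?] [? ?] [? ?] [? ?] [? ?] [? ?] [? ?] [? ?]; apply: complex_ext; rewrite /=; ring.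
Qed.

(** The left side can only be nonzero when k and m have opposite signs, and then |m| <= |k - m|. One
    power of |m| is thereby traded for |j|, which cancels the [sL1 j] of the capillary term. *)
Lemma sgz_diff k m : k != 0 -> `|(Num.sg k)%:~R - (Num.sg m)%:~R : R| * m%:~R ^+ 2 <= 2 * (`|(k - m)%:~R : R| * `|m%:~R|).
Proof.
move=> k0; have : `|Num.sg k - Num.sg m| * m ^+ 2 <= 2 * (`|k - m| * `|m|).
  by case: (sgrP k) k0; case: (sgrP m) => // m0 k1 _; nia.
by rewrite expr2 -(ler_int R) !rmorphM /= !intr_norm !rmorphB expr2.
Qed.

(** The constant is the total weight of |m|: the six terms contribute 2, 2, 2 b / d, 2, 1 and 2,
    after |k| <= |j| + |m|. In every term carrying b or d, the multiplier N pays for one factor |k|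
    at the price 1 / d; in the last one k^2 - m^2 = j (k + m) releases the |j| that cancels
    [sL1 j]. *)
Lemma tau_bound e d b k j : 0 < e -> 0 < d -> 0 <= b -> j != 0 -> 
  normc (tau e d b k j) <= e * ((9 + 2 * b / d) * (`|j%:~R| + `|(k - j)%:~R|)).
Proof.
move=> e0 d0 b0 j0; rewrite /tau; set m := k - j.
have [hn hnd] := normc_sN k d0.
have nL : normc (sL k) = `|k%:~R| by rewrite normc_real normr_id.
have nL1 : normc (sL1 j) = `|j%:~R|^-1 by rewrite normc_real ger0_norm ?invr_ge0.
have nL2 : normc (sL2 m) = `|m%:~R| ^+ 2 by rewrite normc_real real_normK ?num_real // ger0_norm ?sqr_ge0.
have nH : normc (sH k - sH m) <= 2.
  by apply: (le_trans (normcB _ _)); rewrite (_ : 2 = 1 + 1) // lerD ?normc_sH.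
have nHm : `|k%:~R| * (normc (sH k - sH m) * `|m%:~R| ^+ 2) <= `|k%:~R| * (2 * (`|j%:~R| * `|m%:~R|)) :> R.
  have [->|k0] := eqVneq k 0; first by rewrite normr0 !mul0r.
  rewrite ler_wpM2l // /sH -mulrBr normcM normc_opp normc_i mul1r !intC -rmorphB normc_real.
  rewrite real_normK ?num_real //; apply: (le_trans (sgz_diff m k0)).
  by rewrite /m opprB addrC subrK.
have nDD : normc (sD k * sD k - sD m * sD m) <= `|j%:~R| * (`|k%:~R| + `|m%:~R|).
  rewrite (_ : _ - _ = (sD k - sD m) * (sD k + sD m)); last by ring.
  rewrite normcM (_ : sD k - sD m = sD j); last by rewrite /sD /m rmorphB /=; ring.
  by rewrite normc_sD ler_wpM2l // (le_trans (normcD _ _)) // !normc_sD.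
have tri : `|k%:~R| <= `|j%:~R| + `|m%:~R| :> R.
  by apply: le_trans (ler_normD _ _); rewrite -rmorphD /m addrC subrK.
have j1 : 1 <= `|j%:~R : R|.
  by rewrite -(ler_pXn2r (n := 2)) ?nnegrE ?normr_ge0 // expr1n real_normK ?num_real ?int_sqr_ge1.
rewrite normc_opp normcM normc_real (gtr0_norm e0) ler_pM2l // normcM.
have e1 : normc (2 * sD m) = 2 * `|m%:~R|.
  by rewrite normcM normc_sD (_ : normc 2 = 2) // (_ : 2 = 2%:C) ?normc_real ?ger0_norm //; rewrite (rmorph_nat (real_complex R)).
have e2 : normc (sL k * ((sH k - sH m) * sL1 j)) = `|k%:~R| * (normc (sH k - sH m) * `|j%:~R|^-1).
  by rewrite normcM (normcM _ (sL1 j)) nL nL1.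
have e3 : normc (b%:C * (sL k * ((sH k - sH m) * (sL1 j * sL2 m)))) = b * (`|k%:~R| * (normc (sH k - sH m) * (`|j%:~R|^-1 * `|m%:~R| ^+ 2))).
  by rewrite (normcM b%:C) (normcM (sL k)) (normcM _ (sL1 j * _)) (normcM (sL1 j)) nL nL1 nL2 normc_real ger0_norm.
have e4 : normc (d%:C * (sL k * ((sH k - sH m) * sD m))) = d * (`|k%:~R| * (normc (sH k - sH m) * `|m%:~R|)).
  by rewrite (normcM d%:C) (normcM (sL k)) (normcM _ (sD m)) nL normc_sD normc_real gtr0_norm.
have e5 : normc (d%:C * (sD k * sD m)) = d * (`|k%:~R| * `|m%:~R|).
  by rewrite (normcM d%:C) (normcM (sD k)) !normc_sD normc_real gtr0_norm.
have e6 : normc (d%:C * (sL k * ((sD k * sD k - sD m * sD m) * sL1 j))) = d * (`|k%:~R| * (normc (sD k * sD k - sD m * sD m) * `|j%:~R|^-1)).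
  by rewrite (normcM d%:C) (normcM (sL k)) (normcM _ (sL1 j)) nL nL1 normc_real gtr0_norm.
set X1 := 2 * sD m in e1 *; set X2 := sL k * _ in e2 *; set X3 := b%:C * _ in e3 *.
set X4 := d%:C * (sL k * ((sH k - sH m) * sD m)) in e4 *; set X5 := d%:C * (sD k * sD m) in e5 *.
set X6 := d%:C * _ in e6 *.
have : normc (X1 + X2 + X3 - X4 + X5 + X6) <= normc X1 + normc X2 + normc X3 + normc X4 + normc X5 + normc X6.
  by do 5 (apply: (le_trans (normcD _ _)); rewrite ?normc_opp lerD2r).
rewrite e1 e2 e3 e4 e5 e6.
move: (normc _) => S hS; apply: (@le_trans _ _ (normc (sN d k) * (2 * `|m%:~R| + `|k%:~R| * (normc (sH k - sH m) / `|j%:~R|) +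
     b * (`|k%:~R| * (normc (sH k - sH m) * (`|j%:~R|^-1 * `|m%:~R| ^+ 2))) +
     d * (`|k%:~R| * (normc (sH k - sH m) * `|m%:~R|)) +
     d * (`|k%:~R| * `|m%:~R|) +
     d * (`|k%:~R| * (normc (sD k * sD k - sD m * sD m) / `|j%:~R|))))).
  by rewrite ler_wpM2l ?normc_ge0.
move: hn hnd nH nHm nDD tri j1 (normc_ge0 (sN d k)) (normc_ge0 (sH k - sH m)) (normc_ge0 (sD k * sD k - sD m * sD m)).
move: (normr_ge0 (k%:~R : R)) (normr_ge0 (m%:~R : R)).
move: (normc (sN d k)) (normc (sH k - sH m)) (normc (sD k * sD k - sD m * sD m)) (`|k%:~R|) (`|j%:~R|) (`|m%:~R|) => n h q x y z.
move=> x0 z0 n1 nd h2 hm qq tri y1 n0 h0 q0.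
have y0 : 0 < y by lra.
have yV : y^-1 <= 1 by rewrite invf_le1.
have yV0 : 0 <= y^-1 by rewrite invr_ge0 ltW.
have T2 : n * (x * (h / y)) <= 2 * (y + z).
  have A : h / y <= 2 by rewrite -[2]mulr1 ler_pM.
  have B : x * (h / y) <= x * 2 by rewrite ler_wpM2l.
  have : 0 <= x * (h / y) by rewrite mulr_ge0 ?mulr_ge0.
  by move: (x * (h / y)) B => w B w0; nra.
have T3 : n * (b * (x * (h * (y^-1 * z ^+ 2)))) <= 2 * b / d * z.
  have A : x * (h * (y^-1 * z ^+ 2)) <= x * (2 * z).
    rewrite (_ : x * (h * (y^-1 * z ^+ 2)) = x * (h * z ^+ 2) * y^-1); last by ring.
    rewrite (_ : x * (2 * z) = x * (2 * (y * z)) * y^-1); last by field; lra.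
    by rewrite ler_wpM2r.
  have B : n * x <= d^-1 by rewrite -[d^-1]mul1r ler_pdivlMr //; lra.
  apply: (@le_trans _ _ (n * (b * (x * (2 * z))))); first by rewrite ler_wpM2l // ler_wpM2l.
  rewrite (_ : n * _ = (n * x) * (b * 2 * z)); last by ring.
  rewrite (_ : 2 * b / d * z = d^-1 * (b * 2 * z)); last by ring.
  by rewrite ler_wpM2r // !mulr_ge0.
have T4 : n * (d * (x * (h * z))) <= 2 * z.
  rewrite (_ : n * _ = n * (d * x) * (h * z)); last by ring.
  rewrite -[2 * z]mul1r ler_pM ?mulr_ge0 ?(ltW d0) // ler_wpM2r //.
have T5 : n * (d * (x * z)) <= z.
  rewrite (_ : n * _ = n * (d * x) * z); last by ring.
  by rewrite -[leRHS]mul1r ler_wpM2r.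
have T6 : n * (d * (x * (q / y))) <= x + z.
  rewrite (_ : n * _ = n * (d * x) * (q / y)); last by ring.
  rewrite -[leRHS]mul1r ler_pM ?mulr_ge0 ?(ltW d0) //.
  by rewrite ler_pdivrMr // mulrC.
have T1 : n * (2 * z) <= 2 * z by nra.
have bd : 0 <= 2 * b / d * y by rewrite !mulr_ge0 ?invr_ge0 ?(ltW d0) ?(ltW y0).
rewrite !mulrDr; move: T1 T2 T3 T4 T5 T6 bd; lra.
Qed.

Lemma dmul_zcvg (a b : distr R) A B k : herm a -> herm b ->
  sumle (fun k => normc (a k) ^+ 2) A -> sumle (fun k => normc (b k) ^+ 2) B ->
  zcvg (fun j => a j * b (k - j)) (dmul a b k).
Proof.
move=> ha hb sa sb; have [_ ea sqa _] := funofP ha sa; have [_ eb sqb _] := funofP hb sb.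
by have := fhatM k sqa sqb; rewrite ea eb.
Qed.

Lemma mult_herm (s : int -> R[i]) a : (forall k, s (- k) = (s k)^*) -> herm a -> herm (multiplier s a).
Proof. by move=> hs ha k; rewrite /multiplier hs ha rmorphM. Qed.

Lemma rhsE e d b (a : distr R) k A : herm a -> a 0 = 0 ->
  sumle (fun k => (k%:~R ^+ 2 * normc (a k)) ^+ 2) A ->
  zcvg (fun j => tau e d b k j * (a j * a (k - j))) (rhs e d b a k - lin d b k * a k).
Proof.
move=> ha a0 sA.
have ml2 (s : int -> R[i]) : (forall k, k != 0 -> normc (s k) <= k%:~R ^+ 2) ->
    sumle (fun k => normc (multiplier s a k) ^+ 2) A.
  move=> hs; apply: (le_sumle _ (lexx _) sA) => j; rewrite /multiplier normcM.
  have h2 := sqr_ge0 (j%:~R : R); rewrite ler_pXn2r ?nnegrE; first last; [exact: (mulr_ge0 h2 (normc_ge0 _))|exact: (mulr_ge0 (normc_ge0 _) (normc_ge0 _))|by []|].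
  have [->|j0] := eqVneq j 0; first by rewrite a0 normc_0 !mulr0.
  by rewrite ler_wpM2r ?normc_ge0 ?hs.
have l2a : sumle (fun k => normc (a k) ^+ 2) A.
  apply: (le_sumle _ (lexx _) (ml2 (fun=> 1) _)) => [j|j j0]; first by rewrite /multiplier mul1r.
  by rewrite (normc_real 1) normr1 int_sqr_ge1.
have n1 j : j != 0 -> 1 <= `|j%:~R : R|.
  by move=> j0; rewrite -(ler_pXn2r (n := 2)) ?nnegrE ?normr_ge0 // expr1n real_normK ?num_real ?int_sqr_ge1.
have n2 j : j != 0 -> `|j%:~R : R| <= j%:~R ^+ 2.
  move=> /n1 h; rewrite -(@real_normK _ (j%:~R)) ?num_real // expr2 ler_peMl ?normr_ge0 //.
have hD : forall j, j != 0 -> normc (sD j) <= (j%:~R : R) ^+ 2 by move=> j j0; rewrite normc_sD n2.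
have hH : forall j, j != 0 -> normc (sH j) <= (j%:~R : R) ^+ 2.
  by move=> j j0; apply: (le_trans (normc_sH j)); rewrite int_sqr_ge1.
have hL1 : forall j, j != 0 -> normc (sL1 j) <= (j%:~R : R) ^+ 2.
  move=> j j0; rewrite normc_real ger0_norm ?invr_ge0 //; apply: (@le_trans _ _ 1); last exact: int_sqr_ge1.
  by rewrite invf_le1 ?(lt_le_trans ltr01) ?n1.
have hL2 : forall j, j != 0 -> normc (sL2 j) <= (j%:~R : R) ^+ 2.
  by move=> j j0; rewrite normc_real ger0_norm // sqr_ge0.
have mm (s t : int -> R[i]) : multiplier s (multiplier t a) = multiplier (fun k => s k * t k) a.
  by apply/funext => j; rewrite /multiplier mulrA.
have hHD : forall j, j != 0 -> normc (sH j * sD j) <= (j%:~R : R) ^+ 2.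
  move=> j j0; rewrite normcM normc_sD; apply: le_trans (n2 _ j0); rewrite -[leRHS]mul1r.
  by rewrite ler_wpM2r // normc_sH.
have hHL : forall j, j != 0 -> normc (sH j * sL2 j) <= (j%:~R : R) ^+ 2.
  move=> j j0; rewrite normcM; apply: le_trans (hL2 _ j0); rewrite -[leRHS]mul1r.
  by rewrite ler_wpM2r ?normc_ge0 // normc_sH.
have hDD : forall j, j != 0 -> normc (sD j * sD j) <= (j%:~R : R) ^+ 2.
  by move=> j j0; rewrite normcM normc_sD -expr2 real_normK ?num_real.
have cD := sD_conj; have cH := sH_conj; have cL1 := sL1_conj; have cL2 := sL2_conj.
have cM (s t : int -> R[i]) : (forall k, s (- k) = (s k)^*) -> (forall k, t (- k) = (t k)^*) ->
   forall k, s (- k) * t (- k) = (s k * t k)^*.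
  by move=> hs ht j; rewrite hs ht rmorphM.
rewrite rhs_terms !mm.
have Z1 := dmul_zcvg k ha (mult_herm cD ha) l2a (ml2 _ hD).
have Z2 := dmul_zcvg k (mult_herm cL1 ha) ha (ml2 _ hL1) l2a.
have Z3 := dmul_zcvg k (mult_herm cL1 ha) (mult_herm cH ha) (ml2 _ hL1) (ml2 _ hH).
have Z4 := dmul_zcvg k (mult_herm cL1 ha) (mult_herm cL2 ha) (ml2 _ hL1) (ml2 _ hL2).
have Z5 := dmul_zcvg k (mult_herm cL1 ha) (mult_herm (cM _ _ cH cL2) ha) (ml2 _ hL1) (ml2 _ hHL).
have Z6 := dmul_zcvg k ha (mult_herm (cM _ _ cH cD) ha) l2a (ml2 _ hHD).
have Z7 := dmul_zcvg k (mult_herm cL1 ha) (mult_herm (cM _ _ cD cD) ha) (ml2 _ hL1) (ml2 _ hDD).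
have B := zcvgZ (- (e%:C * sN d k)).
have neg (f : int -> R[i]) (l : R[i]) : zcvg f l -> zcvg (fun k => - 1 * f k) (-1 * l) by exact: zcvgZ.
have Z := B _ _ (zcvgD (zcvgD (zcvgD (zcvgD (zcvgD (zcvgZ 2 Z1)
  (zcvgZ (sL k) (zcvgD (zcvgZ (sH k) Z2) (neg _ _ Z3))))
  (zcvgZ (b%:C * sL k) (zcvgD (zcvgZ (sH k) Z4) (neg _ _ Z5))))
  (zcvgZ (- (d%:C * sL k)) (zcvgD (zcvgZ (sH k) Z1) (neg _ _ Z6))))
  (zcvgZ (d%:C * sD k) Z1))
  (zcvgZ (d%:C * sL k) (zcvgD (zcvgZ (sD k * sD k) Z2) (neg _ _ Z7)))).
set l := (X in zcvg _ X).
move: Z; set l' := (X in zcvg _ X) => Z.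
have -> : l = l' by rewrite /l /l'; ring.
apply: eq_zcvg Z => j; rewrite /tau /multiplier; ring.
Qed.

End Symbols.

(** * The system satisfied by the unknowns k^2 u_k *)

Section Coefficients.
Variables (R : realType) (eps delta beta : R).
Hypotheses (e0 : 0 < eps) (d0 : 0 < delta) (b0 : 0 <= beta).
Implicit Types (k j : int) (p a : int -> R[i]).

(* The kernel of the quadratic term in the unknowns k^2 u_k. The vanishing
   inverses at j = 0 and k - j = 0 agree with u_0 = 0. *)
Definition sig k j : R[i] :=
  (k%:~R ^+ 2 / (2 * eps) * ((j%:~R ^+ 2)^-1 * ((k - j)%:~R ^+ 2)^-1))%:C * tau eps delta beta k j.

Definition KK : R := 9 + 2 * beta / delta.

Lemma KK_ge0 : 0 <= KK.
Proof. by rewrite addr_ge0 // !mulr_ge0 ?invr_ge0 ?(ltW d0). Qed.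

(** One of the two factors |k| is bounded by |j| + |m|, m = k - j. Then (|j| + |m|)^2 <= 2 (j^2 +
    m^2) turns the product of the inverse squares into their sum. *)
Lemma sig_bound k j : normc (sig k j) <= KK * `|k%:~R| * ez R k j.
Proof.
have rhs_ge0 : 0 <= KK * `|k%:~R| * ez R k j by rewrite !mulr_ge0 ?KK_ge0 ?ez_ge0.
have [->|j0] := eqVneq j 0.
  by rewrite /sig expr0n /= invr0 mul0r mulr0 mul0r normc_0 !mulr_ge0 ?KK_ge0 ?ez_ge0.
have [kj|m0] := eqVneq (k - j) 0.
  by rewrite /sig kj expr0n /= invr0 !mulr0 mul0r normc_0.
have h : 0 <= k%:~R ^+ 2 / (2 * eps) * ((j%:~R ^+ 2)^-1 * ((k - j)%:~R ^+ 2)^-1).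
  apply: mulr_ge0; [apply: divr_ge0; [exact: sqr_ge0|by rewrite mulr_ge0 // ltW]|apply: mulr_ge0; rewrite invr_ge0; exact: sqr_ge0].
rewrite /sig normcM normc_real ger0_norm; last first.
  exact: h.
have tri : `|k%:~R| <= `|j%:~R| + `|(k - j)%:~R| :> R.
  by apply: le_trans (ler_normD _ _); rewrite -rmorphD addrC subrK.
have tb := tau_bound k e0 d0 b0 j0.
apply: (le_trans (ler_wpM2l h tb)); rewrite /ez -/KK.
have hj : (j%:~R : R) != 0 by rewrite intr_eq0.
have hm : ((k - j)%:~R : R) != 0 by rewrite intr_eq0.
have sq (x : R) : x ^+ 2 = `|x| ^+ 2 by rewrite real_normK ?num_real.
rewrite !(sq _%:~R); move: hj hm tri; rewrite -normr_gt0 -(normr_gt0 (k - j)%:~R).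
move: (`|k%:~R|) (`|j%:~R|) (`|(k - j)%:~R|) (normr_ge0 (k%:~R : R)) => x y z x0 y0 z0 tri.
rewrite (_ : x ^+ 2 / (2 * eps) * ((y ^+ 2)^-1 * (z ^+ 2)^-1) * (eps * (KK * (y + z))) =
  KK * x * (x * (y + z) / (2 * y ^+ 2 * z ^+ 2))); last by field; rewrite ?gt_eqF.
rewrite (_ : (y ^+ 2)^-1 + (z ^+ 2)^-1 = 2 * (y ^+ 2 + z ^+ 2) / (2 * y ^+ 2 * z ^+ 2)); last by field; rewrite ?gt_eqF.
rewrite ler_wpM2l ?mulr_ge0 ?KK_ge0 // ler_pM2r ?invr_gt0 ?mulr_gt0 ?exprn_gt0 //.
by move: (sqr_ge0 (y - z)); nra.
Qed.

Lemma sig_conj k j : sig (- k) (- j) = (sig k j)^*.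
Proof.
rewrite /sig tau_conj (_ : - k - - j = - (k - j)); last by rewrite opprD.
have sqN z : ((- z)%:~R : R) ^+ 2 = z%:~R ^+ 2 by rewrite rmorphN sqrrN.
rewrite !sqN; case: (tau _ _ _ _ _) => u v; apply: complex_ext; rewrite /=; ring.
Qed.

Lemma sig0 j : sig 0 j = 0.
Proof. by rewrite /sig expr0n /= !mul0r. Qed.

Definition Ak k : R[i] := ((2 * eps)^-1)%:C * lin delta beta k.

Lemma normc_Ak k : normc (Ak k) <= (2 * eps)^-1 * ((2 + delta + beta) * k%:~R ^+ 2).
Proof.
have h : 0 <= (2 * eps)^-1 by rewrite invr_ge0 mulr_ge0 // ltW.
by rewrite normcM normc_real ger0_norm // ler_wpM2l // normc_lin.
Qed.

Lemma Ak_conj k : Ak (- k) = (Ak k)^*.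
Proof. by rewrite /Ak lin_conj; case: (lin _ _ _) => u v; apply: complex_ext; rewrite /=; ring. Qed.

Lemma Ak0 : Ak 0 = 0.
Proof. by rewrite /Ak /lin sD0 sH0 !(mulr0, addr0, subr0). Qed.

Definition nu : R := delta / (2 * eps).
Definition cc : R := nu / (2 * (1 + delta ^+ 2)).

Lemma Re_Ak k : k != 0 -> cc * k%:~R ^+ 2 + nu <= - Re (Ak k).
Proof.
move=> k0; rewrite /Ak ReM /= mul0r subr0 -mulrN; have := Re_lin_le d0 b0 k0.
rewrite -lerN2 => h; have h2 : 0 <= (2 * eps)^-1 by rewrite invr_ge0 mulr_ge0 // ltW.
have := ler_wpM2l h2 h; apply: le_trans; rewrite /cc /nu le_eqVlt; apply/orP; left; apply/eqP.
field; rewrite ?gt_eqF //; first by rewrite ltr_wpDr ?sqr_ge0.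
Qed.

Variables (a : distr R) (A : R).
Hypotheses (ha : herm a) (a0 : a 0 = 0)
  (sA : sumle (fun k => (k%:~R ^+ 2 * normc (a k)) ^+ 2) A).

Let p k : R[i] := (k%:~R ^+ 2)%:C * a k.

Lemma rhs_quad k : ((2 * eps)^-1)%:C * ((k%:~R ^+ 2)%:C * rhs eps delta beta a k)
  = Ak k * p k + quad sig p k.
Proof.
have := zcvgZ (((2 * eps)^-1)%:C * (k%:~R ^+ 2)%:C) (rhsE eps delta beta k ha a0 sA).
move=> Z; rewrite /quad; set f := (fun j => _).
have /csum_eq -> : zcvg f (((2 * eps)^-1)%:C * (k%:~R ^+ 2)%:C * (rhs eps delta beta a k - lin delta beta k * a k)).
  apply: eq_zcvg Z => j; rewrite /f /p /sig.
  have [->|j0] := eqVneq j 0; first by rewrite a0 !(mulr0, mul0r).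
  have [->|m0] := eqVneq (k - j) 0; first by rewrite a0 !(mulr0, mul0r).
  have hj : ((j%:~R : R) ^+ 2)^-1 * j%:~R ^+ 2 = 1 by rewrite mulVf // expf_neq0 // intr_eq0.
  have hm : (((k - j)%:~R : R) ^+ 2)^-1 * (k - j)%:~R ^+ 2 = 1 by rewrite mulVf // expf_neq0 // intr_eq0.
  move: hj hm; set x := (_ ^+ 2)^-1; set y := _ ^+ 2; set x' := (_ ^+ 2)^-1; set y' := _ ^+ 2 => hj hm.
  transitivity (((2 * eps)^-1)%:C * (k%:~R ^+ 2)%:C * (tau eps delta beta k j * (a j * a (k - j))) * (x * y)%:C * (x' * y')%:C).
    by rewrite hj hm !mulr1.
  by rewrite !rmorphM /=; ring.
rewrite /p /Ak; ring.
Qed.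

(** The unknown k^2 u_k does not see k = 0, so conservation of the mean is checked separately. Only
    the term from 2 u u_x survives there; its summands 2 i eps j |a_j|^2 are imaginary, and they are
    odd in j. Hence the symmetric sum has no real part and equals its conjugate. *)
Lemma rhs_at0 : rhs eps delta beta a 0 = 0.
Proof.
have := rhsE eps delta beta 0 ha a0 sA; rewrite a0 mulr0 subr0; set f := (fun j => _); set l := rhs _ _ _ _ _ => Z.
have fE j : f j = (2 * eps * j%:~R)%:C * 'i%C * (a j * (a j)^*).
  rewrite /f sub0r ha /tau (_ : sN delta 0 = 1); last by rewrite /sN mulr0 expr0n /= mulr0 subr0 addr0 divr1.
  rewrite sub0r sD0 (_ : sL R 0 = 0); last by rewrite /sL normr0.
  have -> : sD R (- j) = - ('i%C * (j%:~R)%:C) by rewrite /sD intC rmorphN; apply: complex_ext; rewrite /=; ring.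
  rewrite !(mul0r, mulr0, addr0, subr0) mul1r.
  by case: (a j) => u v; apply: complex_ext; rewrite /=; ring.
have l1 : l^* = l.
  apply: (zcvg_unique (zcvg_conj Z)); apply: eq_zcvg Z => j; rewrite !fE ha rmorphN.
  by case: (a j) => u v; apply: complex_ext; rewrite /=; ring.
have l2 : Re l = 0.
  have h := ccont_Re Z; have h2 : (fun n => Re (\sum_(k <- zrange n) f k)) @ \oo --> (0 : R).
    apply: cvg_near_cst; apply: nearW => n.
    by rewrite Re_sum big1 // => j _; rewrite fE; case: (a j) => u v /=; ring.
  exact: (norm_cvg_unique (h _) h2).
move: l1 l2; case: l {Z} => u v /= [] vv ->; congr (_ +i* _); lra.
Qed.

End Coefficients.

(** * Sobolev norms as weighted l^2 sums *)

Section Sobolev.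
Variable R : realType.
Implicit Types (k : int) (f : R -> R) (s : R).

Definition lam s k : R := if k == 0 then 0 else `|k%:~R| `^ s.

Lemma lam_ge0 s k : 0 <= lam s k.
Proof. by rewrite /lam; case: ifP => // _; exact: powR_ge0. Qed.

Lemma LamE s (a : distr R) k : Lam s a k = (lam s k)%:C * a k.
Proof. by rewrite /Lam /multiplier /lam; case: ifP. Qed.

Lemma normc_Lam s (a : distr R) k : normc (Lam s a k) = lam s k * normc (a k).
Proof. by rewrite LamE normcM normc_real ger0_norm // lam_ge0. Qed.

Lemma abs_int_ge1 k : k != 0 -> 1 <= `|k%:~R : R|.
Proof.
by move=> j0; rewrite -(ler_pXn2r (n := 2)) ?nnegrE ?normr_ge0 // expr1n real_normK ?num_real ?int_sqr_ge1.
Qed.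

Lemma lam_le s s' k : s <= s' -> lam s k <= lam s' k.
Proof.
by rewrite /lam => ss; case: eqVneq => // k0; apply: ler_powR => //; exact: abs_int_ge1.
Qed.

Lemma lam2 k : lam 2 k = k%:~R ^+ 2.
Proof.
rewrite /lam; case: eqVneq => [->|k0]; first by rewrite expr0n.
by rewrite powR_mulrn // real_normK // num_real.
Qed.

Lemma lam3 k : lam 3 k = `|k%:~R| * k%:~R ^+ 2.
Proof.
rewrite /lam; case: eqVneq => [->|k0]; first by rewrite expr0n mulr0.
by rewrite powR_mulrn // exprS real_normK // num_real.
Qed.

Lemma lam0 k : lam 0 k = (k != 0)%:R.
Proof. by rewrite /lam; case: eqVneq => // k0; rewrite powRr0. Qed.

Definition hsum s f k : R := (lam s k * normc (fhat f k)) ^+ 2.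

Lemma hsum_ge0 s f k : 0 <= hsum s f k.
Proof. exact: sqr_ge0. Qed.

Lemma herm_Lam s (a : distr R) : herm a -> herm (Lam s a).
Proof.
move=> ha k; rewrite !LamE ha /lam oppr_eq0 rmorphN normrN; case: (a k) => u v.
by case: ifP => _; apply: complex_ext; rewrite /=; ring.
Qed.

Lemma hsumE s f k : normc (Lam s (fhat f) k) ^+ 2 = hsum s f k.
Proof. by rewrite normc_Lam. Qed.

Lemma zero_meanP f : int1 f -> (zero_mean f <-> fhat f 0 = 0).
Proof.
move=> f1; have := I1_fhat f; rewrite /zero_mean -/(I1 f) => ->; split=> [|->]; last by rewrite /= mulr0.
have h := herm_fhat f1 0; rewrite oppr0 in h; move: h; case: (fhat f 0) => u v /= [] h h2.
have -> : v = 0 by lra.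
congr (_ +i* _); apply/eqP; move/eqP: h2; rewrite mulf_eq0 => /orP [|//].
by rewrite gt_eqF // mulr_gt0 ?pi_gt0.
Qed.

Lemma inHsE s f : inHs s f <-> [/\ int1 f, fhat f 0 = 0 & exists A, sumle (hsum s f) A].
Proof.
split=> [[/inLp1P f1 z [g /inLp2P g2 gE]]|[f1 z [A sA]]].
  split => //; first exact/zero_meanP.
  exists ((2 * pi)^-1 * I2 g); have := bessel g2; rewrite gE.
  by under eq_fun do rewrite hsumE.
split; [exact/inLp1P|exact/zero_meanP|].
have [||_ gE g2 _] := @funofP _ (Lam s (fhat f)) A.
- exact/herm_Lam/herm_fhat.
- by under eq_fun do rewrite hsumE.
by exists (funof (Lam s (fhat f))) => //; apply/inLp2P.
Qed.

Lemma Hnorm_ge0 s f : 0 <= Hnorm s f.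
Proof. by rewrite /Hnorm /L2norm fine_ge0 // Lnorm_ge0. Qed.

Lemma L2norm_ge0 f : 0 <= L2norm f.
Proof. by rewrite /L2norm fine_ge0 // Lnorm_ge0. Qed.

Lemma Hnorm_le s f A : int1 f -> sumle (hsum s f) A -> Hnorm s f ^+ 2 <= 2 * pi * A.
Proof.
move=> f1 sA; have [||_ gE g2 h] := @funofP _ (Lam s (fhat f)) A.
- exact/herm_Lam/herm_fhat.
- by under eq_fun do rewrite hsumE.
by rewrite /Hnorm L2norm_sqr.
Qed.

Lemma Hnorm_sum s f : inHs s f -> sumle (hsum s f) ((2 * pi)^-1 * Hnorm s f ^+ 2).
Proof.
move=> /inHsE [f1 _ [A sA]]; have [||_ gE g2 h] := @funofP _ (Lam s (fhat f)) A.
- exact/herm_Lam/herm_fhat.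
- by under eq_fun do rewrite hsumE.
rewrite /Hnorm L2norm_sqr //; have := bessel g2; rewrite gE.
by under eq_fun do rewrite hsumE.
Qed.

Lemma L2norm_le f A : int1 f -> sumle (fun k => normc (fhat f k) ^+ 2) A -> L2norm f ^+ 2 <= 2 * pi * A.
Proof. by move=> f1 /(parseval_le f1) [f2 h]; rewrite L2norm_sqr. Qed.

(** Limits of single coefficients under a common l^2 majorant become limits in norm. The norm is
    abstract because the lemma serves continuity in H^2 ([Hnorm 2]) as well as differentiability in
    L^2 ([L2norm]). *)
Lemma dominated_L2 (T : Type) (F : set_system T) {FF : Filter F} (h : T -> int -> R) (G : int -> R) B (nrm : T -> R) :
  (\forall r \near F, forall k, 0 <= h r k <= G k) ->
  (forall k, h r k @[r --> F] --> 0) ->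
  (forall k, 0 <= G k) -> sumle (fun k => G k ^+ 2) B ->
  (forall r, 0 <= nrm r) ->
  (\forall r \near F, forall A, sumle (fun k => h r k ^+ 2) A -> nrm r ^+ 2 <= 2 * pi * A) ->
  nrm r @[r --> F] --> 0.
Proof.
move=> hG h0 G0 sG n0 nA; apply/cvgrPdist_le => /= e e_gt0.
have d0 : 0 < (2 * pi)^-1 * e ^+ 2 by rewrite mulr_gt0 ?exprn_gt0 // invr_gt0 mulr_gt0 ?pi_gt0.
have P1 : \forall r \near F, forall k, 0 <= h r k ^+ 2 <= G k ^+ 2.
  apply: filterS hG => r hr k; have /andP[a b] := hr k; rewrite sqr_ge0 /=.
  by rewrite ler_pXn2r ?nnegrE // (le_trans a).
have P2 k : h r k ^+ 2 @[r --> F] --> (0 : R).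
  by rewrite -(mulr0 0 : (0 * 0 : R) = 0); under eq_fun do rewrite expr2; exact: cvgM.
have P3 k : 0 <= G k ^+ 2 by exact: sqr_ge0.
have near_small := @sumle_dominated R _ T F _ (fun r k => h r k ^+ 2) (fun k => G k ^+ 2) B P1 P2 P3 sG _ d0.
have ns : \forall r \near F, sumle (fun k => h r k ^+ 2) ((2 * pi)^-1 * e ^+ 2) by exact: near_small.
near=> r.
have sr : sumle (fun k => h r k ^+ 2) ((2 * pi)^-1 * e ^+ 2) by near: r.
have : nrm r ^+ 2 <= e ^+ 2.
  have -> : e ^+ 2 = 2 * pi * ((2 * pi)^-1 * e ^+ 2) by rewrite mulrA divff ?mul1r // gt_eqF // mulr_gt0 ?pi_gt0.
  have nr : forall A, sumle (fun k => h r k ^+ 2) A -> nrm r ^+ 2 <= 2 * pi * A by near: r.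
  exact: nr.
rewrite ler_pXn2r ?nnegrE ?(ltW e_gt0) ?n0 // => hr.
by rewrite sub0r normrN ger0_norm.
Unshelve. all: by end_near.
Qed.

Lemma Hnorm_eq s f A : int1 f -> fhat f 0 = 0 -> sumle (hsum s f) A ->
  ((Hnorm s f ^+ 2)%:E = (2 * pi)%:E * nsum (hsum s f))%E.
Proof.
move=> f1 z sA; have fin : nsum (hsum s f) \is a fin_num.
  rewrite ge0_fin_numE; last by apply: nsum_ge0 => k; exact: hsum_ge0.
  exact: le_lt_trans sA (ltry _).
have p0 : 0 < 2 * pi :> R by rewrite mulr_gt0 ?pi_gt0.
rewrite -(fineK fin) -EFinM; congr EFin; apply/eqP; rewrite eq_le; apply/andP; split.
  by apply: Hnorm_le => //; rewrite /sumle fineK.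
have iH : inHs s f by apply/inHsE; split=> //; exists A.
by have := Hnorm_sum iH; rewrite /sumle -(fineK fin) lee_fin mulrC ler_pdivlMr // mulrC.
Qed.

End Sobolev.

(** * From coefficients to strong solutions *)

Section ComplexDerivative.
Variable R : realType.
Implicit Types (y : R -> R[i]) (t : R).

Lemma is_derive_quot (f : R -> R) t d : is_derive t 1 f d ->
  (fun r => (r - t)^-1 * (f r - f t)) @ t^' --> d.
Proof.
move=> [df <-]; rewrite /derive.
have h1 : h^-1 *: (f (h *: 1 + t) - f t) @[h --> (0 : R)^'] --> lim (h^-1 *: ((f \o shift t) (h *: 1) - f t) @[h --> (0 : R)^']) by exact: df.
have sub0 : (r - t) @[r --> t^'] --> (0 : R)^'.
  move=> A [e /= e0 h]; exists e => //= r; rewrite /ball_ /= => rt rn; apply: h.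
    by rewrite /ball_ /= sub0r opprB.
  by rewrite subr_eq0.
have := cvg_comp _ _ sub0 h1; apply: cvg_trans; apply: near_eq_cvg; apply: nearW => r /=.
by rewrite /GRing.scale /= mulr1 subrK.
Qed.

Lemma cderiv_quot y t d : cderiv y t d ->
  ccont (t^') (fun r => ((r - t)^-1)%:C * (y r - y t)) d.
Proof.
move=> [/is_derive_quot h1 /is_derive_quot h2]; apply: ccont_ReIm.
  apply: cvg_trans h1; apply: near_eq_cvg; apply: nearW => r.
  by rewrite ReM ReD ReN /= mul0r subr0.
apply: cvg_trans h2; apply: near_eq_cvg; apply: nearW => r.
by rewrite ImM ImD ImN /= mul0r addr0.
Qed.

Lemma mvt_real (f df : R -> R) (D : R) (I : set R) : is_interval I ->
  (forall s, I s -> is_derive s 1 f (df s)) -> (forall s, I s -> `|df s| <= D) ->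
  forall r t, I r -> I t -> `|f r - f t| <= D * `|r - t|.
Proof.
move=> Ii dI dD.
have main r t : r <= t -> I r -> I t -> `|f t - f r| <= D * `|t - r|.
  move=> rt Ir It; have sub s : s \in `[r, t] -> I s.
    by rewrite in_itv /= => /andP[a b]; apply: (Ii r t) => //; rewrite a b.
  have [c cI ->] := @MVT_segment R f df r t rt
    (fun s hs => dI s (sub s (subset_itv_oo_cc hs)))
    (derivable_within_continuous (fun s hs => @ex_derive _ _ _ _ _ _ _ (dI s (sub s hs)))).
  by rewrite normrM ler_wpM2r // dD //; exact: sub.
move=> r t Ir It; have [rt|tr] := leP r t; last exact: main (ltW tr) It Ir.
by rewrite distrC (distrC r); exact: main.
Qed.

Lemma mvt_complex y (d : R -> R[i]) (D : R) (I : set R) : is_interval I ->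
  (forall s, I s -> cderiv y s (d s)) -> (forall s, I s -> normc (d s) <= D) ->
  forall r t, I r -> I t -> normc (y r - y t) <= 2 * D * `|r - t|.
Proof.
move=> Ii dI dD r t Ir It; apply: (le_trans (normc_ReIm _)); rewrite ReD ImD ReN ImN.
rewrite -mulrA mulr_natl mulr2n; apply: lerD.
  apply: (@mvt_real (fun s => Re (y s)) (fun s => Re (d s)) D I Ii _ _ r t Ir It) => s Is.
    by case: (dI s Is).
  exact: le_trans (normc_Re _) (dD s Is).
apply: (@mvt_real (fun s => Im (y s)) (fun s => Im (d s)) D I Ii _ _ r t Ir It) => s Is.
  by case: (dI s Is).
exact: le_trans (normc_Im _) (dD s Is).
Qed.

Lemma cderivZ y t d (c : R) : cderiv y t d -> cderiv (fun s => c%:C * y s) t (c%:C * d).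
Proof.
move=> [h1 h2]; split.
  rewrite (_ : (fun s => Re (c%:C * y s)) = (fun s => c * Re (y s))); last by apply/funext => s; rewrite ReM /= mul0r subr0.
  by apply: is_derive_eq; rewrite ReM /= mul0r subr0 /GRing.scale /= ?(mul0r, mulr0, addr0).
rewrite (_ : (fun s => Im (c%:C * y s)) = (fun s => c * Im (y s))); last by apply/funext => s; rewrite ImM /= mul0r addr0.
by apply: is_derive_eq; rewrite ImM /= mul0r addr0 /GRing.scale /= ?(mul0r, mulr0, addr0).
Qed.

End ComplexDerivative.

(** * Strong solutions built from coefficient solutions *)

Section Synthesis.
Variables (R : realType) (eps delta beta : R).
Hypotheses (e0 : 0 < eps) (d0 : 0 < delta) (b0 : 0 <= beta).
Local Notation mu := (@lebesgue_measure R).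

(* The Fourier coefficients of u(t) when q k stands for k^2 u_k. *)
Definition desc (q : int -> R -> R[i]) (t : R) : distr R := fun k => ((k%:~R ^+ 2)^-1)%:C * q k t.
Definition vel (q : int -> R -> R[i]) (t : R) : distr R :=
  fun k => ((k%:~R ^+ 2)^-1)%:C * (Ak eps delta beta k * q k t + quad (sig eps delta beta) (q^~ t) k).

Variables (I : set R) (q : int -> R -> R[i]) (M : int -> R) (S : R).
Hypotheses (M0 : forall k, 0 <= M k) (S0 : 0 <= S) (MS : sumle (fun k => M k ^+ 2) (S ^+ 2))
  (qM : forall k t, I t -> normc (q k t) <= M k)
  (qh : forall k t, I t -> q (- k) t = (q k t)^*)
  (q0 : forall t, I t -> q 0 t = 0)
  (qd : forall k t, I t -> cderiv (q k) t (Ak eps delta beta k * q k t + quad (sig eps delta beta) (q^~ t) k)).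

Let u (t : R) : R -> R := funof (desc q t).

Lemma desc_scale t k : I t -> (k%:~R ^+ 2)%:C * desc q t k = q k t.
Proof.
move=> It; rewrite /desc; have [->|k0] := eqVneq k 0; first by rewrite q0 // !mulr0.
by rewrite mulrA -rmorphM /= divff ?mul1r // expf_neq0 // intr_eq0.
Qed.

Lemma invsqC (f g : int -> R[i]) : (forall k, f (- k) = (f k)^*) ->
  forall k, (((- k)%:~R ^+ 2)^-1)%:C * f (- k) = ((((k)%:~R ^+ 2)^-1 : R)%:C * f k)^*.
Proof.
move=> fh k; rewrite fh rmorphN sqrrN; case: (f k) => x y; apply: complex_ext; rewrite /=; ring.
Qed.

Lemma herm_desc t : I t -> herm (desc q t).
Proof. by move=> It k; apply: (invsqC (f := q^~ t)) => // j; exact: qh. Qed.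

Lemma normc_desc t k : normc (desc q t k) = (k%:~R ^+ 2)^-1 * normc (q k t).
Proof. by rewrite normcM normc_real ger0_norm // invsq_ge0. Qed.

Lemma normc_desc_le t k : normc (desc q t k) <= normc (q k t).
Proof. by rewrite normc_desc -[leRHS]mul1r ler_wpM2r ?normc_ge0 ?invsq_le1. Qed.

Lemma sumle_q t : I t -> sumle (fun k => normc (q k t) ^+ 2) (S ^+ 2).
Proof.
move=> It; apply: (le_sumle _ (lexx _) MS) => k.
by rewrite ler_pXn2r ?nnegrE ?normc_ge0 //; exact: qM.
Qed.

Lemma sumle_desc t : I t -> sumle (fun k => normc (desc q t k) ^+ 2) (S ^+ 2).
Proof.
move=> It; apply: (le_sumle _ (lexx _) (sumle_q It)) => k.
by rewrite ler_pXn2r ?nnegrE ?normc_ge0 // normc_desc_le.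
Qed.

Lemma synthP t : I t -> [/\ int1 (u t), fhat (u t) = desc q t & sq1 (u t)].
Proof. by move=> It; have [? ? ? _] := funofP (herm_desc It) (sumle_desc It). Qed.

Lemma sumle_scaled t : I t -> sumle (fun k => (k%:~R ^+ 2 * normc (desc q t k)) ^+ 2) (S ^+ 2).
Proof.
move=> It; apply: (le_sumle _ (lexx _) (sumle_q It)) => k.
by rewrite -[X in _ <= normc X ^+ 2](desc_scale k It) normcM normc_real (ger0_norm (sqr_ge0 _)).
Qed.

Lemma desc0 t : I t -> desc q t 0 = 0.
Proof. by move=> It; rewrite /desc q0 // mulr0. Qed.

Lemma rhs_vel t k : I t -> rhs eps delta beta (desc q t) k = (2 * eps)%:C * vel q t k.
Proof.
move=> It; have [->|k0] := eqVneq k 0.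
  have -> : rhs eps delta beta (desc q t) 0 = 0.
    by apply: rhs_at0; [exact: herm_desc|exact: desc0|exact: sumle_scaled].
  by rewrite /vel expr0n /= invr0 mul0r mulr0.
have := @rhs_quad R eps delta beta (desc q t) (S ^+ 2) (herm_desc It) (desc0 It) (sumle_scaled It) k.
rewrite desc_scale // (_ : (fun k0 => _) = q^~ t); last by apply/funext => j; rewrite desc_scale.
rewrite /vel => <-.
have k2 : ((k%:~R : R) ^+ 2)^-1 * k%:~R ^+ 2 = 1 by rewrite mulVf // expf_neq0 // intr_eq0.
have e2 : (2 * eps) * (2 * eps)^-1 = 1 by rewrite divff // gt_eqF // mulr_gt0.
transitivity (((2 * eps) * (2 * eps)^-1)%:C * ((k%:~R ^+ 2)^-1 * k%:~R ^+ 2)%:C * rhs eps delta beta (desc q t) k).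
  by rewrite e2 k2 !mul1r.
by rewrite !rmorphM /=; ring.
Qed.

(** The division by k^2 absorbs both the k^2 of [Ak] and the |k| of the kernel: the velocity lies
    two derivatives below H^2, in L^2, again with a majorant uniform in time. *)
Definition velmaj (k : int) : R :=
  (2 * eps)^-1 * (2 + delta + beta) * M k + KK delta beta * conv (ez R) M M k.

Lemma conv_nneg k : 0 <= conv (ez R) M M k.
Proof. by apply: conv_ge0 => //; exact: ez_ge0. Qed.

Lemma velmaj_ge0 k : 0 <= velmaj k.
Proof.
have h1 : 0 <= (2 * eps)^-1 by rewrite invr_ge0 mulr_ge0 // ltW.
have h2 : 0 <= 2 + delta + beta by rewrite !addr_ge0 // ltW.
apply: addr_ge0; apply: mulr_ge0 => //; [exact: mulr_ge0|exact: KK_ge0|exact: conv_nneg].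
Qed.

Lemma quad_maj t k : I t -> normc (quad (sig eps delta beta) (q^~ t) k) <= KK delta beta * `|k%:~R| * conv (ez R) M M k.
Proof.
move=> It; apply: (quad_norm (gam := 4) (S := S)) => //; first exact: ez_ge0.
- by rewrite mulr_ge0 ?KK_ge0.
- exact: sumle_ez.
- by move=> j; exact: sig_bound.
- by move=> j; exact: qM.
Qed.

Lemma vel_maj t k : I t -> normc (vel q t k) <= velmaj k.
Proof.
move=> It; rewrite /vel normcM normc_real ger0_norm ?invsq_ge0 //.
have [->|k0] := eqVneq k 0; first by rewrite expr0n invr0 mul0r velmaj_ge0.
have h1 := normc_Ak e0 d0 b0 k; have h2 := quad_maj k It; have h3 := qM k It.
have x1 := abs_int_ge1 R k0.
have hx : (k%:~R : R) ^+ 2 = `|k%:~R| ^+ 2 by rewrite real_normK ?num_real.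
apply: (@le_trans _ _ ((k%:~R ^+ 2)^-1 * ((2 * eps)^-1 * ((2 + delta + beta) * k%:~R ^+ 2) * M k + KK delta beta * `|k%:~R| * conv (ez R) M M k))).
  rewrite ler_wpM2l ?invsq_ge0 // (le_trans (normcD _ _)) // lerD // normcM ler_pM ?normc_ge0 //.
rewrite hx /velmaj mulrDr lerD //.
  rewrite le_eqVlt; apply/orP; left; apply/eqP; field; rewrite ?gt_eqF //; lra.
rewrite (_ : _ * (KK _ _ * _ * _) = `|k%:~R|^-1 * (KK delta beta * conv (ez R) M M k)); last by field; lra.
by rewrite -[leRHS]mul1r ler_wpM2r ?mulr_ge0 ?KK_ge0 ?conv_nneg // invf_le1 //; lra.
Qed.

Lemma sumle_velmaj : exists B, sumle (fun k => velmaj k ^+ 2) B.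
Proof.
have hc := conv_l2 (@ez_ge0 R) M0 M0 (ler0n _ 4) (@sumle_ez R) MS MS.
set a := (2 * eps)^-1 * (2 + delta + beta); set K := KK delta beta.
exists (2 * a ^+ 2 * S ^+ 2 + 2 * K ^+ 2 * (4 ^+ 2 * (S ^+ 2 * S ^+ 2))).
apply: (@le_sumle _ _ _ (fun k => 2 * a ^+ 2 * M k ^+ 2 + 2 * K ^+ 2 * conv (ez R) M M k ^+ 2)) => [k||].
- rewrite /velmaj -/a -/K; have := sqr_ge0 (a * M k - K * conv (ez R) M M k); nra.
- by [].
have p2 (z : R) : 0 <= 2 * z ^+ 2 by rewrite mulr_ge0 ?sqr_ge0.
apply: sumleD; [by move=> k; rewrite mulr_ge0 ?sqr_ge0 ?p2|by move=> k; rewrite mulr_ge0 ?sqr_ge0 ?p2| |].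
  by apply: sumleZ => // k; exact: sqr_ge0.
by apply: sumleZ => // k; exact: sqr_ge0.
Qed.

Lemma cderiv_desc k t : I t -> cderiv (fun s => desc q s k) t (vel q t k).
Proof. by move=> It; apply: cderivZ; exact: qd. Qed.

Lemma herm_vel t : I t -> herm (vel q t).
Proof.
move=> It k; apply: (invsqC (f := fun k => Ak eps delta beta k * q k t + quad (sig eps delta beta) (q^~ t) k)) => // j.
rewrite Ak_conj qh // /quad.
have [Z _] := csumP (quad_sumle (@ez_ge0 R) (mulr_ge0 (KK_ge0 d0 b0) (normr_ge0 (j%:~R : R))) (@sumle_ez R) (sig_bound e0 d0 b0 j) M0 MS (fun j0 => qM j0 It)).
have := zcvg_conj Z; set f := (fun j0 => _ ^*) => Zc.
rewrite (@csum_eq _ _ (csum (fun j0 => sig eps delta beta j j0 * (q j0 t * q (j - j0) t)))^*).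
  move: (Ak _ _ _ _) (q j t) (csum _) => [x1 x2] [x3 x4] [x5 x6].
  by apply: complex_ext; rewrite /=; ring.
apply: eq_zcvg Zc => i; rewrite /f.
rewrite (_ : sig eps delta beta (- j) i = (sig eps delta beta j (- i))^*); last by rewrite -sig_conj opprK.
rewrite (_ : q i t = (q (- i) t)^*); last by rewrite -qh // opprK.
rewrite (_ : q (- j - i) t = (q (j - - i) t)^*); last by rewrite -qh //; congr (q _ t); ring.
by move: (sig _ _ _ _ _) (q _ t) (q _ t) => [x1 x2] [x3 x4] [x5 x6]; apply: complex_ext; rewrite /=; ring.
Qed.

Hypothesis Ii : is_interval I.

Lemma synth_contHs : contHs I 2 u.
Proof.
split=> [t It|t It].
  have [h1 h2 h3] := synthP It; apply/inHsE; split=> //; first by rewrite h2 desc0.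
  exists (S ^+ 2); apply: (le_sumle _ (lexx _) (sumle_scaled It)) => k.
  by rewrite /hsum lam2 h2.
have [ht fht _] := synthP It.
have diffE r k : I r -> lam 2 k * normc (fhat (u r \- u t) k) = normc (q k r - q k t).
  move=> Ir; have [hr fhr _] := synthP Ir.
  rewrite (fhatB hr ht) fhr fht lam2.
  transitivity (normc ((k%:~R ^+ 2)%:C * (desc q r k - desc q t k))); last by rewrite mulrBr !desc_scale.
  by rewrite [RHS]normcM normc_real (ger0_norm (sqr_ge0 _)).
apply: (@dominated_L2 R _ _ _ (fun r k => normc (q k r - q k t)) (fun k => 2 * M k) (2 ^+ 2 * S ^+ 2)).
- apply: filterS (near_withinT _ _) => r Ir k; rewrite normc_ge0 /=.
  by apply: (le_trans (normcB _ _)); rewrite mulr_natl mulr2n lerD // qM.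
- by move=> k; have := cderiv_ccont (qd k It); exact: cvg_within_filter.
- by move=> k; rewrite mulr_ge0.
- under eq_fun do rewrite exprMn; apply: sumleZ => //; by move=> k; exact: sqr_ge0.
- by move=> r; exact: Hnorm_ge0.
- apply: filterS (near_withinT _ _) => r Ir A sA; apply: Hnorm_le.
    by have [hr _ _] := synthP Ir; exact: int1B.
  by apply: (le_sumle _ (lexx _) sA) => k; rewrite /hsum diffE.
Qed.

Lemma synth_time_deriv t : I t -> is_time_deriv I u t (funof (vel q t)) /\ fhat (funof (vel q t)) = vel q t.
Proof.
move=> It; have [B sB] := sumle_velmaj.
have sv : sumle (fun k => normc (vel q t k) ^+ 2) B.
  apply: (le_sumle _ (lexx _) sB) => k.
  by rewrite ler_pXn2r ?nnegrE ?normc_ge0 ?velmaj_ge0 // vel_maj.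
have [v1 vE v2 _] := funofP (herm_vel It) sv; split=> //; split; first exact/inLp2P.
have [ht fht _] := synthP It.
pose h r k := normc (((r - t)^-1)%:C * (desc q r k - desc q t k) - vel q t k).
(* The mean value theorem on real and imaginary parts bounds the difference quotient by 2
   [velmaj k]; the derivative itself adds one more. *)
apply: (@dominated_L2 R _ _ _ h (fun k => 3 * velmaj k) (3 ^+ 2 * B)).
- have n1 : \forall r \near within I t^', I r by exact: near_withinT.
  have n2 : \forall r \near within I t^', r != t by apply: (@filterE _ (nbhs t)) => r rt _; exact: rt.
  apply: filterS2 n1 n2 => r Ir rt k; rewrite normc_ge0 /=; apply: (le_trans (normcB _ _)).
  rewrite (_ : 3 * _ = 2 * velmaj k + velmaj k); last by ring.
  apply: lerD; last exact: vel_maj.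
  rewrite normcM normc_real normfV ler_pdivrMl ?normr_gt0 ?subr_eq0 // mulrC.
  exact: (@mvt_complex R (fun s => desc q s k) (fun s => vel q s k) (velmaj k) I Ii (fun s => @cderiv_desc k s) (fun s => @vel_maj s k)).
- move=> k; have := cderiv_quot (cderiv_desc k It); exact: cvg_within_filter.
- by move=> k; rewrite mulr_ge0 ?velmaj_ge0.
- under eq_fun do rewrite exprMn; apply: sumleZ => //; by move=> k; exact: sqr_ge0.
- by move=> r; exact: L2norm_ge0.
- apply: filterS (near_withinT _ _) => r Ir A sA; have [hr fhr _] := synthP Ir.
  apply: L2norm_le; first exact: int1B (int1Z _ (int1B hr ht)) v1.
  apply: (le_sumle _ (lexx _) sA) => k.
  by rewrite (fhatB (int1Z _ (int1B hr ht)) v1) (fhatZ _ (int1B hr ht)) (fhatB hr ht) fhr fht vE.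
Qed.

Lemma synth_eq t : I t -> (2 * eps)%:C *: fhat (funof (vel q t)) = rhs eps delta beta (fhat (u t)).
Proof.
move=> It; have [_ ->] := synth_time_deriv It; have [_ -> _] := synthP It.
by apply/funext => k; rewrite rhs_vel.
Qed.

(** The norm is identified exactly, not just bounded, because its measurability in time is inherited
    from the series. *)
Lemma synth_inHs3 t A : I t -> sumle (fun k => (`|k%:~R| * normc (q k t)) ^+ 2) A ->
  inHs 3 (u t) /\ (Hnorm 3 (u t) ^+ 2)%:E = ((2 * pi)%:E * nsum (fun k => ((`|k%:~R| * normc (q k t)) ^+ 2)%R))%E.
Proof.
move=> It sA; have [h1 h2 h3] := synthP It.
have hE : hsum 3 (u t) = (fun k => (`|k%:~R| * normc (q k t)) ^+ 2).
  apply/funext => k; rewrite /hsum lam3 h2 -(desc_scale k It) [in RHS]normcM normc_real.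
  by rewrite (@ger0_norm _ (k%:~R ^+ 2)) ?sqr_ge0 // [in RHS]mulrA.
have h0 : fhat (u t) 0 = 0 by rewrite h2 desc0.
split; last by rewrite -hE; apply: (Hnorm_eq (A := A)) => //; rewrite hE.
by apply/inHsE; split=> //; exists A; rewrite hE.
Qed.

End Synthesis.

(** * Integrability in time of sums over modes *)

Section SumIntegrable.
Variable R : realType.
Local Notation mu := (@lebesgue_measure R).

Lemma nsum_limit (f : int -> R) A : (forall k, 0 <= f k) -> sumle f A ->
  (fun n => (\sum_(k <- zrange n) f k)%:E) @ \oo --> nsum f.
Proof.
move=> f0 fA; have : sumle (fun k => `|f k|) A by apply: (le_sumle _ (lexx _) fA) => k; rewrite ger0_norm.
move/zsum_cvg => fl; set L := limn (fun n => \sum_(k <- zrange n) f k) in fl.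
have nd : nondecreasing_seq (fun n => \sum_(k <- zrange n) f k).
  by move=> m n mn; apply: zrange_le.
have -> : nsum f = L%:E.
  apply/eqP; rewrite eq_le; apply/andP; split.
    apply: sumle_zrange => // n; exact: nondecreasing_cvgn_le.
  have fin : nsum f \is a fin_num.
    rewrite ge0_fin_numE; last exact: nsum_ge0.
    exact: le_lt_trans fA (ltry _).
  rewrite -(fineK fin) lee_fin; apply: limr_le => //; apply: nearW => n.
  by rewrite -lee_fin (fineK fin); exact: nsum_lb (zrange_uniq n).
by apply: cvg_EFin; [exact: nearW|exact: fl].
Qed.

(** Monotone convergence along symmetric partial sums gives the measurability of [G] and the bound
    on its integral together. *)
Lemma sum_integrable (D : set R) (F : int -> R -> R) (G : R -> R) (c B : R) :
  measurable D -> (forall k t, D t -> 0 <= F k t) -> (forall k, measurable_fun D (F k)) ->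
  0 <= c -> (forall t, D t -> exists A, sumle (F^~ t) A) ->
  (forall t, D t -> (G t)%:E = (c%:E * nsum (F^~ t))%E) ->
  (forall n, (\int[mu]_(t in D) (\sum_(k <- zrange n) F k t)%:E <= B%:E)%E) ->
  mu.-integrable D (EFin \o G).
Proof.
move=> mD F0 mF c0 FA GE FB.
pose h n t := (c%:E * (\sum_(k <- zrange n) F k t)%:E)%E.
have mS n : measurable_fun D (fun t => \sum_(k <- zrange n) F k t) by exact: measurable_sum.
have mh n : measurable_fun D (h n).
  by apply: measurable_funeM; apply/measurable_EFinP.
have hG t : D t -> h n t @[n --> \oo] --> (G t)%:E.
  move=> Dt; rewrite GE //; have [A sA] := FA t Dt.
  by apply: cvgeZl => //; apply: nsum_limit sA => k; exact: F0.
have h0 n t : D t -> (0 <= h n t)%E.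
  by move=> Dt; rewrite mule_ge0 // lee_fin ?sumr_ge0 // => k _; exact: F0.
have nd t : D t -> {homo h^~ t : n m / (n <= m)%N >-> (n <= m)%E}.
  move=> Dt m n mn; rewrite /h lee_wpmul2l ?lee_fin //; apply: zrange_le => // k; exact: F0.
have := @cvg_monotone_convergence _ _ _ mu D mD h mh h0 nd.
rewrite (@eq_integral _ _ _ mu D (EFin \o G)); last first.
  by move=> t; rewrite inE => Dt; apply/cvg_lim => //; exact: hG.
move=> cv; have mG : measurable_fun D (EFin \o G) by apply: (emeasurable_fun_cvg h) => // t Dt; exact: hG.
have le : (\int[mu]_(t in D) (EFin \o G) t <= (c * B)%:E)%E.
  rewrite -(cvg_lim _ cv) //; apply: lime_le; first by apply/cvg_ex; eexists; exact: cv.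
  apply: nearW => n; rewrite ge0_integralZl //.
  - by rewrite EFinM lee_wpmul2l ?lee_fin.
  - by apply/measurable_EFinP; exact: mS.
  - by move=> t Dt; rewrite lee_fin sumr_ge0 // => k _; exact: F0.
apply/integrableP; split => //.
rewrite (@eq_integral _ _ _ mu D (EFin \o G)); first exact: le_lt_trans le (ltry _).
move=> t; rewrite inE => Dt /=; rewrite ger0_norm // -lee_fin GE // mule_ge0 // ?lee_fin //.
by apply: nsum_ge0 => k; exact: F0.
Qed.

(** The time profiles r e^(-r t) are exponential densities, of mass 1 on the half line whatever the
    rate r, so that no power of k is left after integration. *)
Lemma integral_pdf_sum (D : set R) (al be lk : int -> R) (m : R) (s : seq int) : measurable D ->
  (forall k, 0 <= al k) -> (forall k, 0 <= be k) -> (forall k, 0 < lk k) -> 0 < m ->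
  (\int[mu]_(t in D) (\sum_(k <- s) (al k * exponential_pdf (lk k) t + be k * exponential_pdf m t))%:E
   <= (\sum_(k <- s) (al k + be k))%:E)%E.
Proof.
move=> mD a0 b0 l0 m0.
have p0 r (t : R) : 0 < r -> 0 <= exponential_pdf r t by move=> /ltW r0; exact: (exponential_pdf_ge0 r0 t).
have mp r : 0 < r -> measurable_fun [set: R] (exponential_pdf r) by move=> r0; exact: measurable_exponential_pdf.
have mt k : measurable_fun [set: R] (fun t => al k * exponential_pdf (lk k) t + be k * exponential_pdf m t).
  by apply: measurable_funD; apply: measurable_funM => //; exact: mp.
have t0 k t : 0 <= al k * exponential_pdf (lk k) t + be k * exponential_pdf m t.
  by rewrite addr_ge0 // mulr_ge0 ?p0.
apply: (@le_trans _ _ (\int[mu]_t (\sum_(k <- s) (al k * exponential_pdf (lk k) t + be k * exponential_pdf m t))%:E)%E).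
  apply: ge0_subset_integral => //.
    by apply/measurable_EFinP; exact: measurable_sum.
  by move=> t _; rewrite lee_fin sumr_ge0.
under eq_integral do rewrite -sumEFin.
rewrite ge0_integral_sum //; last 2 first.
- by move=> k; apply/measurable_EFinP; exact: mt.
- by move=> k t _; rewrite lee_fin.
rewrite -sumEFin; apply: lee_sum => k _.
under eq_integral do rewrite EFinD !EFinM.
rewrite ge0_integralD //; last 4 first.
- by move=> t _; rewrite -EFinM lee_fin mulr_ge0 ?p0.
- by apply: measurable_funeM; apply/measurable_EFinP; exact: mp.
- by move=> t _; rewrite -EFinM lee_fin mulr_ge0 ?p0.
- by apply: measurable_funeM; apply/measurable_EFinP; exact: mp.
rewrite !ge0_integralZl //; last 6 first.
- by apply/measurable_EFinP; exact: mp.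
- by move=> t _; rewrite lee_fin p0.
- by rewrite lee_fin.
- by apply/measurable_EFinP; exact: mp.
- by move=> t _; rewrite lee_fin p0.
- by rewrite lee_fin.
by rewrite !integral_exponential_pdf // !mule1.
Qed.

Lemma integrable_setD1 (D : set R) (f : R -> R) (a : R) : measurable D -> 
  mu.-integrable (D `\` [set a]) (EFin \o f) -> mu.-integrable D (EFin \o f).
Proof.
move=> mD h; have mf : measurable_fun D (EFin \o f).
  have : measurable_fun ((D `\` [set a]) `|` (D `&` [set a])) (EFin \o f).
    apply/measurable_funU; [exact: measurableD|exact: measurableI|split].
      by case/integrableP: h.
    apply: measurable_funS (@measurable_fun_set1 _ _ _ _ a _) => //.
  by rewrite setUC setUIDK.
apply: (proj2 (@negligible_integrable _ _ R mu D [set a] _ _ mD mf _)) => //; exact: lebesgue_measure_set1.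
Qed.

(** Parabolic smoothing, from 1 + z <= e^z: it bounds the profiles at a fixed t > 0 uniformly in the
    rate, so that the H^3 sum is finite there. *)
Lemma expR_mulN (x t : R) : 0 < t -> 0 < x -> x * expR (- x * t) <= t^-1.
Proof.
move=> t0 x0; rewrite -[t^-1]mul1r ler_pdivlMr // mulrAC -ler_pdivlMr ?expR_gt0 //.
by rewrite div1r -expRN mulNr opprK; apply: le_trans (expR_ge1Dx _); lra.
Qed.

End SumIntegrable.

(** * Square integrability with values in H^3 *)

Section SqIntegrable.
Variables (R : realType) (eps delta beta : R).
Hypotheses (e0 : 0 < eps) (d0 : 0 < delta) (b0 : 0 <= beta).
Local Notation mu := (@lebesgue_measure R).
Variables (I : set R) (q : int -> R -> R[i]) (M : int -> R) (S : R).
Hypotheses (M0 : forall k, 0 <= M k) (S0 : 0 <= S) (MS : sumle (fun k => M k ^+ 2) (S ^+ 2))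
  (qM : forall k t, I t -> normc (q k t) <= M k)
  (qh : forall k t, I t -> q (- k) t = (q k t)^*)
  (q0 : forall t, I t -> q 0 t = 0)
  (qd : forall k t, I t -> cderiv (q k) t (Ak eps delta beta k * q k t + quad (sig eps delta beta) (q^~ t) k)).
Variables (al be lk : int -> R) (m A B : R).
Hypotheses (mI : measurable I) (I0 : forall t, I t -> 0 <= t)
  (a0 : forall k, 0 <= al k) (be0 : forall k, 0 <= be k) (l0 : forall k, 0 < lk k) (m0 : 0 < m)
  (sA : sumle al A) (sB : sumle be B)
  (bnd : forall k t, I t -> (`|k%:~R| * normc (q k t)) ^+ 2 <=
     al k * (lk k * expR (- lk k * t)) + be k * (m * expR (- m * t))).

(** Initial data in H^2 need not lie in H^3, so t = 0 is removed as a null set. For t > 0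
    [expR_mulN] makes the sum finite, and over time the two exponential profiles in [bnd] integrate
    to at most A + B. *)
Lemma synth_sqintHs : sqintHs I 3 (fun t => funof (desc q t)).
Proof.
have fin t : I t -> 0 < t -> exists C, sumle (fun k => (`|k%:~R| * normc (q k t)) ^+ 2) C.
  move=> It t0; exists (t^-1 * A + m * B).
  apply: (@le_sumle _ _ _ (fun k => t^-1 * al k + m * be k)) => [k||].
  - apply: (le_trans (bnd k It)); apply: lerD; rewrite mulrC ler_wpM2r //; first exact: expR_mulN.
    by rewrite -[leRHS]mulr1 ler_wpM2l ?(ltW m0) // -expR0 ler_expR mulNr oppr_le0 mulr_ge0 // ltW.
  - by [].
  have t1 : 0 <= t^-1 by rewrite invr_ge0 ltW.
  by apply: sumleD; [move=> k; exact: mulr_ge0|move=> k; apply: mulr_ge0 => //; exact: ltW|exact: sumleZ|apply: sumleZ => //; exact: ltW].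
have h3 t C It sC := @synth_inHs3 R I q M S M0 MS qM qh q0 t C It sC.
have pos t : (I `\` [set 0]) t -> 0 < t.
  by move=> [It tn0]; rewrite lt_def I0 // andbT; apply/eqP.
split.
  exists [set 0]; split => //; first exact: lebesgue_measure_set1.
  move=> t /= nt; apply: contrapT => /eqP t0; apply: nt => It.
  have [C sC] := fin t It (pos t (conj It (elimN eqP t0))).
  by have [] := h3 t C It sC.
apply: (@integrable_setD1 R I _ 0) => //.
have mF k : measurable_fun (I `\` [set 0]) (fun t => (`|k%:~R| * normc (q k t)) ^+ 2).
  apply: measurable_funS mI _ _; first exact: subDsetl.
  apply: subspace_continuous_measurable_fun => //; apply: continuous_in_subspaceT => t; rewrite inE => It.
  have h := cderiv_ccont (qd k It); 
  have hr : (fun s => Re (q k s)) @ t --> Re (q k t) by exact: ccont_Re.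
  have hi : (fun s => Im (q k s)) @ t --> Im (q k t) by exact: ccont_Im.
  have E s : (`|k%:~R| * normc (q k s)) ^+ 2 = (`|k%:~R| ^+ 2) * (Re (q k s) * Re (q k s) + Im (q k s) * Im (q k s)).
    by rewrite exprMn normc_sqr !expr2.
  rewrite /continuous_at (funext E) E.
  exact: cvgM (cvg_cst _) (cvgD (cvgM hr hr) (cvgM hi hi)).
have p0 r (t : R) : 0 < r -> 0 <= exponential_pdf r t by move=> /ltW r0; exact: (exponential_pdf_ge0 r0 t).
have mp r : 0 < r -> measurable_fun [set: R] (exponential_pdf r) by move=> r0; exact: measurable_exponential_pdf.
apply: (@sum_integrable R _ (fun k t => (`|k%:~R| * normc (q k t)) ^+ 2) _ (2 * pi) (A + B)).
- exact: measurableD.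
- by move=> k t _; exact: sqr_ge0.
- exact: mF.
- by rewrite mulr_ge0 // pi_ge0.
- by move=> t It; apply: fin (pos t It); case: It.
- by move=> t It; have [C sC] := fin t (proj1 It) (pos t It); have [_ ->] := h3 t C (proj1 It) sC.
move=> n; apply: le_trans (le_trans (integral_pdf_sum (zrange n) (measurableD mI (measurable_set1 0)) a0 be0 l0 m0) _); last first.
  rewrite lee_fin; apply: (@sumle_lb _ _ (fun k => al k + be k)); [by move=> k; rewrite addr_ge0|exact: sumleD|exact: zrange_uniq].
apply: ge0_le_integral => //.
- exact: measurableD.
- by move=> t _; rewrite lee_fin sumr_ge0 // => k _; exact: sqr_ge0.
- by apply/measurable_EFinP; apply: measurable_sum => k; exact: mF.
- apply: measurable_funTS; apply/measurable_EFinP; apply: measurable_sum => k.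
  by apply: measurable_funD; apply: measurable_funM => //; exact: mp.
- move=> t It; rewrite lee_fin; apply: ler_sum => k _; have It' := proj1 It.
  by rewrite !exponential_pdfE ?I0 //; exact: bnd.
Qed.

End SqIntegrable.

(** * Conjugation and scaling of the quadratic term *)

Section QuadAlgebra.
Variable R : realType.
Implicit Types (sg : int -> int -> R[i]) (p : int -> R[i]) (e : int -> int -> R) (M : int -> R).

Lemma quad_zcvg sg e M S c p k :
  (forall k j, 0 <= e k j) -> 0 <= c -> (forall k, sumle (fun j => e k j ^+ 2) (4 ^+ 2)) ->
  (forall j, normc (sg k j) <= c * e k j) -> (forall j, 0 <= M j) ->
  sumle (fun j => M j ^+ 2) (S ^+ 2) -> (forall j, normc (p j) <= M j) ->
  zcvg (fun j => sg k j * (p j * p (k - j))) (quad sg p k).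
Proof.
by move=> e0 c0 eg sge M0 MS pM; have [] := csumP (quad_sumle e0 c0 eg sge M0 MS pM).
Qed.

Lemma quad_conj sg p k : (forall k j, sg (- k) (- j) = (sg k j)^*) ->
  zcvg (fun j => sg (- k) j * (p j * p (- k - j))) (quad sg p (- k)) ->
  quad sg (fun j => (p (- j))^*) k = (quad sg p (- k))^*.
Proof.
move=> sgc /zcvg_conj Z; apply: csum_eq; apply: eq_zcvg Z => j.
have -> : - (k - j) = - k - - j by ring.
have := sgc k j; case: (sg k j) => x1 x2; case: (p (- j)) => x3 x4; case: (p (- k - - j)) => x5 x6 ->.
by apply: complex_ext; rewrite /=; ring.
Qed.

Lemma quad_scale sg sg' p (c d : R[i]) k : (forall j, sg' k j = d * sg k j) ->
  zcvg (fun j => sg k j * (p j * p (k - j))) (quad sg p k) ->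
  quad sg' (fun j => c * p j) k = d * c ^+ 2 * quad sg p k.
Proof.
move=> E Z; apply: csum_eq; apply: eq_zcvg (zcvgZ (d * c ^+ 2) Z) => j.
by rewrite E expr2; ring.
Qed.

Lemma quad_eq0 sg p k : (forall j, sg k j = 0) -> quad sg p k = 0.
Proof.
move=> sg0; apply: csum_eq; rewrite /zcvg; apply: cvg_near_cst; apply: nearW => n.
by rewrite big1 ?subr0 ?normc_0 // => j _; rewrite sg0 mul0r.
Qed.

Lemma cderiv_conj (y : R -> R[i]) t d : cderiv y t d -> cderiv (fun s => (y s)^*) t d^*.
Proof.
move=> [h1 h2]; split.
  rewrite (_ : (fun s => Re (y s)^*) = (fun s => Re (y s))); last by apply/funext => s; case: (y s).
  by case: d h1 h2.
rewrite (_ : (fun s => Im (y s)^*) = (fun s => - Im (y s))); last by apply/funext => s; case: (y s).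
by apply: is_derive_eq; case: d h1 h2.
Qed.

Lemma cderivM_real (r : R -> R) (y : R -> R[i]) (t : R) (dr : R) d : is_derive t 1 r dr -> cderiv y t d ->
  cderiv (fun s => (r s)%:C * y s) t (dr%:C * y t + (r t)%:C * d).
Proof.
move=> hr [h1 h2]; split.
  rewrite (_ : (fun s => Re ((r s)%:C * y s)) = (fun s => r s * Re (y s))); last by apply/funext => s; rewrite ReM /= mul0r subr0.
  by apply: is_derive_eq; rewrite ReD !ReM /= !mul0r !subr0 /GRing.scale /=; ring.
rewrite (_ : (fun s => Im ((r s)%:C * y s)) = (fun s => r s * Im (y s))); last by apply/funext => s; rewrite ImM /= mul0r addr0.
by apply: is_derive_eq; rewrite ImD !ImM /= !mul0r !addr0 /GRing.scale /=; ring.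
Qed.

End QuadAlgebra.

(** * Coefficient solutions, small data and short times at once *)

Section CoefficientExistence.
Variables (R : realType) (eps delta beta : R).
Hypotheses (e0 : 0 < eps) (d0 : 0 < delta) (b0 : 0 <= beta).
Variables (I : set R) (kappa : R -> R) (eta Th mu0 g c1 S0 : R) (f0 : int -> R[i]).
Hypotheses (I0 : I 0) (Ige0 : forall t, I t -> 0 <= t) (Ii : is_interval I)
  (ckappa : continuous kappa) (kappaI : forall t, I (kappa t)) (kappaK : forall t, I t -> kappa t = t)
  (mu00 : 0 < mu0) (hTh : forall t, I t -> expR (- eta * t) <= Th * expR (- mu0 * t))
  (c10 : 0 < c1) (hc : forall k, k != 0 -> c1 * k%:~R ^+ 2 <= - Re (Ak eps delta beta k) - eta)
  (g0 : 0 <= g)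
  (hg : forall k, k != 0 -> Th * (KK delta beta * `|k%:~R|) <= (- Re (Ak eps delta beta k) - eta) * g)
  (hf : herm f0) (f00 : f0 0 = 0) (S00 : 0 <= S0) (fS : sumle (fun k => normc (f0 k) ^+ 2) (S0 ^+ 2))
  (small : 64 * g * S0 <= 1).
Local Notation Ak := (Ak eps delta beta).
Local Notation sig := (sig eps delta beta).
Local Notation KK := (KK delta beta).

(* Factoring expR (- eta * t) out of the unknown shifts the linear coefficients
   by eta. The value at k = 0, a mode that stays 0, only has to be negative. *)
Let a k : R[i] := if k == 0 then -1 else Ak k + eta%:C.
(** With the unknown e^(- eta t) p the quadratic term keeps one factor e^(- eta t), at most [Th] on
    I. Dividing by [Th] puts [theta] in [0, 1]; the factor is returned to the kernel here. *)
Let sg k j : R[i] := Th%:C * sig k j.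
Let theta t : R := expR (- eta * t) / Th.
Let e k j : R := g * ez R k j.

Lemma Th_ge1 : 1 <= Th.
Proof. by have := hTh I0; rewrite !mulr0 expR0 mulr1. Qed.

Let Th0 : 0 < Th. Proof. exact: lt_le_trans ltr01 Th_ge1. Qed.

Let int2_gt0 k : k != 0 -> 0 < (k%:~R : R) ^+ 2.
Proof. by move=> k0; rewrite (lt_le_trans ltr01) // int_sqr_ge1. Qed.

Let Re_a k : k != 0 -> - Re (a k) = - Re (Ak k) - eta.
Proof. by move=> k0; rewrite /a (negbTE k0) ReD opprD. Qed.

Let a_neg k : Re (a k) < 0.
Proof.
have [->|k0] := eqVneq k 0; first by rewrite /a /= oppr_lt0.
rewrite -oppr_gt0 Re_a //; apply: lt_le_trans (hc k0); rewrite mulr_gt0 ?int2_gt0 //.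
Qed.

Let sgb k j : normc (sg k j) <= - Re (a k) * e k j.
Proof.
have [->|k0] := eqVneq k 0.
  by rewrite /sg sig0 mulr0 normc_0 mulr_ge0 ?mulr_ge0 ?ez_ge0 // oppr_ge0 ltW.
rewrite Re_a // normcM normc_real gtr0_norm // mulrA.
apply: (le_trans (ler_wpM2l (ltW Th0) (sig_bound e0 d0 b0 k j))).
by rewrite mulrA ler_wpM2r ?ez_ge0 // hg.
Qed.

Let e_ge0 k j : 0 <= e k j. Proof. by rewrite mulr_ge0 ?ez_ge0. Qed.

Let gam0 : 0 <= 4 * g. Proof. by rewrite mulr_ge0. Qed.

Let e_sum k : sumle (fun j => e k j ^+ 2) ((4 * g) ^+ 2).
Proof.
rewrite exprMn mulrC /e; under eq_fun do rewrite exprMn.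
by apply: sumleZ; [move=> j; exact: sqr_ge0|exact: sqr_ge0|exact: sumle_ez].
Qed.

Let exp_mu t : I t -> expR (- mu0 * t) <= 1.
Proof. by move=> It; rewrite -expR0 ler_expR mulNr oppr_le0 mulr_ge0 ?(Ige0 It) ?(ltW mu00). Qed.

Let theta01 t : I t -> 0 <= theta t <= 1.
Proof.
move=> It; rewrite divr_ge0 ?expR_ge0 ?(ltW Th0) //= ler_pdivrMr // mul1r.
by apply: le_trans (hTh It) _; rewrite -[leRHS]mulr1 ler_wpM2l ?(ltW Th0) ?exp_mu.
Qed.

Let ctheta : continuous theta.
Proof.
move=> t; apply: cvgM; last exact: cvg_cst.
exact: (@continuous_expRM R (- eta)).
Qed.

Let a_conj k : a (- k) = (a k)^*.
Proof.
rewrite /a oppr_eq0; case: ifP => _; first by apply: complex_ext; rewrite /= ?oppr0.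
by rewrite Ak_conj; case: (Ak k) => x y; apply: complex_ext; rewrite /=; ring.
Qed.

Let sg_conj k j : sg (- k) (- j) = (sg k j)^*.
Proof. by rewrite /sg sig_conj; case: (sig k j) => x y; apply: complex_ext; rewrite /=; ring. Qed.

(** The parameters cover two regimes: eta = mu0 = nu and Th = 1 on the half line, eta = - rho, mu0 =
    rho and Th = e^2 on [0, 1 / rho]. The last group of conclusions prepares the integrability in
    H^3. *)
Theorem coef_exists : exists (q : int -> R -> R[i]) (M : int -> R) (al be lk : int -> R) (m A B : R),
  [/\ (forall k, 0 <= M k) /\ sumle (fun k => M k ^+ 2) ((2 * S0) ^+ 2),
      forall k t, I t -> normc (q k t) <= Th * expR (- mu0 * t) * M k,
      (forall k t, I t -> q (- k) t = (q k t)^*) /\ (forall t, I t -> q 0 t = 0),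
      (forall k, q k 0 = f0 k) /\ (forall k t, I t -> cderiv (q k) t (Ak k * q k t + quad sig (q^~ t) k)) &
      [/\ (forall k, 0 <= al k), (forall k, 0 <= be k), (forall k, 0 < lk k), 0 < m &
        [/\ sumle al A, sumle be B & forall k t, I t -> (`|k%:~R| * normc (q k t)) ^+ 2 <=
          al k * (lk k * expR (- lk k * t)) + be k * (m * expR (- m * t))]]].
Proof.
have small1 : 8 * (4 * g) * S0 <= 1.
  by have : 0 <= g * S0 by [exact: mulr_ge0]; move: small; nra.
have [p [N [N0 NS pN p0 pd]]] := picard a_neg sgb e_ge0 gam0 e_sum ctheta theta01 ckappa kappaI kappaK Ige0 S00 fS small1.
have sub t s : I t -> 0 <= s <= t -> I s by move=> It h; exact: (Ii I0 It).
have contRe k t : I t -> {within `[0, t], continuous (fun s => Re (p k s))}.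
  move=> It; apply: derivable_within_continuous => s; rewrite in_itv /= => hs.
  by have [h _] := pd k s (sub t s It hs); exact: ex_derive.
have contIm k t : I t -> {within `[0, t], continuous (fun s => Im (p k s))}.
  move=> It; apply: derivable_within_continuous => s; rewrite in_itv /= => hs.
  by have [_ h] := pd k s (sub t s It hs); exact: ex_derive.
have sgT k j : normc (sg k j) <= Th * (KK * `|k%:~R|) * ez R k j.
  rewrite normcM normc_real gtr0_norm // -mulrA; apply: ler_wpM2l; first exact: ltW.
  exact: sig_bound.
have TK0 k : 0 <= Th * (KK * `|k%:~R|) by rewrite mulr_ge0 ?(ltW Th0) // mulr_ge0 ?KK_ge0.
have KK0 k : 0 <= KK * `|k%:~R| by rewrite mulr_ge0 ?KK_ge0.
have Zs k t : I t -> zcvg (fun j => sg k j * (p j t * p (k - j) t)) (quad sg (p^~ t) k).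
  by move=> It; apply: (quad_zcvg (e := ez R) (M := N) (S := 2 * S0) (c := Th * (KK * `|k%:~R|))) => //; [exact: ez_ge0|exact: sumle_ez|move=> j; exact: pN].
have Zi k t : I t -> zcvg (fun j => sig k j * (p j t * p (k - j) t)) (quad sig (p^~ t) k).
  by move=> It; apply: (quad_zcvg (e := ez R) (M := N) (S := 2 * S0) (c := KK * `|k%:~R|)) => //; [exact: ez_ge0|exact: sumle_ez|move=> j; exact: sig_bound|move=> j; exact: pN].
(* Reality of u is recovered by uniqueness: the reflected conjugate of p solves the same system with
   the same data. *)
have ph k t : I t -> p k t = (p (- k) t)^*.
  move=> It; pose M j := N j + N (- j).
  have NS' : sumle (fun j => N (- j) ^+ 2) ((2 * S0) ^+ 2).
    exact: (@sumle_inj R int int (fun j => N j ^+ 2) (fun j => - j) _ (fun j => sqr_ge0 _) (@oppr_inj int) NS).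
  have MS : sumle (fun j => M j ^+ 2) ((4 * S0) ^+ 2).
    have -> : (4 * S0) ^+ 2 = 2 * ((2 * S0) ^+ 2 + (2 * S0) ^+ 2) by ring.
    apply: (@le_sumle _ _ _ (fun j => 2 * (N j ^+ 2 + N (- j) ^+ 2)) _ _ _ (lexx _)) => [j|].
      by rewrite /M; have := sqr_ge0 (N j - N (- j)); nra.
    apply: sumleZ => [j||]; [by rewrite addr_ge0 ?sqr_ge0|by []|].
    by apply: sumleD => // j; exact: sqr_ge0.
  (* Here the 64 of [small] is used up: gam is 4 g, and the majorant common to p and its reflection
     has norm 4 S0 rather than 2 S0. *)
  have small2 : 4 * (4 * g) * (4 * S0) <= 1 by move: small; lra.
  apply: (@ode_unique R a sg e (4 * g) (4 * S0) t 0 theta p (fun j s => (p (- j) s)^*) M) => //.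
  - by move=> j; rewrite sub0r oppr_gt0.
  - by move=> i j; rewrite sub0r.
  - by move=> s hs; apply: theta01; exact: sub It hs.
  - by move=> j; rewrite addr_ge0.
  - by rewrite mulr_ge0.
  - split=> [j s hs|j|j|j s hs]; [|exact: contRe|exact: contIm|].
      by apply: (le_trans (pN j s (sub t s It hs))); rewrite lerDl.
    by apply: pd; apply: sub It _; case/andP: hs => h1 h2; rewrite !ltW.
  - split=> [j s hs|j|j|j s hs].
    + by rewrite normc_conj; apply: (le_trans (pN (- j) s (sub t s It hs))); rewrite lerDr.
    + rewrite (_ : (fun s => _) = (fun s => Re (p (- j) s))); last by apply/funext => s; case: (p _ s).
      exact: contRe.
    + rewrite (_ : (fun s => _) = (fun s => - Im (p (- j) s))); last by apply/funext => s; case: (p _ s).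
      move=> x; apply: cvgN; exact: contIm.
    + have Is : I s by apply: sub It _; case/andP: hs => h1 h2; rewrite !ltW.
      have := cderiv_conj (pd (- j) s Is).
      rewrite a_conj (quad_conj sg_conj (Zs (- j) s Is)).
      by move: (a j) (p (- j) s) (quad sg _ (- j)) => [x1 x2] [x3 x4] [x5 x6]; rewrite (_ : (_ + _)^* = (x1 +i* x2) * (x3 +i* x4)^* + (theta s)%:C * (x5 +i* x6)^*) //; apply: complex_ext; rewrite /=; ring.
  - by move=> j; rewrite !p0 hf; case: (f0 j) => x y; apply: complex_ext; rewrite /=; ring.
  - by rewrite Ige0 ?lexx.
have q0z s : quad sg (p^~ s) 0 = 0 by apply: quad_eq0 => j; rewrite /sg sig0 mulr0.
have pz t : I t -> p 0 t = 0.
  move=> It; apply: normc_eq0; apply/eqP; rewrite eq_le normc_ge0 andbT.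
  have := @duhamel_bound R (a 0) (p 0) (fun=> 0) t 0 0 (Ige0 It) _ (contRe 0 t It) (contIm 0 t It).
  rewrite p0 f00 normc_0 mulr0 !mul0r addr0; apply.
  - move=> s hs; have := pd 0 s; rewrite q0z mulr0; apply; apply: sub It _.
    by case/andP: hs => h1 h2; rewrite !ltW.
  - by move=> s _; rewrite mul0r.
  - by rewrite sub0r oppr_gt0.
pose E t : R := expR (- eta * t).
have dE (t : R) : is_derive t 1 E (- eta * E t).
  by apply: is_derive_eq; rewrite /E /GRing.scale /=; ring.
pose q k t := (E t)%:C * p k t.
have qM k t : I t -> normc (q k t) <= Th * expR (- mu0 * t) * N k.
  move=> It; rewrite normcM normc_real ger0_norm ?expR_ge0 // ler_pM ?expR_ge0 ?normc_ge0 ?hTh //; exact: pN.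
have qd k t : I t -> cderiv (q k) t (Ak k * q k t + quad sig (q^~ t) k).
  move=> It; have := cderivM_real (dE t) (pd k t It).
  have -> : quad sig (q^~ t) k = 1 * (E t)%:C ^+ 2 * quad sig (p^~ t) k.
    by apply: (quad_scale (sg := sig)) => [j|]; [rewrite mul1r|exact: Zi].
  have [->|k0] := eqVneq k 0.
    have -> : quad sig (p^~ t) 0 = 0 by apply: quad_eq0 => j; rewrite sig0.
    have -> : q 0 t = 0 by rewrite /q pz // mulr0.
    by rewrite q0z pz // !(mulr0, addr0).
  have -> : quad sg (p^~ t) k = Th%:C * 1 ^+ 2 * quad sig (p^~ t) k.
    rewrite -(quad_scale (sg := sig) (sg' := sg) 1) => [|j|]; [|by []|exact: Zi].
    by congr (quad sg _ k); apply/funext => j; rewrite mul1r.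
  have -> : theta t = E t / Th by [].
  rewrite /q /a (negbTE k0) (_ : _ + _ = Ak k * ((E t)%:C * p k t) + 1 * (E t)%:C ^+ 2 * quad sig (p^~ t) k) //.
  have TT : Th / Th = 1 by rewrite divff // gt_eqF.
  have -> : 1 * (E t)%:C ^+ 2 * quad sig (p^~ t) k = (E t)%:C ^+ 2 * (Th / Th)%:C * quad sig (p^~ t) k by rewrite TT mulr1 mul1r.
  by rewrite !rmorphM rmorphN /=; ring.
pose c k := conv (ez R) N N k.
have c0 k : 0 <= c k by apply: conv_ge0 => //; exact: ez_ge0.
have cs : sumle (fun k => c k ^+ 2) (4 ^+ 2 * ((2 * S0) ^+ 2 * (2 * S0) ^+ 2)).
  exact: (conv_l2 (@ez_ge0 R) N0 N0 (ler0n _ 4) (@sumle_ez R) NS NS).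
pose K2 := Th * KK / c1.
have K20 : 0 <= K2 by rewrite divr_ge0 ?(ltW c10) // mulr_ge0 ?KK_ge0 ?(ltW Th0).
(* A bound with one derivative more than the majorant [N]. The free part keeps its decay e^(- c1 k^2
   t). The quadratic part gains k^-2 from Duhamel, which pays for the |k| of the kernel and the |k|
   of the weight. *)
have pb k t : I t -> `|k%:~R| * normc (p k t) <= `|k%:~R| * expR (- (c1 * k%:~R ^+ 2) * t) * normc (f0 k) + K2 * c k.
  move=> It; have [->|k0] := eqVneq k 0.
    by rewrite normr0 !mul0r add0r mulr_ge0.
  have := @duhamel_bound R (a k) (p k) (fun s => (theta s)%:C * quad sg (p^~ s) k) t (Th * (KK * `|k%:~R|) * c k) 0 (Ige0 It) _ (contRe k t It) (contIm k t It).
  rewrite p0 mul0r expR0 mulr1 sub0r => h.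
  have {}h : normc (p k t) <= expR (Re (a k) * t) * normc (f0 k) + Th * (KK * `|k%:~R|) * c k / - Re (a k).
    apply: h => [s hs|s hs|]; last by rewrite oppr_gt0.
      by apply: pd; apply: sub It _; case/andP: hs => h1 h2; rewrite !ltW.
    have Is := sub t s It hs; have /andP[th0 th1] := theta01 Is.
    rewrite mul0r expR0 mulr1 normcM normc_real ger0_norm // -[leRHS]mul1r ler_pM ?normc_ge0 //.
    by apply: (quad_norm (gam := 4) (S := 2 * S0)) => //; [exact: ez_ge0|exact: sumle_ez|move=> j; exact: pN].
  have ra := hc k0; rewrite -Re_a // in ra.
  have k2 := int2_gt0 k0.
  apply: (@le_trans _ _ (`|k%:~R| * (expR (- (c1 * k%:~R ^+ 2) * t) * normc (f0 k) + Th * (KK * `|k%:~R|) * c k / (c1 * k%:~R ^+ 2)))).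
    apply: ler_wpM2l => //; apply: (le_trans h); apply: lerD.
      rewrite ler_wpM2r ?normc_ge0 // ler_expR ler_wpM2r ?Ige0 // lerNr //.
    apply: ler_wpM2l; first by rewrite mulr_ge0.
    by rewrite lef_pV2 // posrE; [rewrite oppr_gt0|rewrite mulr_gt0].
  rewrite mulrDr; apply: lerD; first by rewrite mulrA.
  rewrite le_eqVlt; apply/orP; left; apply/eqP.
  rewrite -(@real_normK _ (k%:~R : R)) ?num_real // /K2; have kk := abs_int_ge1 R k0.
  move: (`|k%:~R : R|) kk => x x1; field; rewrite !gt_eqF //; exact: lt_le_trans x1.
(* Squaring [pb] doubles both terms. Twice k^2 e^(- 2 c1 k^2 t) is [c1^-1] times the density of rate
   2 c1 k^2, and twice e^(- 2 mu0 t) is [mu0^-1] times the density of rate 2 mu0. The rate 1 at k =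
   0 only has to be positive, that mode being 0. *)
exists q, N, (fun k => Th ^+ 2 / c1 * normc (f0 k) ^+ 2), (fun k => Th ^+ 2 / mu0 * K2 ^+ 2 * c k ^+ 2),
  (fun k => if k == 0 then 1 else 2 * c1 * k%:~R ^+ 2), (2 * mu0), (Th ^+ 2 / c1 * S0 ^+ 2),
  (Th ^+ 2 / mu0 * K2 ^+ 2 * (4 ^+ 2 * ((2 * S0) ^+ 2 * (2 * S0) ^+ 2))).
have T1 : 0 <= Th ^+ 2 / c1 by rewrite divr_ge0 ?sqr_ge0 // ltW.
have T2 : 0 <= Th ^+ 2 / mu0 * K2 ^+ 2 by rewrite mulr_ge0 ?sqr_ge0 // divr_ge0 ?sqr_ge0 // ltW.
split=> //.
- split=> [k t It|t It]; last by rewrite /q pz // mulr0.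
  rewrite /q (ph (- k)) // opprK; case: (p k t) => x y; apply: complex_ext; rewrite /=; ring.
- by split=> // k; rewrite /q /E mulr0 expR0 mul1r.
split.
- by move=> k; rewrite mulr_ge0 ?sqr_ge0.
- by move=> k; rewrite mulr_ge0 ?sqr_ge0.
- by move=> k; case: eqVneq => // k0; rewrite pmulr_rgt0 ?int2_gt0 // mulr_gt0.
- by rewrite mulr_gt0.
split.
- by apply: sumleZ => // k; exact: sqr_ge0.
- by apply: sumleZ => // k; exact: sqr_ge0.
move=> k t It; have [->|k0] := eqVneq k 0.
  rewrite normr0 mul0r expr0n /=; apply: addr_ge0.
    by apply: (mulr_ge0 (mulr_ge0 T1 (sqr_ge0 _))); rewrite mulr_ge0 ?expR_ge0.
  by apply: (mulr_ge0 (mulr_ge0 T2 (sqr_ge0 _))); rewrite mulr_ge0 ?expR_ge0 // mulr_ge0 // ltW.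
set X := `|k%:~R| * expR (- (c1 * k%:~R ^+ 2) * t) * normc (f0 k).
have X0 : 0 <= X by rewrite !mulr_ge0 ?expR_ge0 ?normc_ge0.
have XX : X ^+ 2 = k%:~R ^+ 2 * expR (- (2 * c1 * k%:~R ^+ 2) * t) * normc (f0 k) ^+ 2.
  rewrite !exprMn real_normK ?num_real //; congr (_ * _ * _).
  by rewrite expr2 -expRD; congr expR; ring.
have EE : expR (- mu0 * t) ^+ 2 = expR (- (2 * mu0) * t) by rewrite expr2 -expRD; congr expR; ring.
have h1 : `|k%:~R| * normc (q k t) <= Th * expR (- mu0 * t) * (X + K2 * c k).
  rewrite (_ : normc (q k t) = E t * normc (p k t)); last by rewrite normcM normc_real ger0_norm ?expR_ge0.
  by rewrite mulrCA; apply: ler_pM; rewrite ?expR_ge0 ?hTh ?pb // mulr_ge0 ?normc_ge0.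
have h2 : (`|k%:~R| * normc (q k t)) ^+ 2 <= Th ^+ 2 * (expR (- mu0 * t) ^+ 2 * (2 * X ^+ 2 + 2 * (K2 * c k) ^+ 2)).
  apply: (@le_trans _ _ ((Th * expR (- mu0 * t) * (X + K2 * c k)) ^+ 2)).
    by rewrite ler_pXn2r ?nnegrE ?mulr_ge0 ?normc_ge0 ?expR_ge0 ?(ltW Th0) ?addr_ge0 // mulr_ge0.
  rewrite (_ : (_ * (X + _)) ^+ 2 = Th ^+ 2 * (expR (- mu0 * t) ^+ 2 * (X + K2 * c k) ^+ 2)); last by ring.
  apply: (ler_wpM2l (sqr_ge0 _)); apply: (ler_wpM2l (sqr_ge0 _)).
  by have := sqr_ge0 (X - K2 * c k); nra.
apply: (le_trans h2); rewrite mulrDr mulrDr; apply: lerD.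
  apply: (@le_trans _ _ (Th ^+ 2 * (2 * X ^+ 2))).
    apply: (ler_wpM2l (sqr_ge0 _)).
    rewrite -[leRHS]mul1r; apply: ler_wpM2r; first by rewrite mulr_ge0 ?sqr_ge0.
    by rewrite expr_le1 ?expR_ge0 ?exp_mu.
  by rewrite XX le_eqVlt; apply/orP; left; apply/eqP; field; rewrite gt_eqF.
by rewrite EE exprMn le_eqVlt; apply/orP; left; apply/eqP; field; rewrite gt_eqF.
Qed.

End CoefficientExistence.

(** * From strong solutions to coefficients *)

Section DerivativeConverse.
Variable R : realType.

Lemma quot_is_derive (f : R -> R) (t d : R) : (fun r => (r - t)^-1 * (f r - f t)) @ t^' --> d ->
  is_derive t 1 f d.
Proof.
move=> h.
have add0 : (r + t) @[r --> (0 : R)^'] --> t^'.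
  move=> A [e /= e0 hA]; exists e => //= r; rewrite /ball_ /= => rt rn; apply: hA.
    by rewrite /ball_ /= opprD addrCA subrr addr0 -[- r]sub0r.
  by rewrite -subr_eq0 addrK.
have h1 : h^-1 *: (f (h *: 1 + t) - f t) @[h --> (0 : R)^'] --> d.
  have := cvg_comp _ _ add0 h; apply: cvg_trans; apply: near_eq_cvg; apply: nearW => r /=.
  by rewrite /GRing.scale /= mulr1 addrK.
split; first by apply/cvg_ex; exists d.
exact/cvg_lim.
Qed.

Lemma quot_cderiv (y : R -> R[i]) (t : R) d :
  ccont (t^') (fun r => ((r - t)^-1)%:C * (y r - y t)) d -> cderiv y t d.
Proof.
move=> h; have h1 := ccont_Re h; have h2 := ccont_Im h; split; apply: quot_is_derive.
  apply: cvg_trans (h1 _); apply: near_eq_cvg; apply: nearW => r.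
  by rewrite ReM ReD ReN /= mul0r subr0.
apply: cvg_trans (h2 _); apply: near_eq_cvg; apply: nearW => r.
by rewrite ImM ImD ImN /= mul0r addr0.
Qed.

Lemma fhat_ae (f g : R -> R) : int1 f -> int1 g -> ae_eqS1 f g -> fhat f = fhat g.
Proof.
move=> f1 g1 fg; apply/funext => k; rewrite !fhatE; congr (_ +i* _).
  congr (_ * _); apply: I1_ae; [exact: int1cos|exact: int1cos|].
  by move: fg; rewrite /ae_eqS1 /ae_eq; apply: filterS => x h Dx; rewrite h.
congr (- (_ * _)); apply: I1_ae; [exact: int1sin|exact: int1sin|].
by move: fg; rewrite /ae_eqS1 /ae_eq; apply: filterS => x h Dx; rewrite h.
Qed.

Lemma ae_eqS1_trans (f g h : R -> R) : ae_eqS1 f g -> ae_eqS1 h g -> ae_eqS1 f h.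
Proof. by rewrite /ae_eqS1 /ae_eq; apply: filterS2 => x h1 h2 Dx; rewrite h1 // h2. Qed.

End DerivativeConverse.

(** * Coefficients of a given strong solution *)

Section Analysis.
Variables (R : realType) (eps delta beta : R).
Hypotheses (e0 : 0 < eps) (d0 : 0 < delta) (b0 : 0 <= beta).
Local Notation Ak := (Ak eps delta beta).
Local Notation sig := (sig eps delta beta).
Local Notation KK := (KK delta beta).

Definition asc (v : R -> R -> R) (k : int) (t : R) : R[i] := (k%:~R ^+ 2)%:C * fhat (v t) k.

Lemma asc0 v t : asc v 0 t = 0.
Proof. by rewrite /asc expr0n /= mul0r. Qed.

Lemma hsum2 f k : hsum 2 f k = normc ((k%:~R ^+ 2)%:C * fhat f k) ^+ 2 :> R.
Proof. by rewrite /hsum lam2 normcM normc_real ger0_norm ?sqr_ge0. Qed.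

Lemma inHs2_sq1 (f : R -> R) : inHs 2 f -> sq1 f.
Proof.
move=> /inHsE [f1 z [A sA]]; have [] // := @parseval_le _ f A f1.
apply: (le_sumle _ (lexx _) sA) => k; rewrite hsum2.
have [->|k0] := eqVneq k 0; first by rewrite z normc_0 expr0n /= sqr_ge0.
rewrite ler_pXn2r ?nnegrE ?normc_ge0 // normcM normc_real ger0_norm ?sqr_ge0 //.
by rewrite ler_peMl ?normc_ge0 // int_sqr_ge1.
Qed.

Lemma inHsB s (f g : R -> R) : inHs s f -> inHs s g -> inHs s (f \- g).
Proof.
move=> /inHsE [f1 f0 [A sA]] /inHsE [g1 g0 [B sB]]; apply/inHsE.
have E : fhat (f \- g) = fun k => fhat f k - fhat g k by exact: fhatB.
split; [exact: int1B|by rewrite E f0 g0 subrr|].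
exists (2 * (A + B)).
apply: (@le_sumle _ _ _ (fun k => 2 * (hsum s f k + hsum s g k)) _ _ _ (lexx _)) => [k|].
  rewrite /hsum E; apply: (@le_trans _ _ ((lam s k * normc (fhat f k) + lam s k * normc (fhat g k)) ^+ 2)).
    by rewrite ler_pXn2r ?nnegrE ?addr_ge0 ?mulr_ge0 ?lam_ge0 ?normc_ge0 // -mulrDr ler_wpM2l ?lam_ge0 ?normcB.
  have := sqr_ge0 (lam s k * normc (fhat f k) - lam s k * normc (fhat g k)); nra.
apply: sumleZ => //; first by move=> k; rewrite addr_ge0 ?hsum_ge0.
by apply: sumleD => // k; exact: hsum_ge0.
Qed.

Lemma Hnorm_triangle (f g : R -> R) : inHs 2 f -> inHs 2 g ->
  Hnorm 2 f ^+ 2 <= 2 * Hnorm 2 g ^+ 2 + 2 * Hnorm 2 (f \- g) ^+ 2.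
Proof.
move=> hf hg; have hd := inHsB hf hg; have [f1 _ _] := (inHsE 2 f).1 hf; have [g1 _ _] := (inHsE 2 g).1 hg.
have E : fhat (f \- g) = fun k => fhat f k - fhat g k by exact: fhatB.
have p0 : 0 < 2 * pi :> R by rewrite mulr_gt0 ?pi_gt0.
have -> : 2 * Hnorm 2 g ^+ 2 + 2 * Hnorm 2 (f \- g) ^+ 2 =
  2 * pi * (2 * ((2 * pi)^-1 * Hnorm 2 g ^+ 2 + (2 * pi)^-1 * Hnorm 2 (f \- g) ^+ 2)).
  by rewrite -!mulrDr mulrCA mulVKf // gt_eqF.
apply: Hnorm_le => //.
apply: (@le_sumle _ _ _ (fun k => 2 * (hsum 2 g k + hsum 2 (f \- g) k)) _ _ _ (lexx _)) => [k|].
  rewrite /hsum; have : lam 2 k * normc (fhat f k) <= lam 2 k * normc (fhat g k) + lam 2 k * normc (fhat (f \- g) k).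
    rewrite -mulrDr ler_wpM2l ?lam_ge0 // E; apply: le_trans (normcD _ _); by rewrite addrC subrK.
  have : 0 <= lam 2 k * normc (fhat f k) by rewrite mulr_ge0 ?lam_ge0 ?normc_ge0.
  move: (lam 2 k * _) (lam 2 k * normc (fhat g k)) (lam 2 k * _) => x y z x0 xyz.
  by have := sqr_ge0 (y - x); nra.
apply: sumleZ => //; first by move=> k; rewrite addr_ge0 ?hsum_ge0.
by apply: sumleD; [move=> k; exact: hsum_ge0|move=> k; exact: hsum_ge0|exact: Hnorm_sum|exact: Hnorm_sum].
Qed.

Lemma asc_le (f : R -> R) (k : int) : inHs 2 f -> normc ((k%:~R ^+ 2)%:C * fhat f k) ^+ 2 <= (2 * pi)^-1 * Hnorm 2 f ^+ 2.
Proof.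
move=> hf; rewrite -hsum2; apply: (sumle_lb1 (f := hsum 2 f)); first by move=> j; exact: hsum_ge0.
exact: Hnorm_sum.
Qed.

Lemma sqr_cvg0 (T : Type) (F : set_system T) {FF : Filter F} (u v : T -> R) (C : R) :
  (\forall r \near F, 0 <= u r /\ u r ^+ 2 <= C * v r ^+ 2) -> 0 <= C -> (forall r, 0 <= v r) -> v @ F --> 0 -> u @ F --> 0.
Proof.
move=> h C0 v0 vl; apply: (@cvg0_le _ _ _ _ _ (fun r => Num.sqrt C * v r)); last exact: cvg0Ml.
apply: filterS h => r [u0 h]; rewrite u0 /=.
rewrite -(ler_pXn2r (n := 2)) ?nnegrE ?mulr_ge0 ?sqrtr_ge0 //.
by rewrite exprMn sqr_sqrtr.
Qed.

Variables (I : set R) (u0 : R -> R) (v : R -> R -> R).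
Hypothesis sv : strong_solution eps delta beta I u0 v.
Variable T : R.
Hypotheses (T0 : 0 <= T) (IT : `[0, T]%classic `<=` I).

Let vH t : 0 <= t <= T -> inHs 2 (v t).
Proof. by move=> ht; case: sv => -[h _] _ _ _; apply: h; apply: IT; rewrite /= in_itv. Qed.

Let asc_cont k t : 0 <= t <= T -> ccont (within I (nbhs t)) (asc v k) (asc v k t).
Proof.
move=> ht; have It : I t by apply: IT; rewrite /= in_itv.
have cv : Hnorm 2 (v r \- v t) @[r --> within I (nbhs t)] --> 0 by case: sv => -[_ h] _ _ _; exact: h.
apply: (@sqr_cvg0 _ _ _ _ (fun r => Hnorm 2 (v r \- v t)) (2 * pi)^-1) => //.
- apply: filterS (near_withinT _ _) => r Ir; split; first exact: normc_ge0.
  have hr : inHs 2 (v r) by case: sv => -[h _] _ _ _; exact: h.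
  have [r1 _ _] := (inHsE 2 (v r)).1 hr; have [t1 _ _] := (inHsE 2 (v t)).1 (vH ht).
  have -> : asc v k r - asc v k t = (k%:~R ^+ 2)%:C * fhat (v r \- v t) k.
    by rewrite /asc -mulrBr (fhatB r1 t1).
  by apply: asc_le; apply: inHsB => //; exact: vH.
- by rewrite invr_ge0 mulr_ge0 ?pi_ge0.
- by move=> r; exact: Hnorm_ge0.
Qed.

Lemma strong_Re_cont k : {within `[0, T], continuous (fun s => Re (asc v k s))}.
Proof.
apply/subspace_continuousP => t /=; rewrite in_itv /= => ht.
have h := ccont_Re (asc_cont k ht).
apply: cvg_trans (h _); apply: cvg_app; apply: within_subset; exact: IT.
Qed.

Lemma strong_Im_cont k : {within `[0, T], continuous (fun s => Im (asc v k s))}.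
Proof.
apply/subspace_continuousP => t /=; rewrite in_itv /= => ht.
have h := ccont_Im (asc_cont k ht).
apply: cvg_trans (h _); apply: cvg_app; apply: within_subset; exact: IT.
Qed.

(** Continuity in H^2 bounds the norm near each t by 2 [Hnorm 2 (v t) ^+ 2] + 2, and compactness of
    [0, T], in its near-covering form, makes the bound uniform. *)
Lemma strong_bounded : exists B, 0 <= B /\ forall t, 0 <= t <= T -> Hnorm 2 (v t) ^+ 2 <= B.
Proof.
have cpt := (compact_near_coveringP `[0, T]%classic).1 (@segment_compact R 0 T).
have := cpt R (+oo : set_system R) (fun B t => 0 <= t <= T -> Hnorm 2 (v t) ^+ 2 <= B) _ _.
move=> /(_ _ _) h.
have {}h : \forall B \near (+oo : set_system R), `[0, T] `<=` (fun t => 0 <= t <= T -> Hnorm 2 (v t) ^+ 2 <= B).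
  apply: h => t /=; rewrite in_itv /= => ht.
  have It : I t by apply: IT; rewrite /= in_itv.
  have cv : Hnorm 2 (v r \- v t) @[r --> within I (nbhs t)] --> 0 by case: sv => -[_ h] _ _ _; exact: h.
  have near1 : \forall r \near within I (nbhs t), Hnorm 2 (v r \- v t) < 1.
    have := cvgr_lt _ cv (1 : R) ltr01; exact.
  exists ([set r | I r -> Hnorm 2 (v r \- v t) < 1], [set B | 2 * Hnorm 2 (v t) ^+ 2 + 2 <= B]).
    by split; [exact: near1|exact: nbhs_pinfty_ge (num_real _)].
  move=> [r B] /= [h1 h2] hr; have Ir : I r by apply: IT; rewrite /= in_itv.
  apply: (le_trans (Hnorm_triangle (vH hr) (vH ht))); apply: le_trans h2.
  rewrite lerD2l -[leRHS]mulr1 ler_wpM2l // expr_le1 ?Hnorm_ge0 //; exact/ltW/h1.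
have [B [B0 hB]] : exists B, 0 <= B /\ `[0, T] `<=` (fun t => 0 <= t <= T -> Hnorm 2 (v t) ^+ 2 <= B).
  have h2 : \forall B \near (+oo : set_system R), 0 <= B by exact: nbhs_pinfty_ge (num_real _).
  by have [B [? ?]] := filter_ex (filterI h2 h); exists B.
by exists B; split=> // t ht; apply: (hB t) => //=; rewrite in_itv.
Qed.

(** At interior times the limit within I is two-sided, and by Bessel each coefficient of the error
    of the difference quotient is controlled by its L^2 norm. *)
Lemma strong_ode k t : 0 < t < T -> cderiv (asc v k) t (Ak k * asc v k t + quad sig ((asc v)^~ t) k).
Proof.
move=> /andP[t0 tT]; have ht : 0 <= t <= T by rewrite !ltW.
have It : I t by apply: IT; rewrite /= in_itv.
have [_ _ _ /(_ t It) [ut [/inLp2P u2 lim] eq]] := sv.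
have hv := vH ht; have [v1 vz [A sA]] := (inHsE 2 (v t)).1 hv.
have v2 := inHs2_sq1 hv.
have := @rhs_quad R eps delta beta (fhat (v t)) A (herm_fhat v1) vz _ k.
rewrite -eq => <-; last first.
  by apply: (le_sumle _ (lexx _) sA) => j; rewrite hsum2 normcM normc_real ger0_norm ?sqr_ge0.
have -> : ((2 * eps)^-1)%:C * ((k%:~R ^+ 2)%:C * ((2 * eps)%:C *: fhat ut) k) = (k%:~R ^+ 2)%:C * fhat ut k.
  have ee : (2 * eps)^-1 * (2 * eps) = 1 by rewrite mulVf // gt_eqF // mulr_gt0.
  transitivity (((2 * eps)^-1 * (2 * eps))%:C * ((k%:~R ^+ 2)%:C * fhat ut k)); last by rewrite ee mul1r.
  rewrite (rmorphM (real_complex R)) /= -[(_ *: fhat ut) k]/((2 * eps)%:C * fhat ut k); ring.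
apply: quot_cderiv.
have tn : \forall r \near t^', 0 <= r <= T.
  have tI : t \in `]0, T[ by rewrite in_itv /= t0.
  by apply: filterS (near_in_itvoo tI) => r; rewrite in_itv /= => /andP[h1 h2] _; rewrite !ltW.
have lim' : L2norm (fun x => (r - t)^-1 * (v r x - v t x) - ut x) @[r --> t^'] --> 0.
  by move=> N /lim h; apply: filterS2 tn h => r hr hN; apply: hN; apply: IT; rewrite /= in_itv.
apply: (@sqr_cvg0 _ _ _ _ (fun r => L2norm (fun x => (r - t)^-1 * (v r x - v t x) - ut x)) ((k%:~R ^+ 2) ^+ 2 * (2 * pi)^-1)) => //.
- apply: filterS tn => r hr; split; first exact: normc_ge0.
  have r1 := sq1_int1 (inHs2_sq1 (vH hr)); have r2 := inHs2_sq1 (vH hr).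
  have q2 : sq1 (fun x => (r - t)^-1 * (v r x - v t x) - ut x) by apply: sq1B => //; apply: sq1Z; exact: sq1B.
  have qE : fhat (fun x => (r - t)^-1 * (v r x - v t x) - ut x) k = ((r - t)^-1)%:C * (fhat (v r) k - fhat (v t) k) - fhat ut k.
    rewrite (fhatB (int1Z _ (int1B r1 v1)) (sq1_int1 u2)).
    by rewrite (fhatZ _ (int1B r1 v1)) (fhatB r1 v1).
  have -> : ((r - t)^-1)%:C * (asc v k r - asc v k t) - (k%:~R ^+ 2)%:C * fhat ut k =
     (k%:~R ^+ 2)%:C * fhat (fun x => (r - t)^-1 * (v r x - v t x) - ut x) k by rewrite qE /asc; ring.
  rewrite normcM exprMn normc_real (ger0_norm (sqr_ge0 _)) -[leRHS]mulrA ler_wpM2l ?sqr_ge0 //.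
  rewrite L2norm_sqr //; have := bessel q2; apply: (sumle_lb1 (f := fun j => normc (fhat _ j) ^+ 2)) => j; exact: sqr_ge0.
- by rewrite mulr_ge0 ?sqr_ge0 // invr_ge0 mulr_ge0 ?pi_ge0.
- by move=> r; exact: L2norm_ge0.
Qed.

(* On bounded sets of H^2 the quadratic term is O(|k|) and the Duhamel formula
   gains k^-2: what remains is the square summable 1 / |k|. *)
Lemma strong_majorant : exists M S, [/\ forall k, 0 <= M k, 0 <= S, sumle (fun k => M k ^+ 2) (S ^+ 2) &
  forall k t, 0 <= t <= T -> normc (asc v k t) <= M k].
Proof.
have [B [B0 hB]] := strong_bounded.
pose S1 := Num.sqrt ((2 * pi)^-1 * B).
have S1E : S1 ^+ 2 = (2 * pi)^-1 * B by rewrite sqr_sqrtr // mulr_ge0 // invr_ge0 mulr_ge0 ?pi_ge0.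
have sw t : 0 <= t <= T -> sumle (fun k => normc (asc v k t) ^+ 2) (S1 ^+ 2).
  move=> ht; apply: (@le_sumle _ _ _ (hsum 2 (v t)) _ _ _ _ (Hnorm_sum (vH ht))) => [k|]; first by rewrite hsum2.
  by rewrite S1E ler_wpM2l ?hB // invr_ge0 mulr_ge0 ?pi_ge0.
pose C := KK * (4 * S1 ^+ 2).
have C0 : 0 <= C by rewrite mulr_ge0 ?KK_ge0 // mulr_ge0 ?sqr_ge0.
have qb k t : 0 <= t <= T -> normc (quad sig ((asc v)^~ t) k) <= C * `|k%:~R|.
  move=> ht; have w0 j : 0 <= normc (asc v j t) by exact: normc_ge0.
  have h := @quad_norm R sig (ez R) 4 S1 (KK * `|k%:~R|) (fun j => normc (asc v j t)) k (@ez_ge0 R) _ (@sumle_ez R) (sig_bound e0 d0 b0 k) w0 (sw t ht) ((asc v)^~ t) (fun j => lexx _).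
  have kk : 0 <= KK * `|k%:~R| by rewrite mulr_ge0 ?KK_ge0.
  apply: (le_trans (h kk)); rewrite /C [leRHS]mulrAC; apply: ler_wpM2l => //.
  have := conv_l2 (@ez_ge0 R) w0 w0 (ler0n _ 4) (@sumle_ez R) (sw t ht) (sw t ht).
  move=> /(sumle_lb1 k (fun j => sqr_ge0 _)); rewrite (_ : 4 ^+ 2 * (S1 ^+ 2 * S1 ^+ 2) = (4 * S1 ^+ 2) ^+ 2); last by ring.
  have cv0 : 0 <= conv (ez R) (fun j => normc (asc v j t)) (fun j => normc (asc v j t)) k by apply: conv_ge0 => //; exact: ez_ge0.
  have s0 : 0 <= 4 * S1 ^+ 2 by rewrite mulr_ge0 ?sqr_ge0.
  by rewrite ler_pXn2r ?nnegrE.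
have cc0 : 0 < cc eps delta.
  by rewrite /cc /nu !divr_gt0 ?mulr_gt0 // ltr_wpDr ?sqr_ge0.
have h00 : (0 : R) <= 0 <= T by apply/andP; split.
pose M k := normc (asc v k 0) + C / cc eps delta * `|k%:~R|^-1.
have Cc : 0 <= C / cc eps delta by rewrite divr_ge0 // ltW.
have M0 k : 0 <= M k by rewrite addr_ge0 ?normc_ge0 // mulr_ge0 ?invr_ge0.
(* The 4 bounds the sum of k^-2 over the integers. *)
pose S := Num.sqrt (2 * (S1 ^+ 2 + (C / cc eps delta) ^+ 2 * 4)).
exists M, S; split=> //; first exact: sqrtr_ge0.
  rewrite sqr_sqrtr; last by apply: mulr_ge0 => //; apply: addr_ge0; [exact: sqr_ge0|apply: mulr_ge0 => //; exact: sqr_ge0].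
  apply: (@le_sumle _ _ _ (fun k => 2 * (normc (asc v k 0) ^+ 2 + (C / cc eps delta) ^+ 2 * (k%:~R ^+ 2)^-1)) _ _ _ (lexx _)) => [k|].
    rewrite /M -(@real_normK _ (k%:~R : R)) ?num_real // -exprVn -exprMn.
    move: (normc _) (_ * _^-1) => x y; have := sqr_ge0 (x - y); nra.
  apply: sumleZ => // [k|]; first by apply: addr_ge0; [exact: sqr_ge0|apply: (mulr_ge0 (sqr_ge0 _)); exact: invsq_ge0].
  apply: sumleD => [k|k||]; [exact: sqr_ge0|by apply: (mulr_ge0 (sqr_ge0 _)); exact: invsq_ge0|exact: sw|].
  by apply: sumleZ; [exact: invsq_ge0|exact: sqr_ge0|exact: sumle_invsq].
move=> k t ht; have [->|k0] := eqVneq k 0.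
  by rewrite asc0 normc_0 M0.
have sub s : 0 <= s <= t -> 0 <= s <= T.
  by case/andP: ht => _ tT /andP[s0 st]; rewrite s0 (le_trans st).
have t0 : 0 <= t by case/andP: ht.
have stT : `[0, t] `<=` `[0, T]%classic by move=> s /=; rewrite !in_itv /=; exact: sub.
have := @duhamel_bound R (Ak k) (asc v k) (fun s => quad sig ((asc v)^~ s) k) t (C * `|k%:~R|) 0 t0 _ _ _ _ _.
have ra := Re_Ak e0 d0 b0 k0.
have k2 : 0 < (k%:~R : R) ^+ 2 by rewrite (lt_le_trans ltr01) // int_sqr_ge1.
have nu0 : 0 < nu eps delta by rewrite divr_gt0 ?mulr_gt0.
have ck : 0 < cc eps delta * k%:~R ^+ 2 by rewrite mulr_gt0.
rewrite !sub0r mul0r expR0 mulr1 => h.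
apply: (le_trans (h _ _ _ _ _)).
- move=> s /andP[s1 s2]; apply: strong_ode; rewrite s1 (lt_le_trans s2) //.
  by case/andP: ht.
- exact: (continuous_subspaceW stT (@strong_Re_cont k)).
- exact: (continuous_subspaceW stT (@strong_Im_cont k)).
- by move=> s hs; rewrite mul0r expR0 mulr1; apply: qb; exact: sub.
- by lra.
rewrite /M; apply: lerD.
  rewrite -[leRHS]mul1r ler_wpM2r ?normc_ge0 // -expR0 ler_expR mulr_le0_ge0 //; lra.
apply: (@le_trans _ _ (C * `|k%:~R| / (cc eps delta * k%:~R ^+ 2))).
  apply: ler_wpM2l; first by rewrite mulr_ge0.
  by rewrite lef_pV2 // ?posrE; lra.
have kk := abs_int_ge1 R k0; rewrite -(@real_normK _ (k%:~R : R)) ?num_real //.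
move: (`|k%:~R : R|) kk => x x1; rewrite le_eqVlt; apply/orP; left; apply/eqP.
by field; rewrite !gt_eqF // (lt_le_trans ltr01).
Qed.


End Analysis.

(** * Well-posedness *)

Section WellPosedness.
Variables (R : realType) (eps delta beta : R).
Hypotheses (e0 : 0 < eps) (d0 : 0 < delta) (b0 : 0 <= beta).
Local Notation Ak := (Ak eps delta beta).
Local Notation sig := (sig eps delta beta).
Local Notation KK := (KK delta beta).
Local Notation cc := (cc eps delta).
Local Notation nu := (nu eps delta).

Lemma nu_gt0 : 0 < nu.
Proof. by rewrite /nu divr_gt0 ?mulr_gt0. Qed.

Lemma cc_gt0 : 0 < cc.
Proof. by rewrite /cc divr_gt0 ?nu_gt0 // mulr_gt0 // ltr_wpDr ?sqr_ge0. Qed.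

(** Young's inequality for (K / g) x with weight [cc]. It dictates the value (K / g)^2 / cc + 1 of
    rho, both for uniqueness and for local existence. *)
Lemma absorb (K g x : R) : 0 < g -> K * x <= ((K / g) ^+ 2 / cc + 1 + cc * x ^+ 2) * g.
Proof.
move=> g0; have c0 := cc_gt0; rewrite -ler_pdivrMr // mulrAC; set y := K / g.
have h : y * x <= (y ^+ 2 / cc + cc * x ^+ 2) / 2.
  rewrite ler_pdivlMr // -(ler_pM2r c0) mulrDl divfK ?gt_eqF //.
  have := sqr_ge0 (y - cc * x); nra.
have : 0 <= y ^+ 2 / cc + cc * x ^+ 2.
  by apply: addr_ge0; [apply: divr_ge0; [exact: sqr_ge0|exact: ltW]|apply: mulr_ge0; [exact: ltW|exact: sqr_ge0]].
lra.
Qed.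

Lemma Re_Ak_le k : Re (Ak k) <= - (cc * k%:~R ^+ 2).
Proof.
have [->|k0] := eqVneq k 0.
  by rewrite Ak0 expr0n /= mulr0 oppr0.
by have := Re_Ak e0 d0 b0 k0; have := nu_gt0; lra.
Qed.

Lemma strong_unique (I : set R) (u0 : R -> R) (v1 v2 : R -> R -> R) (t : R) : 0 <= t ->
  `[0, t]%classic `<=` I -> strong_solution eps delta beta I u0 v1 ->
  strong_solution eps delta beta I u0 v2 -> ae_eqS1 (v1 t) (v2 t).
Proof.
move=> t0 tI s1 s2.
have [M1 [S1 [M10 S10 MS1 b1]]] := strong_majorant e0 d0 b0 s1 t0 tI.
have [M2 [S2 [M20 S20 MS2 b2]]] := strong_majorant e0 d0 b0 s2 t0 tI.
pose S := Num.sqrt (2 * (S1 ^+ 2 + S2 ^+ 2)).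
have S0 : 0 <= S by exact: sqrtr_ge0.
pose M k := M1 k + M2 k.
have MS : sumle (fun k => M k ^+ 2) (S ^+ 2).
  rewrite sqr_sqrtr; last by rewrite mulr_ge0 // addr_ge0 ?sqr_ge0.
  apply: (@le_sumle _ _ _ (fun k => 2 * (M1 k ^+ 2 + M2 k ^+ 2)) _ _ _ (lexx _)) => [k|].
    by rewrite /M; have := sqr_ge0 (M1 k - M2 k); nra.
  apply: sumleZ => // [k|]; first by rewrite addr_ge0 ?sqr_ge0.
  by apply: sumleD => // k; exact: sqr_ge0.
(* So that 4 * (4 * g) * S <= 1, the smallness asked by [ode_unique] for the kernel g * [ez]. The
   size of the solutions is thus unrestricted and rho pays for it. *)
pose g := (16 * (S + 1))^-1.
have g0 : 0 < g by rewrite invr_gt0 mulr_gt0 // ltr_wpDl.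
pose rho := (KK / g) ^+ 2 / cc + 1.
have rho0 : 0 < rho by rewrite ltr_wpDl // divr_ge0 ?sqr_ge0 // ltW // cc_gt0.
have inI s : 0 <= s <= t -> I s by move=> hs; apply: tI; rewrite /= in_itv.
have hv (v : R -> R -> R) : strong_solution eps delta beta I u0 v -> forall s, 0 <= s <= t -> inHs 2 (v s).
  by move=> [[h _] _ _ _] s hs; apply: h; exact: inI.
have tt : 0 <= t <= t by rewrite t0 lexx.
have z0 : (0 : R) <= 0 <= t by apply/andP; split.
have i1 (v : R -> R -> R) s (hs : strong_solution eps delta beta I u0 v) (h : 0 <= s <= t) : int1 (v s) /\ fhat (v s) 0 = 0.
  by have /inHsE [] := hv v hs s h.
have eq0 k : asc v1 k 0 = asc v2 k 0.
  rewrite /asc (_ : fhat (v1 0) = fhat (v2 0)) //; apply: fhat_ae.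
  - by have [] := i1 v1 0 s1 z0.
  - by have [] := i1 v2 0 s2 z0.
  by case: s1 s2 => _ _ a1 _ [_ _ a2 _]; exact: ae_eqS1_trans a1 a2.
have Areg k : rho - Re (Ak k) >= rho + cc * k%:~R ^+ 2 by have := Re_Ak_le k; lra.
have k20 k : 0 <= cc * k%:~R ^+ 2 by rewrite mulr_ge0 ?sqr_ge0 // ltW // cc_gt0.
have key : forall k s, 0 <= s <= t -> asc v1 k s = asc v2 k s.
  move=> k s; apply: (@ode_unique R Ak sig (fun k j => g * ez R k j) (4 * g) S t rho (fun=> 1) (asc v1) (asc v2) M) => //.
  - exact: ltW.
  - by move=> j; have := Areg j; have := k20 j; lra.
  - move=> i j; apply: (le_trans (sig_bound e0 d0 b0 i j)); rewrite mulrA ler_wpM2r ?ez_ge0 //.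
    apply: (le_trans (absorb KK `|i%:~R| g0)); rewrite real_normK ?num_real //.
    by rewrite ler_wpM2r // ltW.
  - by move=> i j; rewrite mulr_ge0 ?ez_ge0 // ltW.
  - by rewrite mulr_ge0 // ltW.
  - move=> i; rewrite exprMn mulrC; under eq_fun do rewrite exprMn.
    by apply: sumleZ; [move=> j; exact: sqr_ge0|exact: sqr_ge0|exact: sumle_ez].
  - by move=> ? _; rewrite lexx ler01.
  - by move=> j; rewrite addr_ge0.
  - rewrite (_ : 4 * (4 * g) * S = 16 * S / (16 * (S + 1))); last by rewrite /g; field; rewrite gt_eqF // ltr_wpDl.
    by rewrite ler_pdivrMr ?mulr_gt0 ?ltr_wpDl //; lra.
  - split.
    + by move=> j r hr; apply: (le_trans (b1 j r hr)); rewrite lerDl.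
    + by move=> j; exact: (strong_Re_cont s1 tI).
    + by move=> j; exact: (strong_Im_cont s1 tI).
    + by move=> j r hr; rewrite mul1r; exact: (strong_ode e0 s1 tI).
  - split.
    + by move=> j r hr; apply: (le_trans (b2 j r hr)); rewrite lerDr.
    + by move=> j; exact: (strong_Re_cont s2 tI).
    + by move=> j; exact: (strong_Im_cont s2 tI).
    + by move=> j r hr; rewrite mul1r; exact: (strong_ode e0 s2 tI).
have [f1 f10] := i1 v1 t s1 tt; have [f2 f20] := i1 v2 t s2 tt.
apply: fhat_inj => //; apply/funext => k; have [->|k0] := eqVneq k 0; first by rewrite f10 f20.
have := key k t tt; rewrite /asc; apply: mulfI.
by rewrite (fmorph_eq0 (real_complex R)) expf_neq0 // intr_eq0.
Qed.

Lemma solution_exists (I : set R) (kappa : R -> R) (eta Th mu0 g S0 : R) (u0 : R -> R) :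
  I 0 -> (forall t, I t -> 0 <= t) -> is_interval I -> measurable I -> continuous kappa ->
  (forall t, I (kappa t)) -> (forall t, I t -> kappa t = t) -> 0 < mu0 ->
  (forall t, I t -> expR (- eta * t) <= Th * expR (- mu0 * t)) ->
  (forall k, k != 0 -> cc * k%:~R ^+ 2 <= - Re (Ak k) - eta) -> 0 <= g ->
  (forall k, k != 0 -> Th * (KK * `|k%:~R|) <= (- Re (Ak k) - eta) * g) ->
  inHs 2 u0 -> 0 <= S0 -> (2 * pi)^-1 * Hnorm 2 u0 ^+ 2 <= S0 ^+ 2 -> 64 * g * S0 <= 1 ->
  exists u : R -> R -> R, unique_strong_solution eps delta beta I u0 u /\
    exists N : int -> R, [/\ forall k, 0 <= N k, sumle (fun k => N k ^+ 2) ((2 * S0) ^+ 2) &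
      forall t, I t -> [/\ int1 (u t), fhat (u t) 0 = 0 &
        forall k, k%:~R ^+ 2 * normc (fhat (u t) k) <= Th * expR (- mu0 * t) * N k]].
Proof.
move=> I0 Ige0 Ii mI ck kI kK m0 hTh hc g0 hg hu S00 hS small.
have /inHsE [u1 uz _] := hu; have hf := herm_fhat u1.
pose f0 k := (k%:~R ^+ 2)%:C * fhat u0 k.
have f0h : herm f0.
  move=> k; rewrite /f0 hf rmorphN sqrrN; case: (fhat u0 k) => x y.
  by apply: complex_ext; rewrite /=; ring.
have f00 : f0 0 = 0 by rewrite /f0 uz mulr0.
have fS : sumle (fun k => normc (f0 k) ^+ 2) (S0 ^+ 2).
  by apply: (le_sumle _ hS (Hnorm_sum hu)) => k; rewrite hsum2.
have [q [N [al [be [lk [m [A [B [[N0 NS] qN [qh q0] [qi qd] [al0 be0 lk0 mm0 [sA sB bnd]]]]]]]]]]] :=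
  coef_exists e0 d0 b0 I0 Ige0 Ii ck kI kK m0 hTh cc_gt0 hc g0 hg f0h f00 S00 fS small.
have Th0 : 0 <= Th by have := hTh 0 I0; rewrite !mulr0 expR0 mulr1; apply: le_trans.
pose M k := Th * N k.
have M0 k : 0 <= M k by rewrite mulr_ge0.
have MS : sumle (fun k => M k ^+ 2) ((Th * (2 * S0)) ^+ 2).
  rewrite exprMn; under eq_fun do rewrite exprMn.
  by apply: sumleZ; [move=> k; exact: sqr_ge0|exact: sqr_ge0|].
have qM k t : I t -> normc (q k t) <= M k.
  move=> It; apply: (le_trans (qN k t It)); rewrite /M -mulrA; apply: ler_wpM2l => //.
  rewrite -[leRHS]mul1r ler_wpM2r // -expR0 ler_expR mulNr oppr_le0.
  by apply: mulr_ge0; [exact: ltW|exact: Ige0].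
pose u t := funof (desc q t).
have P t : I t -> [/\ int1 (u t), fhat (u t) = desc q t & sq1 (u t)] by exact: (synthP M0 MS qM qh).
have S : strong_solution eps delta beta I u0 u.
  split.
  - exact: (synth_contHs M0 MS qM qh q0 qd).
  - exact: (synth_sqintHs M0 MS qM qh q0 qd mI Ige0 al0 be0 lk0 mm0 sA sB bnd).
  - have [h1 h2 _] := P 0 I0; apply: fhat_inj => //; apply/funext => k; rewrite h2 /desc qi /f0.
    have [->|k0] := eqVneq k 0; first by rewrite uz !mulr0.
    by rewrite mulrA -rmorphM /= mulVf ?mul1r // expf_neq0 // intr_eq0.
  move=> t It; exists (funof (vel eps delta beta q t)).
    by have [] := synth_time_deriv e0 d0 b0 M0 MS qM qh qd Ii It.
  exact: (synth_eq e0 d0 b0 M0 MS qM qh q0 qd Ii It).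
exists u; split.
  split=> // v sv t It; apply: (strong_unique (Ige0 t It) _ sv S).
  by move=> s /=; rewrite in_itv /= => hs; apply: (Ii 0 t).
exists N; split=> // t It; have [h1 h2 _] := P t It; split=> //.
  by rewrite h2 /desc q0 // mulr0.
move=> k; apply: le_trans (qN k t It); rewrite h2 -[X in _ <= normc X](desc_scale q0 k It).
by rewrite normcM normc_real ger0_norm ?sqr_ge0.
Qed.

Lemma local_existence (m : R) : exists T : R, 0 < T /\ forall u0, inHs 2 u0 -> Hnorm 2 u0 = m ->
  exists u, unique_strong_solution eps delta beta `[0, T] u0 u.
Proof.
pose S0 := Num.sqrt ((2 * pi)^-1 * m ^+ 2).
have S00 : 0 <= S0 by exact: sqrtr_ge0.
have S0E : S0 ^+ 2 = (2 * pi)^-1 * m ^+ 2.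
  by rewrite sqr_sqrtr // mulr_ge0 ?sqr_ge0 // invr_ge0 mulr_ge0 ?pi_ge0.
pose g := (64 * (S0 + 1))^-1.
have g0 : 0 < g by rewrite invr_gt0 mulr_gt0 // ltr_wpDl.
(* On [0, 1 / rho] one has e^(rho t) <= e^2 e^(- rho t). The order of choices is m, S0, g, rho, so
   that the time 1 / rho depends on the data through their norm only. *)
pose Th : R := expR 2.
pose rho := (Th * KK / g) ^+ 2 / cc + 1.
have rho0 : 0 < rho by rewrite ltr_wpDl // divr_ge0 ?sqr_ge0 // ltW // cc_gt0.
have T0 : 0 < rho^-1 by rewrite invr_gt0.
exists rho^-1; split=> // u0 hu hm.
have hA k : k != 0 -> rho + cc * k%:~R ^+ 2 <= - Re (Ak k) - - rho.
  by move=> k0; have := Re_Ak_le k; lra.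
(* The clamp of t to [0, 1 / rho], written with absolute values so that continuity is immediate. *)
pose kap t := (`|t| - `|t - rho^-1| + rho^-1) / 2.
have [||||||||||||||||u [hu' _]] := @solution_exists `[0, rho^-1]%classic kap (- rho) Th rho g S0 u0.
- by rewrite /= in_itv /= lexx ltW.
- by move=> t /=; rewrite in_itv /= => /andP[].
- exact: interval_is_interval.
- exact: measurable_itv.
- move=> t; apply: cvgM; last exact: cvg_cst.
  apply: cvgD; last exact: cvg_cst.
  by apply: cvgB; apply: cvg_norm; [exact: cvg_id|apply: cvgB; [exact: cvg_id|exact: cvg_cst]].
- move=> t; rewrite /= in_itv /= /kap; case: (ger0P t) => ht; case: (ger0P (t - rho^-1)) => ht2; apply/andP; split; lra.
- by move=> t /=; rewrite in_itv /= => /andP[ta tb]; rewrite /kap ger0_norm // ler0_norm; lra.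
- by [].
- move=> t /=; rewrite in_itv /= => /andP[ta tb]; rewrite /Th -expRD ler_expR opprK mulNr.
  have : rho * t <= 1 by rewrite mulrC -ler_pdivlMr // div1r.
  lra.
- by move=> k k0; have := hA k k0; lra.
- exact: ltW.
- move=> k k0; rewrite mulrA; apply: (le_trans (absorb _ `|k%:~R| g0)); rewrite real_normK ?num_real //.
  by rewrite ler_wpM2r ?(ltW g0) // hA.
- by [].
- by [].
- by rewrite hm S0E.
- rewrite (_ : 64 * g * S0 = S0 / (S0 + 1)); last by rewrite /g; field; rewrite gt_eqF // ltr_wpDl.
  by rewrite ler_pdivrMr ?ltr_wpDl // mul1r; lra.
by exists u.
Qed.

Lemma global_existence : exists c0 : R, 0 < c0 /\ forall u0, inHs 2 u0 -> Hnorm 2 u0 <= c0 ->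
  exists u, unique_strong_solution eps delta beta `[0, +oo[ u0 u /\
    (eps <= 1 -> forall t, 0 <= t ->
      (Wnorm 0 (u t) <= (expR (- (delta / 2) * t))%:E)%E /\
      (forall r, r <= 2 -> inHs r (u t) /\ Hnorm r (u t) <= expR (- (delta / 2) * t))).
Proof.
pose g := KK / cc; have c0 := cc_gt0.
have g0 : 0 <= g by rewrite divr_ge0 ?KK_ge0 ?(ltW c0).
(* The summand 64 g gives the smallness for existence. The summand 8 gives S0 <= 1/8, which makes
   all decay constants at most 1: 4 S0 <= 1 for the Wiener norm and 2 pi (2 S0)^2 <= 1 for the
   Sobolev norms. *)
pose S0 := (8 + 64 * g)^-1.
have den : 0 < 8 + 64 * g by rewrite ltr_wpDr // mulr_ge0.
have S00 : 0 < S0 by rewrite invr_gt0.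
have S01 : S0 <= 8^-1 by rewrite lef_pV2 ?posrE // lerDl mulr_ge0.
have p1 : 0 < 2 * pi :> R by rewrite mulr_gt0 ?pi_gt0.
have p2 := pi_ge2 R.
have p4 : (pi : R) <= 4 by have [/andP[_ h] _] := pihalf_02_cos_pihalf R; lra.
exists S0; split=> // u0 hu hm.
have hS : (2 * pi)^-1 * Hnorm 2 u0 ^+ 2 <= S0 ^+ 2.
  apply: (@le_trans _ _ (1 * Hnorm 2 u0 ^+ 2)).
    by rewrite ler_wpM2r ?sqr_ge0 // invf_le1 //; lra.
  by rewrite mul1r ler_pXn2r ?nnegrE ?Hnorm_ge0 // ltW.
pose kap (t : R) := (`|t| + t) / 2.
have hA k : k != 0 -> cc * k%:~R ^+ 2 <= - Re (Ak k) - nu.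
  by move=> k0; have := Re_Ak e0 d0 b0 k0; lra.
have [||||||||||||||||u [hu' [N [N0 NS uN]]]] := @solution_exists `[0, +oo[%classic kap nu 1 nu g S0 u0.
- by rewrite /= in_itv /= lexx.
- by move=> t /=; rewrite in_itv /= andbT.
- exact: interval_is_interval.
- exact: measurable_itv.
- move=> t; apply: cvgM; last exact: cvg_cst.
  by apply: cvgD; [apply: cvg_norm; exact: cvg_id|exact: cvg_id].
- move=> t; rewrite /= in_itv /= andbT /kap; case: (ger0P t) => ht; lra.
- by move=> t /=; rewrite in_itv /= andbT => ta; rewrite /kap ger0_norm //; lra.
- exact: nu_gt0.
- by move=> t _; rewrite mul1r.
- exact: hA.
- by [].
(* With g = KK / cc, the factor KK |k| is absorbed by cc k^2 g because |k| <= k^2 for integers. *)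
- move=> k k0; rewrite mul1r; apply: (@le_trans _ _ (cc * k%:~R ^+ 2 * g)); last by rewrite ler_wpM2r ?hA.
  rewrite (_ : cc * k%:~R ^+ 2 * g = KK * k%:~R ^+ 2); last by rewrite /g; field; rewrite gt_eqF.
  rewrite ler_wpM2l ?KK_ge0 // -(@real_normK _ (k%:~R)) ?num_real // expr2 ler_peMr ?abs_int_ge1 //.
- by [].
- exact: ltW.
- by [].
- rewrite /S0 ler_pdivrMr // mul1r; lra.
exists u; split=> // eps1 t t0.
have [u1 uz ub] : [/\ int1 (u t), fhat (u t) 0 = 0 & forall k, k%:~R ^+ 2 * normc (fhat (u t) k) <= 1 * expR (- nu * t) * N k].
  by apply: uN; rewrite /= in_itv /= t0.
pose E := expR (- nu * t).
(* Here eps <= 1 enters: it says that nu = delta / (2 eps) is at least delta / 2. *)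
have EE : E <= expR (- (delta / 2) * t).
  rewrite ler_expR ler_wpM2r // lerN2 /nu ler_pM2l // lef_pV2 ?posrE ?mulr_gt0 //; lra.
have E0 : 0 <= E by exact: expR_ge0.
have EN : sumle (fun k => (E * N k) ^+ 2) (E ^+ 2 * (2 * S0) ^+ 2).
  by under eq_fun do rewrite exprMn; apply: sumleZ; [move=> k; exact: sqr_ge0|exact: sqr_ge0|].
have {}ub k : k%:~R ^+ 2 * normc (fhat (u t) k) <= E * N k by have := ub k; rewrite mul1r.
split.
  apply: (@le_trans _ _ E%:E); last by rewrite lee_fin.
  have s1 : sumle (fun k : int => ((k%:~R : R) ^+ 2)^-1 ^+ 2) 4.
    apply: (le_sumle _ (lexx _) (@sumle_invsq R)) => k.
    by rewrite expr2 -[leRHS]mul1r ler_wpM2r ?invsq_ge0 ?invsq_le1.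
  (* The embedding of H^2 into the Wiener space: u_k is k^-2 times a square summable sequence, and
     the squares of k^-2 sum to at most 4. *)
  have := sumle_CS (@invsq_ge0 R) (fun k => mulr_ge0 E0 (N0 k)) s1 EN.
  rewrite (_ : 4 * (E ^+ 2 * (2 * S0) ^+ 2) = (E * (4 * S0)) ^+ 2); last by ring.
  rewrite sqrtr_sqr ger0_norm ?mulr_ge0 ?(ltW S00) // => s2.
  have : sumle (fun k => normc (Lam 0 (fhat (u t)) k)) E; last by [].
  apply: (le_sumle _ _ s2) => [k|]; last first.
    by rewrite -[leRHS]mulr1 ler_wpM2l //; move: S01; rewrite -[8^-1]div1r ler_pdivlMr //; lra.
  rewrite normc_Lam lam0; have [->|k0] := eqVneq k 0.
    by rewrite mul0r mulr_ge0 ?invsq_ge0 // mulr_ge0.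
  rewrite mul1r -ler_pdivrMl ?invr_gt0 ?(lt_le_trans ltr01) ?int_sqr_ge1 // invrK; exact: ub.
move=> r r2.
have sr : sumle (hsum r (u t)) (E ^+ 2 * (2 * S0) ^+ 2).
  apply: (le_sumle _ (lexx _) EN) => k; rewrite /hsum.
  rewrite ler_pXn2r ?nnegrE ?mulr_ge0 ?lam_ge0 ?normc_ge0 //.
  apply: le_trans (ub k); rewrite -lam2 ler_wpM2r ?normc_ge0 // lam_le //.
split; first by apply/inHsE; split=> //; exists (E ^+ 2 * (2 * S0) ^+ 2).
apply: le_trans EE; rewrite -(ler_pXn2r (n := 2)) ?nnegrE ?Hnorm_ge0 //.
apply: (le_trans (Hnorm_le u1 sr)); rewrite mulrCA -[leRHS]mulr1; apply: (ler_wpM2l (sqr_ge0 _)).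
have s2 : S0 ^+ 2 <= 8^-1 ^+ 2 by rewrite ler_pXn2r ?nnegrE ?(ltW S00) ?invr_ge0.
apply: (@le_trans _ _ (8 * (2 ^+ 2 * 8^-1 ^+ 2))); last by lra.
by apply: ler_pM; [exact: ltW|exact: sqr_ge0|lra|rewrite exprMn; lra].
Qed.

End WellPosedness.

Theorem theorem2 (R : realType) :
  exists (C : R) (rate : R -> R -> R),
    0 < C /\
    (forall delta r : R, 0 < delta -> 0 <= r < 2 -> 0 < rate delta r) /\
    forall eps delta beta : R, 0 < eps -> 0 < delta -> 0 <= beta ->
      (exists Tstar : R -> R,
         (forall m : R, 0 < Tstar m) /\
         forall u0 : R -> R, inHs 2 u0 ->
           exists u : R -> R -> R,
             unique_strong_solution eps delta beta
               `[0, Tstar (Hnorm 2 u0)] u0 u) /\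
      (exists c0 : R,
         0 < c0 /\
         forall u0 : R -> R, inHs 2 u0 -> Hnorm 2 u0 <= c0 ->
           exists u : R -> R -> R,
             unique_strong_solution eps delta beta `[0, +oo[ u0 u /\
             (eps <= 1 -> forall t : R, 0 <= t ->
                (Wnorm 0 (u t) <= (C * expR (- (delta / 2) * t))%:E)%E /\
                (forall r : R, 0 <= r < 2 ->
                   inHs r (u t) /\
                   Hnorm r (u t) <= C * expR (- rate delta r * t)))).
Proof.
(* The smallness of the data absorbs the constant, and the rate of H^2 passes to every smaller r,
   since [lam] increases with the exponent. *)
exists 1, (fun delta _ => delta / 2); split=> //; split=> [delta r d0 _|eps delta beta e0 d0 b0].
  by rewrite divr_gt0.
split.
  (* Existence times are chosen per value of the norm, before any initial datum. *)
  have /choice [Ts hT] := local_existence e0 d0 b0.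
  exists Ts; split=> [m|u0 hu]; first by have [] := hT m.
  by have [_ h] := hT (Hnorm 2 u0); exact: h.
have [c0 [c00 h]] := global_existence e0 d0 b0.
exists c0; split=> // u0 hu hm; have [u [su du]] := h u0 hu hm.
exists u; split=> // eps1 t t0; have [h1 h2] := du eps1 t t0.
split; first by rewrite mul1r.
by move=> r /andP[_ r2]; rewrite mul1r; apply: h2; exact: ltW.
Qed.
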